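(* Let $1\le k\le L$ and $y\in\mathbb R$. The joint probability distribution of $m(\mathcal Y_k)=\min\{X(s):0\le s\le\mathcal Y_k\}$ and $X(\mathcal Y_k)$, given the initial level $0$ and the initial phase, is as follows. (a) If $x<0$, then $$\mathcal P^{\boldsymbol\eta}_+(x,y,k)=\sum_{n=0}^{k-1}\Psi^{(n)}\mathcal P^{\boldsymbol\eta}_-(x,y,k-n),\qquad \mathcal P^{\boldsymbol\eta}_-(x,y,k)=\sum_{n=0}^{k-1}W^{(n)}_{|x|}\,\boldsymbol r_-(y-x,k-n).$$ (b) If $x\ge0$, then $\mathcal P^{\boldsymbol\eta}_+(x,y,k)=\boldsymbol r_+(y,k)$ and $\mathcal P^{\boldsymbol\eta}_-(x,y,k)=\boldsymbol r_-(y,k)$.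
   Context: Random walk: $\{\varphi(t)\}_{t\ge0}$ is a continuous-time Markov chain on a finite set $\mathcal S=\{1,\dots,m\}$ (phases) with infinitesimal generator $A$; each phase $i$ has a rate $c_i\in\mathbb R\setminus\{0\}$; $\mathcal S_+=\{i:c_i>0\}$, $\mathcal S_-=\{i:c_i<0\}$; $A$ is partitioned accordingly into blocks $A_{++},A_{+-},A_{-+},A_{--}$, and $C_\pm=\mathrm{diag}(c_i:i\in\mathcal S_\pm)$, $|C_-|=-C_-$. The level is $X(t)=X(0)+\int_0^t c_{\varphi(s)}\,ds$. Erlang clock: $\nu>0$ and an integer $L\ge1$ are fixed; $Y_1,Y_2,\dots$ are i.i.d. exponential random variables with parameter $\nu$, independent of $\varphi$ and $X$; $\mathcal Y_k=\sum_{n=1}^kY_n$ ($\mathcal Y_0=0$), $T=\mathcal Y_L$. For $t<T$ the stage at time $t$ is $\phi(t)=n$ if $\mathcal Y_n\le t<\mathcal Y_{n+1}$, $0\le n\le L-1$. Put $\Phi(t)=(\varphi(t),\phi(t))$; for a random time $\tau$, ''$\Phi(\tau)=(j,n)$'' means $\tau<\infty$, $\varphi(\tau)=j$ and $\mathcal Y_n\le\tau<\mathcal Y_{n+1}$. $\mathbb P_i^a[\cdot]=\mathbb P[\cdot\mid X(0)=a,\varphi(0)=i]$ (initial stage $0$). With $\tau_-(x)=\inf\{t>0:X(t)<x\}$, for $0\le n\le L-1$: $\Psi^{(n)}_{ij}=\mathbb P_i^0[\Phi(\tau_-(0))=(j,n)]$, $i\in\mathcal S_+$, $j\in\mathcal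 S_-$. Let $U$ be the $L\times L$ block upper-triangular, block-Toeplitz matrix whose first block row is $(U^{(0)},\dots,U^{(L-1)})$, with $U^{(0)}=|C_-|^{-1}(A_{--}-\nu I)+|C_-|^{-1}A_{-+}\Psi^{(0)}$, $U^{(1)}=\nu|C_-|^{-1}+|C_-|^{-1}A_{-+}\Psi^{(1)}$ and $U^{(n)}=|C_-|^{-1}A_{-+}\Psi^{(n)}$ for $n\ge2$ (generator of the downward records of $X$ before $T$). For $x\ge0$ the matrices $W^{(0)}_x,\dots,W^{(L-1)}_x$ are the blocks of the first block row of $\exp(Ux)$; the entry $[W^{(n)}_x]_{uv}$ ($u,v\in\mathcal S_-$) is the probability that the random walk started at level $x$ in phase $u$ first reaches level $0$ in phase $v$ during stage $n$. $r_i(x,k)=\mathbb P_i^0[X(\mathcal Y_k)\le x]$ and $\mathcal P^{\boldsymbol\eta}_i(x,y,k)=\mathbb P_i^0[m(\mathcal Y_k)\le x,\ X(\mathcal Y_k)\le y]$ for $i\in\mathcal S$; the corresponding vectors have subvectors with subscripts $\pm$ indexed by $\mathcal S_\pm$. *)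

(* Defs.v *)
From HB Require Import structures.
From mathcomp Require Import all_boot all_order all_algebra finmap.
From mathcomp Require Import all_classical all_reals all_analysis.

Set Implicit Arguments.
Unset Strict Implicit.
Unset Printing Implicit Defensive.

Import Order.TTheory GRing.Theory Num.Theory.
Import numFieldNormedType.Exports.

Local Open Scope classical_set_scope.
Local Open Scope ring_scope.

(* exp(M) = \sum_k M^k / k!, with entrywise convergence. *)
Definition expm (R : realType) (n : nat) (M : 'M[R]_n) : 'M[R]_n :=
  \matrix_(i, j) limn (series (fun k => (M ^+ k) i j / k`!%:R)).

Definition is_generator (R : realType) (m : nat) (A : 'M[R]_m) : Prop :=
  (forall i j, i != j -> 0 <= A i j) /\ (forall i, \sum_j A i j = 0).

(* Mutual independence of a family of classes of events. *)
Definition independent_classes d (T : measurableType d) (R : realType)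
    (P : probability T R) (I : choiceType) (G : I -> set (set T)) : Prop :=
  forall (F : {fset I}) (E : I -> set T),
    (forall i, i \in F -> G i (E i)) ->
    P (\bigcap_(i in [set` F]) E i) = (\prod_(i <- F) P (E i))%E.

Section RandomWalk.
Context {R : realType} {m : nat} {d : measure_display}
  {Omega : measurableType d}.
(* [P i] is the law given that the initial phase is i; only the values
   [phi t] with 0 <= t are meaningful. *)
Variables (P : 'I_m -> probability Omega R) (phi : R -> Omega -> 'I_m).

(* Transition function exp(tA), through the finite-dimensional distributions
   (n = 0 gives P_i[phi(0) = i] = 1), together with cadlag paths for the
   discrete topology. *)
Record is_markov_chain (A : 'M[R]_m) : Prop := {
  chain_measurable : forall t j, 0 <= t ->
    measurable [set w | phi t w = j];
  chain_right_continuous : forall t w, 0 <= t ->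
    \forall s \near t^'+, phi s w = phi t w;
  chain_left_limit : forall t w, 0 < t ->
    exists j, \forall s \near t^'-, phi s w = j;
  chain_fdd : forall (i : 'I_m) (n : nat) (t : nat -> R) (j : nat -> 'I_m),
    t 0%N = 0 -> (forall l, t l <= t l.+1) -> j 0%N = i ->
    P i [set w | forall l, (l <= n)%N -> phi (t l) w = j l] =
    (\prod_(l < n) expm ((t l.+1 - t l) *: A) (j l) (j l.+1))%:E }.

Definition sigma_phi : set (set Omega) :=
  <<s [set E | exists t j, 0 <= t /\ E = [set w | phi t w = j]] >>.

(* [Y n] is the (n+1)-st exponential variable Y_{n+1}. *)
Variable Y : nat -> {mfun Omega >-> R}.

(* None stands for the phase process, Some n for the variable [Y n]; the level
   is a function of the phase process. *)
Definition clock_classes (o : option nat) : set (set Omega) :=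
  if o is Some n then preimage_set_system setT (Y n) measurable
  else sigma_phi.

Definition is_erlang_clock (nu : R) : Prop :=
  (forall i n B, measurable B ->
     distribution (P i) (Y n) B = exponential_prob nu B) /\
  (forall i, independent_classes (P i) clock_classes).

Definition clock (k : nat) (w : Omega) : R := \sum_(n < k) Y n w.

Variable c : 'I_m -> R.

Definition level (a t : R) (w : Omega) : R :=
  a + \int[lebesgue_measure]_(s in `[0, t]) c (phi s w).

(* The infimum is a minimum, since t |-> level a t w is continuous. *)
Definition level_min (a t : R) (w : Omega) : R :=
  inf [set level a s w | s in `[0, t]].

(* tau_-(x); equal to +oo when the level never goes below x. *)
Definition tau_minus (a x : R) (w : Omega) : \bar R :=
  ereal_inf [set t%:E | t in [set t : R | 0 < t /\ level a t w < x]].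

(* "Phi(tau) = (j, n)", including tau < +oo. *)
Definition phase_stage_at (tau : Omega -> \bar R) (j : 'I_m) (n : nat) :
    set Omega :=
  [set w | exists t : R, [/\ tau w = t%:E, phi t w = j
                           & clock n w <= t < clock n.+1 w]].

Definition Sp : {set 'I_m} := [set i : 'I_m | 0 < c i]%SET.
Definition Sm : {set 'I_m} := [set i : 'I_m | c i < 0]%SET.
Definition phase_plus (i : 'I_#|Sp|) : 'I_m := enum_val i.
Definition phase_minus (i : 'I_#|Sm|) : 'I_m := enum_val i.

Definition Psi (n : nat) : 'M[R]_(#|Sp|, #|Sm|) :=
  \matrix_(i, j)
    fine (P (phase_plus i) (phase_stage_at (tau_minus 0 0) (phase_minus j) n)).

Definition r_vec (y : R) (k : nat) (i : 'I_m) : R :=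
  fine (P i [set w | level 0 (clock k w) w <= y]).

Definition P_vec (x y : R) (k : nat) (i : 'I_m) : R :=
  fine (P i [set w | level_min 0 (clock k w) w <= x /\
                     level 0 (clock k w) w <= y]).

Definition subp (v : 'I_m -> R) : 'cV[R]_#|Sp| := \col_i v (phase_plus i).
Definition subm (v : 'I_m -> R) : 'cV[R]_#|Sm| := \col_i v (phase_minus i).

Section DownwardRecords.
Variables (A : 'M[R]_m) (nu : R).

Definition A_mm : 'M[R]_#|Sm| := mxsub phase_minus phase_minus A.
Definition A_mp : 'M[R]_(#|Sm|, #|Sp|) := mxsub phase_minus phase_plus A.
Definition absCm : 'M[R]_#|Sm| := diag_mx (\row_i (- c (phase_minus i))).

Definition U_block (n : nat) : 'M[R]_#|Sm| :=
  let rec_part := invmx absCm *m A_mp *m Psi n in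
  match n with
  | 0 => invmx absCm *m (A_mm - nu%:M) + rec_part
  | 1 => nu *: invmx absCm + rec_part
  | _ => rec_part
  end.

Definition U_mx (L : nat) : 'M[R]_(\sum_(i < L) #|Sm|) :=
  \mxblock_(i < L, j < L) (if (i <= j)%N then U_block (j - i) else 0).

Definition first_ord (L : nat) (n : 'I_L) : 'I_L :=
  Ordinal (leq_ltn_trans (leq0n n) (ltn_ord n)).

Definition W_block (L : nat) (x : R) (n : 'I_L) : 'M[R]_#|Sm| :=
  submxblock (expm (x *: U_mx L)) (first_ord n) n.

End DownwardRecords.

End RandomWalk.

(* Main.v *)
Require Import Defs.
From HB Require Import structures.
From mathcomp Require Import all_boot all_order all_algebra finmap.
From mathcomp Require Import all_classical all_reals all_analysis.
From mathcomp Require Import measurable_realfun ring lra.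

Set Implicit Arguments.
Unset Strict Implicit.
Unset Printing Implicit Defensive.

Import Order.TTheory GRing.Theory Num.Theory.
Import numFieldNormedType.Exports.

Local Open Scope classical_set_scope.
Local Open Scope ring_scope.

(** Why the formulas hold.  Let [T] be the first time at which the level is below
    [- z], for some [z >= 0].  At time [T] the phase [j] is descending and the level
    is exactly [- z].  If [n] of the exponential variables are exhausted at that
    time, the memoryless property leaves a clock with [k - n] variables, and by the
    strong Markov property the walk starts afresh from phase [j].  Hence, for an
    event which implies that [T] precedes the clock,

      P_i (event) = sum over n < k and j of
         V n z i j * P_j (event seen from time T, with k - n variables),

    where [V n z i j], written [passage_prob] below, is the probability to be in
    phase [j] and in stage [n] at time [T].  This is [first_passage_decomposition].

    The formulas of part (a) are the cases [z = 0] and [z = - x].  For [z = 0] the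
    event is seen unchanged from time [T], and [V n 0] is the matrix Psi of index
    [n] on the ascending phases ([stage_law]).  For [z = - x] there remains only a
    condition on the final level; the event is then that the minimum is less than
    [x], which differs from the event of the statement by a null event, because
    [V] depends continuously on [z] ([after_passages_limit]).  Part (b) holds
    because the minimum is at most the initial level.

    It remains to see that [V n z], on the descending phases, is the [n]-th block of
    the first row of [exp (z U)] ([W_block_passage]).  A step of duration [h] of the
    walk gives the backward equation

      V n z i j = V n (z + c_i h) i j + h * backward_rate n z i j + O(h^2)

    ([O_backward]), an ordinary differential equation in [z] when [c_i < 0].  Its
    right-hand side also involves ascending phases; a passage that starts in one
    of these is a return to the initial level followed by a passage from a
    descending phase ([passage_from_plus]), and eliminating them produces the
    matrix U ([generator_passage]).  The block-Toeplitz matrix [M z] of the blocks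
    [V n z] thus solves [M' = U M].  It is the identity at [z = 0] and bounded, so
    that it is the exponential ([ode_expm]).

    All this takes place on the space of right-continuous phase paths, where the
    Markov property is derived from the finite-dimensional distributions, and the
    strong Markov property from discrete approximations of [T] from above.  The
    weight of a path in [V n z i j] is the Poisson probability of [n] points before
    [T], so that the clock itself only enters through the law of the pair of the
    path and the clock ([joint_law]). *)

(** * Weighted images of measures *)

Section weighted_image.
Local Open Scope ereal_scope.
Context d1 d2 (T1 : measurableType d1) (T2 : measurableType d2) (R : realType).
Variables (mu : {measure set T1 -> \bar R}) (th : T1 -> T2) (w : T1 -> R).

(** The image by [th] of the measure of density [w] with respect to [mu]. The
    proofs serve as arguments so that the measure structure depends on them. *)
Definition weighted_image (_ : measurable_fun setT th) (_ : measurable_fun setT w)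
    (_ : forall x, (0 <= w x)%R) (A : set T2) : \bar R :=
  \int[mu]_(x in th @^-1` A) (w x)%:E.

Hypotheses (mth : measurable_fun setT th) (mw : measurable_fun setT w).
Hypothesis w0 : forall x, (0 <= w x)%R.

Let measurable_preimage A : measurable A -> measurable (th @^-1` A).
Proof. by move=> mA; rewrite -[X in measurable X]setTI; exact: mth. Qed.

Local Notation image := (weighted_image mth mw w0).

Let image0 : image set0 = 0.
Proof. by rewrite /weighted_image preimage_set0 integral_set0. Qed.

Let image_ge0 A : 0 <= image A.
Proof. by apply: integral_ge0 => x _; rewrite lee_fin. Qed.

Let image_sigma_additive : semi_sigma_additive image.
Proof.
move=> F mF tF mUF; rewrite /weighted_image preimage_bigcup; apply: cvg_toP.
  apply: ereal_nondecreasing_is_cvgn => m n mn.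
  apply: lee_sum_nneg_natr => // k _ _.
  by apply: integral_ge0 => x _; rewrite lee_fin.
rewrite ge0_integral_bigcup//=.
- by move=> k; exact: measurable_preimage.
- by apply/measurable_funTS/measurable_EFinP.
- by move=> x _; rewrite lee_fin.
- apply/trivIsetP => /= i j _ _ ij; rewrite -preimage_setI.
  by move/trivIsetP : tF => /(_ _ _ I I ij) ->; rewrite preimage_set0.
Qed.

HB.instance Definition _ := isMeasure.Build _ _ _
  image image0 image_ge0 image_sigma_additive.

Import HBNNSimple.

(** It is enough to compare two measures on events in order to integrate; this
    turns uniqueness of measures into identities between integrals. *)
Lemma integral_transfer (nu : {measure set T2 -> \bar R}) (G : T2 -> \bar R) :
  (forall A, measurable A -> \int[mu]_(x in th @^-1` A) (w x)%:E = nu A) ->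
  measurable_fun setT G -> (forall y, 0 <= G y) ->
  \int[mu]_x ((w x)%:E * G (th x)) = \int[nu]_y G y.
Proof.
move=> nuE mG G0.
pose g := nnsfun_approx measurableT mG.
have mwg n : measurable_fun setT (fun x => (w x)%:E * (g n (th x))%:E).
  apply: emeasurable_funM; first exact/measurable_EFinP.
  by apply/measurable_EFinP; exact: measurableT_comp.
transitivity (limn (fun n => \int[mu]_x ((w x)%:E * (g n (th x))%:E))).
  rewrite -monotone_convergence//.
  - apply: eq_integral => x _; apply/esym/cvg_lim => //.
    by apply: cvgeZl => //; exact: cvg_nnsfun_approx.
  - by move=> n x _; rewrite mule_ge0// lee_fin.
  - move=> x _ m n mn; apply: lee_wpmul2l; first by rewrite lee_fin.
    by rewrite lee_fin; exact/lefP/nd_nnsfun_approx.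
transitivity (limn (fun n => \int[nu]_y (g n y)%:E)); last first.
  rewrite -monotone_convergence//.
  - by apply: eq_integral => y _; apply/cvg_lim => //; exact: cvg_nnsfun_approx.
  - by move=> n; exact/measurable_EFinP.
  - by move=> n y _; rewrite lee_fin.
  - by move=> y _ m n mn; rewrite lee_fin; exact/lefP/nd_nnsfun_approx.
congr (limn _); apply/funext => n.
have mgk k : measurable (g n @^-1` [set k]) by exact: measurable_sfunP.
transitivity (\sum_(k \in range (g n))
    \int[nu]_y (k * \1_(g n @^-1` [set k]) y)%:E); last first.
  rewrite -ge0_integral_fsum//.
  - by apply: eq_integral => y _; rewrite fsumEFin// -fimfunE.
  - by move=> r; exact/measurable_EFinP/measurable_funM.
  - by move=> r y _; rewrite nnfun_muleindic_ge0.
transitivity (\sum_(k \in range (g n))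
    \int[mu]_x ((w x)%:E * (k * \1_(g n @^-1` [set k]) (th x))%:E)).
  rewrite -ge0_integral_fsum//.
  - apply: eq_integral => x _.
    rewrite -ge0_mule_fsumr ?fsumEFin// -?fimfunE// => r.
    exact: nnfun_muleindic_ge0.
  - move=> r; apply: emeasurable_funM; first exact/measurable_EFinP.
    apply/measurable_EFinP/measurable_funM => //.
    by apply: measurableT_comp => //; exact: measurable_indic.
  - move=> r x _; apply: mule_ge0; first by rewrite lee_fin.
    exact: nnfun_muleindic_ge0.
apply: eq_fsbigr => r; rewrite inE => -[y _ gy].
have r0 : (0 <= r)%R by rewrite -gy.
rewrite (@integralZl_indic _ _ _ _ _ _ (fun r => g n @^-1` [set r]))//; last first.
  by move=> r0'; rewrite preimage_nnfun0.
rewrite integral_indic// setIT -nuE// [in RHS]integral_mkcond.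
rewrite -ge0_integralZl//; last 2 first.
- apply/(measurable_restrictT _ _).1 => //; first exact: measurable_preimage.
  by apply/measurable_funTS/measurable_EFinP.
- by move=> x _; rewrite patchE; case: ifPn => // _; rewrite lee_fin.
apply: eq_integral => x _; rewrite patchE indicE.
have -> : (x \in th @^-1` (g n @^-1` [set r])) = (th x \in g n @^-1` [set r]) by [].
case: ifPn => _; rewrite ?mulr1 ?mulr0 ?mule0//.
by rewrite muleC.
Qed.

End weighted_image.

(** * The space of phase paths *)

(** A path is a function on the whole line, constrained at nonnegative times, so
    that no dependent type of times is needed. *)
Record trajectory (R : realType) (m : nat) := Path {
  state_at :> R -> 'I_m.+1;
  path_rc : forall t, 0 <= t -> \forall s \near t^'+, state_at s = state_at t }.

HB.instance Definition _ R m := gen_eqMixin (trajectory R m).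
HB.instance Definition _ R m := gen_choiceMixin (trajectory R m).

Section path_space.
Context {R : realType} {m : nat}.
Notation Pi := (trajectory R m).

Lemma const_path_rc (j : 'I_m.+1) (t : R) : 0 <= t ->
  \forall s \near t^'+, (fun=> j) s = j.
Proof. by move=> _; apply: nearW. Qed.

HB.instance Definition _ := isPointed.Build Pi (Path (@const_path_rc ord0)).

Definition coordinate_events : set (set Pi) :=
  [set E | exists (t : R) (j : 'I_m.+1), 0 <= t /\ E = [set f : Pi | f t = j]].

HB.instance Definition _ := Measurable.copy Pi (g_sigma_algebraType coordinate_events).

Lemma path_eq (f g : Pi) : (forall t, f t = g t) -> f = g.
Proof.
case: f g => [f hf] [g hg] /= fg.
have E : f = g by apply/funext.
by subst g; congr Path; exact: Prop_irrelevance.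
Qed.

Lemma measurable_coordinate (t : R) j : 0 <= t ->
  measurable [set f : Pi | f t = j].
Proof. by move=> t0; apply: sub_sigma_algebra; exists t, j. Qed.

Lemma measurable_to_path d (T : measurableType d) (p : T -> Pi) :
  (forall t j, 0 <= t -> measurable [set x | p x t = j]) ->
  measurable_fun setT p.
Proof.
move=> h; apply: (@measurability _ _ _ _ _ _ coordinate_events) => //.
by move=> _ [_ [t [j [t0 ->]]] <-]; rewrite setTI; exact: h.
Qed.

Lemma near_right_itv (P : R -> Prop) (t : R) :
  (\forall s \near t^'+, P s) <->
  exists2 e, 0 < e & forall s, t < s < t + e -> P s.
Proof.
split.
- move=> [e /= e0 h]; exists e => // s /andP[ts se]; apply: h => //=.
  by rewrite distrC gtr0_norm ?subr_gt0// ltrBlDl.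
- move=> [e e0 h]; exists e => //= s /=.
  move=> tse ts; apply: h; rewrite ts/=.
  by move: tse; rewrite distrC gtr0_norm ?subr_gt0// ltrBlDl.
Qed.

Lemma path_constant_right (f : Pi) (t : R) : 0 <= t ->
  exists2 e, 0 < e & forall s, t <= s < t + e -> f s = f t.
Proof.
move=> t0; have /near_right_itv[e e0 h] := @path_rc _ _ f t t0.
exists e => // s /andP[]; rewrite le_eqVlt => /orP[/eqP->//|ts st].
by apply: h; rewrite ts.
Qed.

Lemma shift_rc (s : R) (f : Pi) (t : R) : 0 <= t ->
  \forall u \near t^'+, f (`|s| + u) = f (`|s| + t).
Proof.
move=> t0; apply/near_right_itv.
have [e e0 h] := path_constant_right f (addr_ge0 (normr_ge0 s) t0).
exists e => // u /andP[tu ut]; apply: h.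
by rewrite lerD2l (ltW tu)/= -addrA ltrD2l.
Qed.

(** The absolute value makes the shift by a negative time a path as well. *)
Definition shift (s : R) (f : Pi) : Pi := Path (@shift_rc s f).

Lemma stop_rc (s : R) (f : Pi) (t : R) : 0 <= t ->
  \forall u \near t^'+, f (Num.min u `|s|) = f (Num.min t `|s|).
Proof.
move=> t0; have [ts|st] := ltP t `|s|.
- have := @path_rc _ _ f t t0 => h.
  near=> u.
  have us : u < `|s| by near: u; exact: nbhs_right_lt.
  rewrite (min_idPl (ltW us)).
  by near: u.
- near=> u.
  by rewrite (min_idPr _)// (le_trans st)//; near: u; exact: nbhs_right_ge.
Unshelve. all: by end_near. Qed.

Definition stop (s : R) (f : Pi) : Pi := Path (@stop_rc s f).

Lemma shiftE s f t : 0 <= s -> shift s f t = f (s + t).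
Proof. by move=> s0; rewrite /= ger0_norm. Qed.

Lemma stopE s f t : 0 <= s -> stop s f t = f (Num.min t s).
Proof. by move=> s0; rewrite /= ger0_norm. Qed.

Lemma stop_stop s r f : 0 <= s -> s <= r -> stop s (stop r f) = stop s f.
Proof.
move=> s0 sr; apply: path_eq => t.
rewrite !stopE ?(le_trans s0 sr)//; congr (f _).
by rewrite -minA (min_idPl sr).
Qed.

Lemma measurable_shift s : measurable_fun setT (shift s).
Proof.
apply: measurable_to_path => t j t0.
by apply: measurable_coordinate; rewrite addr_ge0.
Qed.

Lemma measurable_stop s : measurable_fun setT (stop s).
Proof.
apply: measurable_to_path => t j t0.
by apply: measurable_coordinate; rewrite le_min t0 normr_ge0.
Qed.

(** The point of the grid of mesh [1 / n.+1] strictly above [s]: as paths are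
    constant for a while after each time, approximating a time from above keeps
    track of the phase at that time. *)
Definition up (n : nat) (s : R) : R := (Num.truncn (s * n.+1%:R)).+1%:R / n.+1%:R.

Lemma up_gt n s : s < up n s.
Proof. by rewrite ltr_pdivlMr ?ltr0n// truncnS_gt. Qed.

Lemma up_le n s : 0 <= s -> up n s <= s + n.+1%:R^-1.
Proof.
move=> s0; rewrite /up ler_pdivrMr ?ltr0n// mulrDl mulVf ?pnatr_eq0//.
rewrite -natr1 lerD2r.
have /truncn_itv /andP[] // : 0 <= s * n.+1%:R by rewrite mulr_ge0.
Qed.

Lemma cvg_up s : 0 <= s -> up n s @[n --> \oo] --> s.
Proof.
move=> s0; apply: (@squeeze_cvgr _ _ _ _ (fun=> s) (fun n => s + n.+1%:R^-1)).
- by apply: nearW => n; rewrite (ltW (up_gt n s)) up_le.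
- exact: cvg_cst.
- rewrite -[X in _ --> X]addr0; apply: cvgD; first exact: cvg_cst.
  exact: cvg_harmonic.
Qed.

Lemma path_up (f : Pi) (s : R) : 0 <= s -> \forall n \near \oo, f (up n s) = f s.
Proof.
move=> s0; have [e e0 h] := path_constant_right f s0.
have /cvgrPdist_lt/(_ _ e0) := cvg_up s0.
apply: filterS => n hn; apply: h; rewrite (ltW (up_gt n s))/=.
by move: hn; rewrite distrC gtr0_norm ?subr_gt0 ?up_gt// ltrBlDl.
Qed.

Lemma measurable_coordinate_up n j :
  measurable [set x : R * Pi | 0 <= x.1 /\ x.2 (up n x.1) = j].
Proof.
rewrite (_ : [set _ | _] = \bigcup_l ([set s : R | 0 <= s /\
    l%:R <= s * n.+1%:R < l.+1%:R] `*` [set f : Pi | f (l.+1%:R / n.+1%:R) = j])).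
  apply: bigcupT_measurable => l; apply: measurableX.
  - rewrite (_ : [set _ | _] = `[0, +oo[ `&` `[l%:R / n.+1%:R, l.+1%:R / n.+1%:R[%classic).
      by apply: measurableI; exact: measurable_itv.
    apply/seteqP; split => s /=; rewrite !in_itv/= ?andbT.
      by move=> [-> /andP[h1 h2]]; rewrite ler_pdivrMr ?ltr0n// ltr_pdivlMr ?ltr0n// h1 h2.
    by rewrite ler_pdivrMr ?ltr0n// ltr_pdivlMr ?ltr0n// => -[-> ->].
  - exact: measurable_coordinate.
apply/seteqP; split => -[s f] /=.
  move=> [s0 fs]; exists (Num.truncn (s * n.+1%:R)) => //=; split => //.
  by split => //; apply: truncn_itv; rewrite mulr_ge0.
move=> [l _ [/= [s0 sl] fl]]; split => //.
by rewrite /up (truncn_def sl).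
Qed.

(** The phase at [s] is the eventual value at the grid points above [s]; this
    makes the evaluation jointly measurable in time and path. *)
Lemma measurable_path_graph j :
  measurable [set x : R * Pi | 0 <= x.1 /\ x.2 x.1 = j].
Proof.
rewrite (_ : [set _ | _] = \bigcup_N \bigcap_(n in [set n | (N <= n)%N])
    [set x : R * Pi | 0 <= x.1 /\ x.2 (up n x.1) = j]).
  apply: bigcupT_measurable => N; apply: bigcap_measurable => [|n _]; first by exists N => /=.
  exact: measurable_coordinate_up.
apply/seteqP; split => -[s f] /=.
  move=> [s0 fs]; have [N _ hN] := path_up f s0.
  by exists N => // n /= Nn; split => //; rewrite (hN n Nn).
move=> [N _ h]; have [s0 _] := h N (leqnn N); split => //.
have [N' _ hN] := path_up f s0.
rewrite -(hN (maxn N N')) ?/= ?leq_maxr//.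
by have [] := h (maxn N N') (leq_maxl _ _).
Qed.

Lemma measurable_state_at d (T : measurableType d) (a : T -> R) (p : T -> Pi) j :
  measurable_fun setT a -> measurable_fun setT p ->
  measurable [set x | 0 <= a x /\ p x (a x) = j].
Proof.
move=> ma mp.
have mF : measurable_fun setT (fun x => (a x, p x)) by exact: measurable_fun_pair.
have := mF measurableT _ (measurable_path_graph j).
by rewrite setTI.
Qed.

End path_space.

(** * The level along a path *)

Section path_level.
Context {R : realType} {m : nat}.
Notation Pi := (trajectory R m).
Variable c : 'I_m.+1 -> R.
Notation mu := (@lebesgue_measure R).
Implicit Types (s t u : R) (f g : Pi) (i j : 'I_m.+1).

Lemma measurable_rate_state d (T : measurableType d) (a : T -> R) (p : T -> Pi) :
  measurable_fun setT a -> measurable_fun setT p ->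
  measurable_fun [set x | 0 <= a x] (fun x => c (p x (a x))).
Proof.
move=> ma mp _ B mB.
rewrite (_ : _ `&` _ = \bigcup_(j in [set j | B (c j)]) [set x | 0 <= a x /\ p x (a x) = j]).
  apply: fin_bigcup_measurable => [|j _]; last exact: measurable_state_at.
  exact: finite_finset.
apply/seteqP; split => x /=; first by move=> [a0 Bc]; exists (p x (a x)).
by move=> [j Bj [a0 ->]].
Qed.

Definition rate_bound : R := 1 + \sum_j `|c j|.

Lemma rate_bound_gt0 : 0 < rate_bound.
Proof. by rewrite ltr_pwDl// sumr_ge0. Qed.

Lemma rate_le_bound j : `|c j| <= rate_bound.
Proof.
by rewrite /rate_bound (bigD1 j)//= addrCA lerDl addr_ge0// sumr_ge0.
Qed.

Lemma measurable_rate_path (f : Pi) (D : set R) : measurable D -> D `<=` [set s : R | 0 <= s] ->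
  measurable_fun D (fun s => c (f s)).
Proof.
move=> mD D0; apply: (@measurable_funS _ _ _ _ [set s : R | 0 <= s]) => //.
  rewrite (_ : [set _ | _] = `[0, +oo[%classic); first exact: measurable_itv.
  by apply/seteqP; split => s /=; rewrite in_itv/= andbT.
by apply: (@measurable_rate_state _ _ id (cst f)) => //; exact: measurable_id.
Qed.

Lemma integrable_rate (f : Pi) (i : interval R) :
  [set` i] `<=` [set s : R | 0 <= s] -> (mu [set` i] < +oo)%E ->
  mu.-integrable [set` i] (EFin \o (fun s => c (f s))).
Proof.
move=> i0 ioo; apply: measurable_bounded_integrable => //.
  exact: measurable_rate_path.
exists rate_bound; split; first exact: num_real.
by move=> M hM s _ /=; rewrite (le_trans (rate_le_bound _))// ltW.
Qed.

Lemma integrable_rate_itv (f : Pi) (b b' : bool) (s t : R) : 0 <= s ->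
  mu.-integrable [set` Interval (BSide b s) (BSide b' t)] (EFin \o (fun s => c (f s))).
Proof.
move=> s0; apply: integrable_rate.
  by move=> u /=; case: b; rewrite in_itv/= => /andP[su _];
    rewrite (le_trans s0)// ltW.
by rewrite lebesgue_measure_itv/=; case: ifP => // _; rewrite -EFinD ltry.
Qed.

Lemma lebesgue_itv0c (b : bool) t : 0 <= t ->
  mu [set` Interval (BLeft 0) (BSide b t)] = t%:E.
Proof.
rewrite lebesgue_measure_itv/= lte_fin le_eqVlt => /orP[/eqP<-|->].
  by rewrite ltxx.
by rewrite -EFinB subr0.
Qed.

Definition lev (f : Pi) (t : R) : R := \int[mu]_(s in `[0, t]) c (f s).

Lemma lev_lt0 f t : t < 0 -> lev f t = 0.
Proof. by move=> t0; rewrite /lev set_itv_ge ?Rintegral_set0// bnd_simp -ltNge. Qed.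

Lemma lev0 f : lev f 0 = 0.
Proof. by rewrite /lev set_itv1 Rintegral_set1. Qed.

Lemma lev_bound f t : 0 <= t -> `|lev f t| <= rate_bound * t.
Proof.
move=> t0; apply: le_trans (le_normr_Rintegral _ _) _ => //.
  exact: integrable_rate_itv.
have -> : rate_bound * t = \int[mu]_(s in `[0, t]) rate_bound.
  by rewrite Rintegral_cst//= lebesgue_itv0c.
apply: le_Rintegral => //.
- have := @integrable_rate_itv f true false 0 t (lexx _).
  by move/(integrable_norm); apply.
- apply: measurable_bounded_integrable => //.
    by rewrite /= lebesgue_itv0c// ltry.
  exists rate_bound; split; first exact: num_real.
  by move=> M hM u _ /=; rewrite ger0_norm ?ltW// rate_bound_gt0.
- by move=> u _; exact: rate_le_bound.
Qed.

(** Translation invariance of the Lebesgue measure, as a change of variables. *)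
Lemma integral_translation s (F : R -> \bar R) (D : set R) :
  measurable_fun setT F -> measurable D ->
  mu.-integrable ((fun u => s + u)%R @^-1` D) (F \o (fun u => s + u)%R) ->
  (\int[mu]_(u in D) F u = \int[mu]_(u in (fun u => s + u)%R @^-1` D) F (s + u)%R)%E.
Proof.
move=> mF mD iF.
have mf : measurable_fun setT (fun u : R => s + u) by exact: measurable_funD.
pose nu : {measure set (measurableTypeR R) -> \bar R} :=
  @measure_function_pushforward__canonical__measure_function_Measure
    _ _ (measurableTypeR R) (measurableTypeR R) R mu (fun u => s + u) mf.
have nuE A : measurable A -> mu A = nu A.
  apply: lebesgue_measure_unique => _ [[a b] _ <-] /=.
  rewrite /nu /= /pushforward (_ : _ @^-1` _ = `]a - s, b - s]%classic); last first.
    by apply/seteqP; split => u /=; rewrite !in_itv/= ltrBlDl lerBrDl.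
  rewrite !lebesgue_measure_itv/= !lte_fin ltrD2r; case: ifP => // _.
  by rewrite -!EFinB; congr EFin; ring.
rewrite -(@eq_measure_integral _ (measurableTypeR R) R D mu nu); last first.
  by move=> A mA _; rewrite [RHS]nuE.
exact: (@integral_pushforward _ _ (measurableTypeR R) (measurableTypeR R) R
  (fun u => s + u) mf mu D F mF iF mD).
Qed.

Lemma lev_shift f s t : 0 <= s -> 0 <= t ->
  lev f (s + t) = lev f s + lev (shift s f) t.
Proof.
move=> s0 t0.
have I := @integrable_rate_itv f true false 0 (s + t) (lexx _).
have -> : lev (shift s f) t = \int[mu]_(u in `]s, s + t]) c (f u).
  rewrite /lev -Rintegral_itv_obnd_cbnd; last exact: integrable_rate_itv.
  rewrite /Rintegral; congr fine.
  pose F u := (c (f `|u|))%:E.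
  have mF : measurable_fun setT F.
    apply/measurable_EFinP; have := @measurable_rate_state _ R (fun u => `|u|) (cst f).
    rewrite (_ : [set x : R | _] = setT).
      by apply => //; exact: measurableT_comp.
    by apply/seteqP; split => u //= _.
  have pre : (fun u => s + u) @^-1` `]s, s + t]%classic = `]0, t]%classic.
    by apply/seteqP; split => u /=; rewrite !in_itv/= lerD2l ltrDl.
  transitivity (\int[mu]_(u in `]s, (s + t)%R]) F u)%E; last first.
    apply: eq_integral => u; rewrite inE/= in_itv/= => /andP[u0 _].
    by rewrite /F ger0_norm// (le_trans s0)// ltW.
  rewrite (integral_translation (s := s))// pre.
    apply: eq_integral => u; rewrite inE/= in_itv/= => /andP[u0 _].
    by rewrite /F /= !ger0_norm ?addr_ge0// ltW.
  have := @integrable_rate_itv (shift s f) false false 0 t (lexx _).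
  apply: eq_integrable => // u; rewrite inE/= in_itv/= => /andP[u0 _].
  by rewrite /F /= !ger0_norm ?addr_ge0// ltW.
rewrite -(@Rintegral_itvB _ _ _ _ s I) ?bnd_simp//; first by rewrite /lev [RHS]addrC subrK.
by rewrite lerDl.
Qed.

Lemma lev_lipschitz f s t : 0 <= s -> s <= t ->
  `|lev f t - lev f s| <= rate_bound * (t - s).
Proof.
move=> s0 st.
have -> : lev f t = lev f s + lev (shift s f) (t - s).
  by rewrite -lev_shift ?subr_ge0// [in RHS]addrC subrK.
by rewrite addrAC subrr add0r lev_bound// subr_ge0.
Qed.

Lemma eq_lev f g t : (forall u, 0 <= u <= t -> f u = g u) -> lev f t = lev g t.
Proof.
by move=> fg; apply: eq_Rintegral => u; rewrite inE/= in_itv/= => /fg ->.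
Qed.

Lemma lev_stop f s t : 0 <= s -> t <= s -> lev (stop s f) t = lev f t.
Proof.
move=> s0 ts; apply: eq_lev => u /andP[u0 ut].
by rewrite stopE// (min_idPl _)// (le_trans ut).
Qed.

Lemma lev_constant f t j : 0 <= t -> (forall u, 0 <= u < t -> f u = j) ->
  lev f t = c j * t.
Proof.
move=> t0 h; rewrite /lev -Rintegral_itv_bndo_bndc; last exact: integrable_rate_itv.
rewrite (@eq_Rintegral _ _ _ _ _ (fun=> c j)); last first.
  by move=> u; rewrite inE/= in_itv/= => /h ->.
by rewrite Rintegral_cst//= lebesgue_itv0c.
Qed.

(** The level is a Fubini integral of the rate over the times in [0, t]; the
    constant [C] makes the integrand nonnegative. *)
Lemma measurable_lev : measurable_fun setT (fun x : R * Pi => lev x.2 x.1).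
Proof.
pose C := rate_bound.
pose G (y : (R * Pi) * R) : \bar R :=
  if 0 <= y.2 <= y.1.1 then (c (y.1.2 y.2) + C)%:E else 0%E.
have G0 y : (0 <= G y)%E.
  rewrite /G; case: ifP => // _; rewrite lee_fin -lerBlDr sub0r.
  by have := rate_le_bound (y.1.2 y.2); rewrite ler_norml => /andP[].
have mG : measurable_fun setT G.
  apply: measurable_fun_if => //.
  - apply: measurable_and; apply: measurable_fun_ler => //.
    by apply: measurableT_comp => //; exact: measurable_fst.
  - apply/measurable_EFinP; apply: measurable_funD => //.
    apply: (@measurable_funS _ _ _ _ [set y : (R * Pi) * R | 0 <= y.2]).
    + rewrite -[X in measurable X]setTI.
      rewrite (_ : [set _ | _] = (snd @^-1` `[0, +oo[%classic)).
        by apply: measurable_snd => //; exact: measurable_itv.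
      by apply/seteqP; split => -[x u] /=; rewrite in_itv/= andbT.
    + by move=> [x u] [_ /= /andP[]].
    + apply: measurable_rate_state => //.
      by apply: measurableT_comp => //; exact: measurable_fst.
have := measurable_fun_fubini_tonelli_F (m2 := mu) G mG G0.
move=> mF.
rewrite (_ : (fun _ => _) = (fun x : R * Pi => fine (fubini_F mu G x) - C * Num.max 0 x.1)).
  apply: measurable_funB; first exact: measurableT_comp.
  apply: measurable_funM => //; apply: measurable_maxr => //.
apply/funext => -[t f] /=; rewrite /fubini_F /=.
have [t0|t0] := leP 0 t; last first.
  rewrite lev_lt0// mulr0 subr0 integral0_eq// => u _; rewrite /G /=.
  by case: ifP => // /andP[u0 /(le_trans u0)]; rewrite leNgt t0.
rewrite /= -[LHS](addrK (C * t)); congr (_ - _).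
have -> : C * t = \int[mu]_(s in `[0, t]) C.
  by rewrite Rintegral_cst//= lebesgue_itv0c.
rewrite /lev -RintegralD//; first last.
- apply: measurable_bounded_integrable => //.
    by rewrite /= lebesgue_itv0c// ltry.
  exists C; split; first exact: num_real.
  by move=> M hM u _ /=; rewrite ger0_norm ?ltW// rate_bound_gt0.
- exact: integrable_rate_itv.
rewrite /Rintegral integral_mkcond; congr fine; apply: eq_integral => u _.
by rewrite patchE /G /= mem_setE in_itv/=; case: ifP.
Qed.

End path_level.

(** * First passage times *)

Lemma measurable_bool_set d (T : measurableType d) (b : T -> bool) :
  measurable_fun setT b -> measurable [set x | b x].
Proof. by move=> mb; rewrite -[X in measurable X]setTI; apply: (mb measurableT [set true]). Qed.

Section hitting_times.
Context {R : realType} {m : nat}.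
Notation Pi := (trajectory R m).
Variable c : 'I_m.+1 -> R.
Notation lev := (lev c).
Notation C := (rate_bound c).
Implicit Types (r s t u z : R) (f : Pi) (j : 'I_m.+1).

(** The parameter is the depth [z] below the initial level [0], so that depths add
    up along a path, see [hit_add]. *)
Definition hit z f : \bar R :=
  ereal_inf [set t%:E | t in [set t : R | 0 < t /\ lev f t < - z]].

Lemma hit_ge0 z f : (0 <= hit z f)%E.
Proof. by apply: le_ereal_inf_tmp => _ [t [t0 _] <-]; rewrite lee_fin ltW. Qed.

Lemma hit_ltP z f r :
  (hit z f < r%:E)%E <-> exists2 t, 0 < t < r & lev f t < - z.
Proof.
split.
  by move/ereal_inf_lt => [_ [t [t0 ft] <-]]; rewrite lte_fin => tr; exists t => //; rewrite t0.
move=> [t /andP[t0 tr] ft]; apply: le_lt_trans (_ : _ <= t%:E)%E _; last by rewrite lte_fin.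
by apply: ereal_inf_lbound; exists t.
Qed.

(** The level being continuous, its passage below [- z] is seen at rational
    times, which makes the passage time measurable. *)
Lemma lev_rational z f r :
  (exists2 t, 0 < t < r & lev f t < - z) <->
  exists q : rat, (0 < (ratr q : R) < r) && (lev f (ratr q) < - z).
Proof.
split; last by move=> [q /andP[qr h]]; exists (ratr q : R).
move=> [t /andP[t0 tr] ft].
have C0 := rate_bound_gt0 c.
have : t < Num.min r (t + (- z - lev f t) / C).
  by rewrite lt_min tr ltrDl divr_gt0// subr_gt0.
move=> /rat_in_itvoo[q]; rewrite in_itv/= lt_min => /and3P[tq qr qt].
exists q; rewrite qr (lt_trans t0 tq)/=.
have := lev_lipschitz c f (ltW t0) (ltW tq).
move=> /(le_trans (ler_norm _)).
move: qt; rewrite -ltrBlDl ltr_pdivlMr// mulrC => qt h.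
lra.
Qed.

Lemma measurable_hit : measurable_fun setT (fun x : R * Pi => hit x.1 x.2).
Proof.
apply: (measurability _ (ErealGenCInfty.measurableE R)) => //.
move=> _ [_ [r ->] <-]; rewrite setTI.
rewrite (_ : _ @^-1` _ = ~` [set x : R * Pi | (hit x.1 x.2 < r%:E)%E]); last first.
  apply/seteqP; split => x /=; rewrite in_itv/= andbT leNgt; first by move/negP.
  by move=> ?; apply/negP.
apply: measurableC.
rewrite (_ : [set _ | _] = \bigcup_(q : rat) [set x : R * Pi |
    (0 < (ratr q : R) < r) && (lev x.2 (ratr q) < - x.1)]); last first.
  apply/seteqP; split => x /=.
    by move/hit_ltP/lev_rational => [q hq]; exists q.
  by move=> [q _ hq]; apply/hit_ltP/lev_rational; exists q.
apply: bigcupT_measurable_rat => q.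
have [qr|_] := boolP (0 < (ratr q : R) < r); last first.
  by rewrite (_ : [set _ | _] = set0)//; apply/seteqP; split.
apply: measurable_bool_set; apply: measurable_fun_ltr.
- have mq : measurable_fun setT (fun x : R * Pi => (ratr q : R, x.2)).
    by apply: measurable_fun_pair => //; exact: measurable_snd.
  exact: (measurableT_comp (measurable_lev c) mq).
- by apply: measurable_funN; exact: measurable_fst.
Qed.

Lemma measurable_hit_at d (T : measurableType d) (a : T -> R) (q : T -> Pi) :
  measurable_fun setT a -> measurable_fun setT q ->
  measurable_fun setT (fun x => hit (a x) (q x)).
Proof.
move=> ma mq; have mp : measurable_fun setT (fun x => (a x, q x)).
  exact: measurable_fun_pair.
exact: (measurableT_comp measurable_hit mp).
Qed.

Lemma hit_stop z f r : 0 <= r ->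
  (hit z (stop r f) < r%:E)%E <-> (hit z f < r%:E)%E.
Proof.
move=> r0; split=> /hit_ltP[t tr h]; apply/hit_ltP; exists t => //.
  by move: h; rewrite lev_stop//; case/andP: tr => _ /ltW.
by rewrite lev_stop//; case/andP: tr => _ /ltW.
Qed.

Lemma before_hit z f t : 0 <= z -> 0 <= t -> (t%:E <= hit z f)%E ->
  - z <= lev f t.
Proof.
move=> z0; rewrite le_eqVlt => /orP[/eqP<-|t0 h].
  by rewrite lev0 oppr_le0.
rewrite leNgt; apply/negP => ft; move: h; rewrite leNgt => /negP; apply.
have C0 := rate_bound_gt0 c.
have : Num.max 0 (t - (- z - lev f t) / C) < t.
  by rewrite gt_max t0 ltrBlDl ltrDr divr_gt0// subr_gt0.
move=> /midf_lt[]; set s := ((_ + t) / 2) => /=; rewrite gt_max => /andP[s0 ts] st.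
apply/hit_ltP; exists s; rewrite ?s0//.
have := lev_lipschitz c f (ltW s0) (ltW st).
move=> /ler_normlP[]; rewrite opprB => h _.
move: ts; rewrite ltrBlDl -ltrBlDr ltr_pdivlMr// mulrC => ts.
lra.
Qed.

Lemma after_hit z f t e : hit z f = t%:E -> 0 < e ->
  exists2 s, t <= s < t + e & lev f s < - z.
Proof.
move=> ft e0; have /hit_ltP[s /andP[s0 se] fs] : (hit z f < (t + e)%:E)%E.
  by rewrite ft lte_fin ltrDl.
exists s; rewrite ?se ?andbT// -lee_fin -ft.
by apply: ereal_inf_lbound; exists s.
Qed.

(** No overshoot, by continuity of the level. *)
Lemma lev_hit z f t : 0 <= z -> hit z f = t%:E -> lev f t = - z.
Proof.
move=> z0 ft; have t0 : 0 <= t by rewrite -lee_fin -ft hit_ge0.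
apply/eqP; rewrite eq_le before_hit ?ft// andbT leNgt; apply/negP => h.
have C0 := rate_bound_gt0 c.
have e0 : 0 < (lev f t + z) / C by rewrite divr_gt0// -ltrBlDr sub0r.
have [s /andP[ts st] fs] := after_hit ft e0.
have := lev_lipschitz c f t0 ts.
move=> /ler_normlP[]; rewrite opprB => k _.
move: st; rewrite -ltrBlDl ltr_pdivlMr// mulrC => st.
lra.
Qed.

(** The phase is constant just after the passage, and the level goes down. *)
Lemma rate_at_hit z f t : 0 <= z -> hit z f = t%:E -> c (f t) < 0.
Proof.
move=> z0 ft; have t0 : 0 <= t by rewrite -lee_fin -ft hit_ge0.
have [e e0 fe] := path_constant_right f t0.
have [s /andP[ts st] fs] := after_hit ft e0.
have E : lev f s = lev f t + c (f t) * (s - t).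
  rewrite -{1}(subrKC t s) lev_shift ?subr_ge0//; congr (_ + _).
  apply: lev_constant; rewrite ?subr_ge0// => u /andP[u0 us].
  rewrite shiftE//; apply: fe; rewrite lerDl u0/= (lt_trans _ st)//.
  by rewrite -ltrBrDl.
move: fs; rewrite E (lev_hit z0 ft) gtrDl => h.
have ts' : 0 < s - t.
  rewrite lt_neqAle subr_ge0 ts andbT eq_sym; apply: contraTneq h => ->.
  by rewrite mulr0 ltxx.
by move: h; rewrite pmulr_llt0.
Qed.

Lemma eq_ereal_lt (x y : \bar R) : (0 <= x)%E -> (0 <= y)%E ->
  (forall r : R, (x < r%:E)%E <-> (y < r%:E)%E) -> x = y.
Proof.
have key (a b : \bar R) : (0 <= a)%E -> (forall r : R, (a < r%:E)%E -> (b < r%:E)%E) -> (b <= a)%E.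
  case: a => [a| |]// _ h; last by rewrite leey.
  apply/lee_addgt0Pr => e e0; rewrite -EFinD; apply/ltW/h.
  by rewrite lte_fin ltrDl.
move=> x0 y0 h; apply/eqP; rewrite eq_le; apply/andP; split.
- by apply: key => // r /(h r).2.
- by apply: key => // r /(h r).1.
Qed.

(** No passage occurs before [s], so that the infimum is over the times after [s],
    which are those of the shifted path. *)
Lemma hit_shift z f s : 0 <= s -> (forall u, 0 <= u <= s -> - z <= lev f u) ->
  hit z f = (s%:E + hit (z + lev f s) (shift s f))%E.
Proof.
move=> s0 hs; apply: eq_ereal_lt; rewrite ?hit_ge0 ?adde_ge0 ?hit_ge0//.
move=> r; rewrite addeC -lteBrDr// -EFinB; split => /hit_ltP[t /andP[t0 tr] ft].
  have st : s < t.
    rewrite ltNge; apply/negP => ts; have := hs t; rewrite (ltW t0) ts => /(_ isT).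
    by rewrite leNgt ft.
  apply/hit_ltP; exists (t - s); first by rewrite subr_gt0 st ltrD2r.
  move: ft; rewrite -{1}(subrKC s t) lev_shift ?subr_ge0 ?(ltW st)// => ft.
  lra.
apply/hit_ltP; exists (s + t); first by rewrite ltr_wpDl//= -ltrBrDl.
rewrite lev_shift ?(ltW t0)//; lra.
Qed.

(** After the passage below [- x] the level is exactly [- x], so that there
    remains to go down by [y]. *)
Lemma hit_add x y f t : 0 <= x -> 0 <= y -> hit x f = t%:E ->
  hit (x + y) f = (t%:E + hit y (shift t f))%E.
Proof.
move=> x0 y0 ft; have t0 : 0 <= t by rewrite -lee_fin -ft hit_ge0.
rewrite (hit_shift t0).
  by rewrite (lev_hit x0 ft) addrAC subrr add0r.
move=> u /andP[u0 ut]; apply: (@le_trans _ _ (- x)).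
  by rewrite lerN2 lerDl.
by apply: before_hit => //; rewrite ft lee_fin.
Qed.

Lemma hit_homo x y f : x <= y -> (hit x f <= hit y f)%E.
Proof.
move=> xy; apply: ereal_inf_le_tmp => _ [t [t0 ft] <-]; exists t => //.
by split => //; rewrite (lt_le_trans ft)// lerN2.
Qed.

Lemma hit_constant f j e z : 0 <= z -> 0 < e -> (forall u, 0 <= u < e -> f u = j) ->
  c j < 0 -> z < - c j * e -> hit z f = (z / - c j)%:E.
Proof.
move=> z0 e0 fj cj ze.
have cj' : 0 < - c j by rewrite oppr_gt0.
have L t : 0 <= t < e -> lev f t = c j * t.
  move=> /andP[t0 te]; apply: lev_constant => // u /andP[u0 ut].
  by apply: fj; rewrite u0 (lt_trans ut).
have T0 : 0 <= z / - c j by rewrite divr_ge0// ltW.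
have Te : z / - c j < e by rewrite ltr_pdivrMr// mulrC.
apply: eq_ereal_lt; rewrite ?hit_ge0 ?lee_fin// => r; split.
  move=> /hit_ltP[t /andP[t0 tr] ft]; rewrite lte_fin (lt_trans _ tr)// ltNge.
  apply/negP => tT.
  move: ft; rewrite L; last by rewrite (ltW t0) (le_lt_trans tT).
  move: tT; rewrite ler_pdivlMr// => tT; rewrite ltNge; move/negP; apply.
  by rewrite lerNl mulrC -mulrN mulrC mulrC.
rewrite lte_fin => Tr.
have : z / - c j < Num.min r e by rewrite lt_min Tr.
move=> /midf_lt[]; set t := ((_ + Num.min r e) / 2) => Tt; rewrite lt_min => /andP[tr te].
have t0 : 0 < t by rewrite (le_lt_trans T0).
apply/hit_ltP; exists t; first by rewrite t0.
rewrite L ?(ltW t0)//.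
by move: Tt; rewrite ltr_pdivrMr// mulrN ltrNr mulrC.
Qed.

(** The weights with which the strong Markov property is used: the clock gives a
    function [g] of the passage time [tau]. *)
Definition stopped (g : R -> R) j (tau : \bar R) f : R :=
  if (tau < +oo)%E && (f (fine tau) == j) then g (fine tau) else 0.

Lemma measurable_stopped d (T : measurableType d) (g : R -> R) j
    (tau : T -> \bar R) (p : T -> Pi) :
  measurable_fun setT g -> measurable_fun setT tau -> measurable_fun setT p ->
  (forall x, 0 <= tau x)%E ->
  measurable_fun setT (fun x => stopped g j (tau x) (p x)).
Proof.
move=> mg mtau mp tau0.
have mft : measurable_fun setT (fine \o tau) by exact: measurableT_comp.
apply: measurable_fun_if => //.
- apply: measurable_and.
    apply: measurable_fun_lte => //.
  apply: (measurable_fun_bool true).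
  rewrite (_ : _ @^-1` _ = [set x | 0 <= fine (tau x) /\ p x (fine (tau x)) = j]).
    by rewrite setTI; exact: measurable_state_at.
  apply/seteqP; split => x /=; first by move/eqP => ->; split=> //; exact: fine_ge0.
  by move=> [_ ->]; rewrite eqxx.
- by apply: measurable_funTS; exact: measurableT_comp.
Qed.

Lemma stopped_sum g tau f :
  \sum_j stopped g j tau f = if (tau < +oo)%E then g (fine tau) else 0.
Proof.
rewrite /stopped; case: ifP => _ /=; last by rewrite big1.
by rewrite (bigD1 (f (fine tau)))//= eqxx big1 ?addr0// => j; rewrite eq_sym => /negbTE ->.
Qed.

End hitting_times.

(** * Laws on products *)

Section product_laws.
Local Open Scope ereal_scope.
Context d1 d2 (T1 : measurableType d1) (T2 : measurableType d2) (R : realType).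

Section fin_measure.
Variable mu : {measure set T1 -> \bar R}.

(** The measure itself, under a name which can carry the structure of a finite
    measure given the proof that it is one. *)
Definition fin_measure (_ : mu setT < +oo) : set T1 -> \bar R := mu.

Hypothesis mu_fin : mu setT < +oo.

HB.instance Definition _ := Measure.copy (fin_measure mu_fin) mu.

Let fin_num_measure : fin_num_fun (fin_measure mu_fin).
Proof.
move=> A mA; rewrite ge0_fin_numE ?measure_ge0// (le_lt_trans _ mu_fin)//.
by apply: le_measure; rewrite ?inE.
Qed.

HB.instance Definition _ :=
  Measure_isFinite.Build _ _ _ (fin_measure mu_fin) fin_num_measure.
End fin_measure.

(** Uniqueness of the product measure, followed by the theorem of Tonelli. *)
Lemma integral_product_law (mu1 : {measure set T1 -> \bar R})
    (mu2 : {sigma_finite_measure set T2 -> \bar R})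
    (nu : {measure set (T1 * T2) -> \bar R}) (G : T1 * T2 -> \bar R) :
  mu1 setT < +oo ->
  (forall A B, measurable A -> measurable B -> nu (A `*` B) = mu1 A * mu2 B) ->
  measurable_fun setT G -> (forall x, 0 <= G x) ->
  \int[nu]_z G z = \int[mu1]_x \int[mu2]_y G (x, y).
Proof.
move=> fin1 nuE mG G0.
transitivity (\int[fin_measure fin1 \x mu2]_z G z).
  apply: eq_measure_integral => A mA _; apply/esym.
  by apply: (@product_measure_unique _ _ _ _ _ (fin_measure fin1)).
by rewrite fubini_tonelli1.
Qed.

End product_laws.

Section weighted_image_indic.
Local Open Scope ereal_scope.
Context d1 d2 (T1 : measurableType d1) (T2 : measurableType d2) (R : realType).

Lemma weighted_image_indic (mu : {measure set T1 -> \bar R}) (th : T1 -> T2)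
    (mth : measurable_fun setT th) (E : set T1)
    (mE : measurable_fun setT (\1_E : T1 -> R)) (E0 : forall x, (0 <= \1_E x :> R)%R) A :
  measurable E -> measurable A ->
  weighted_image mu mth mE E0 A = mu (E `&` th @^-1` A).
Proof.
move=> hE mA; rewrite /weighted_image integral_indic//.
by rewrite -[X in measurable X]setTI; exact: mth.
Qed.
End weighted_image_indic.

Lemma measurable_preimageT d1 d2 (T1 : measurableType d1) (T2 : measurableType d2)
    (th : T1 -> T2) (A : set T2) :
  measurable_fun setT th -> measurable A -> measurable (th @^-1` A).
Proof. by move=> mth mA; rewrite -[X in measurable X]setTI; exact: mth. Qed.

Lemma probability_lty d (T : measurableType d) (R : realType)
    (P : probability T R) (A : set T) : measurable A -> (P A < +oo)%E.
Proof. by move=> mA; rewrite (le_lt_trans (probability_le1 _ mA))// ltry. Qed.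

(** * The Markov property *)

Section cylinders.
Context {R : realType} {m : nat}.
Notation Pi := (trajectory R m).
Notation S := 'I_m.+1.
Implicit Types (t s : R) (i j : S) (l : seq (R * S)).

Definition cylinder l : set Pi := [set f : Pi | forall x, x \in l -> f x.1 = x.2].

Definition time_le (x y : R * S) := x.1 <= y.1.

Lemma cylinder_nil : cylinder [::] = setT.
Proof. by apply/seteqP; split => f. Qed.

Lemma cylinder_cat l1 l2 : cylinder (l1 ++ l2) = cylinder l1 `&` cylinder l2.
Proof.
apply/seteqP; split => f /=.
  by move=> h; split => x xl; apply: h; rewrite mem_cat xl ?orbT.
by move=> [h1 h2] x; rewrite mem_cat => /orP[/h1|/h2].
Qed.

Lemma cylinder_cons x l : cylinder (x :: l) = [set f : Pi | f x.1 = x.2] `&` cylinder l.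
Proof.
rewrite -cat1s cylinder_cat; congr (_ `&` _).
apply/seteqP; split => f /= h; first by apply: h; rewrite mem_head.
by move=> y; rewrite inE => /eqP ->.
Qed.

Lemma measurable_cylinder l : all (fun x => 0 <= x.1) l -> measurable (cylinder l).
Proof.
elim: l => [_|x l IH /= /andP[x0 l0]]; first by rewrite cylinder_nil.
rewrite cylinder_cons; apply: measurableI; last exact: IH.
exact: measurable_coordinate.
Qed.

Lemma time_le_trans : transitive time_le.
Proof. by move=> y x z; exact: le_trans. Qed.

Lemma time_le_total : total time_le.
Proof. by move=> x y; exact: le_total. Qed.

Lemma cylinder_sort l : cylinder (sort time_le l) = cylinder l.
Proof.
by apply/seteqP; split => f h x xl; apply: h; rewrite ?mem_sort// -(mem_sort time_le).
Qed.

(** Cylinders are stable by intersection and generate the events; sorting the list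
    of times reduces to increasing ones. *)
Lemma path_law_unique (m1 m2 : {measure set Pi -> \bar R}) :
  (m1 setT < +oo)%E ->
  (forall l, sorted time_le l -> all (fun x => 0 <= x.1) l ->
     m1 (cylinder l) = m2 (cylinder l)) ->
  forall A, measurable A -> m1 A = m2 A.
Proof.
move=> fin1 m12 A mA.
pose G : set (set Pi) := [set cylinder l | l in [set l | all (fun x => 0 <= x.1) l]].
have GT : G setT by exists [::] => //; rewrite cylinder_nil.
apply: (g_sigma_algebra_measure_unique G _ (fun=> setT)) => //.
- by move=> _ [l l0 <-]; exact: measurable_cylinder.
- by rewrite bigcup_const//; exists 0%N.
- move=> _ _ [l1 l10 <-] [l2 l20 <-]; exists (l1 ++ l2); last by rewrite cylinder_cat.
  by rewrite /= all_cat l10.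
- move=> _ [l l0 <-]; rewrite -cylinder_sort; apply: m12.
    exact/sort_sorted/time_le_total.
  by rewrite all_sort.
- move: A mA; apply: sub_smallest2r; first exact: smallest_sigma_algebra.
  move=> _ [t [j [t0 ->]]]; exists [:: (t, j)]; rewrite /= ?t0//.
  by rewrite cylinder_cons cylinder_nil setIT.
Qed.

(** The form in which uniqueness is used: conditionally on [E], the path [th] has
    law [nu]. *)
Lemma image_path_law_unique d (T : measurableType d) (mu : {measure set T -> \bar R})
    (th : T -> Pi) (E : set T) (r : R) (nu : {measure set Pi -> \bar R}) :
  measurable_fun setT th -> measurable E -> 0 <= r -> (nu setT < +oo)%E ->
  (forall l, sorted time_le l -> all (fun x => 0 <= x.1) l ->
    mu (E `&` th @^-1` cylinder l) = (r%:E * nu (cylinder l))%E) ->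
  forall A, measurable A -> mu (E `&` th @^-1` A) = (r%:E * nu A)%E.
Proof.
move=> mth mE r0 nufin h A mA.
have E0 x : 0 <= \1_E x :> R by rewrite indicE.
have mE' : measurable_fun setT (\1_E : T -> R) by exact: measurable_indic.
pose W : {measure set Pi -> \bar R} := weighted_image mu mth mE' E0.
have WE B : measurable B -> W B = mu (E `&` th @^-1` B).
  exact: weighted_image_indic.
pose N : {measure set Pi -> \bar R} := mscale (NngNum r0) nu.
have NE B : N B = (r%:E * nu B)%E by [].
rewrite -WE// -NE; apply: path_law_unique => //.
- rewrite WE// -cylinder_nil h//=.
  by rewrite cylinder_nil lte_mul_pinfty// lee_fin.
- by move=> l ls l0; rewrite NE WE ?h//; exact: measurable_cylinder.
Qed.

End cylinders.

Section markov.
Context {R : realType} {m : nat}.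
Notation Pi := (trajectory R m).
Notation S := 'I_m.+1.
Implicit Types (t s : R) (i j : S) (l : seq (R * S)).
Variable p : R -> S -> S -> R.

(** The finite-dimensional distributions of a chain in phase [i] at time [t], by
    recursion on the list of times and phases, so that cutting the list at one of
    its times is [chain_prob_cat]. *)
Fixpoint chain_prob t i l : R :=
  if l is x :: l' then p (x.1 - t) i x.2 * chain_prob x.1 x.2 l' else 1.

Variable Q : S -> probability Pi R.
Hypothesis Q_cylinder : forall i l, sorted time_le l -> all (fun x => 0 <= x.1) l ->
  Q i (cylinder l) = (chain_prob 0 i l)%:E.

Lemma chain_prob_cat t i l1 s j l2 :
  chain_prob t i (l1 ++ (s, j) :: l2) =
  chain_prob t i (rcons l1 (s, j)) * chain_prob s j l2.
Proof.
elim: l1 t i => [|x l1 IH] t i /=; first by rewrite mulr1.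
by rewrite IH mulrA.
Qed.

Lemma chain_prob_shift t i s l :
  chain_prob (s + t) i [seq (s + x.1, x.2) | x <- l] = chain_prob t i l.
Proof.
elim: l t i => [|x l IH] t i //=; rewrite IH; congr (p _ _ _ * _).
by ring.
Qed.

(** Stopping at [s] moves the times of [l1] to at most [s], so that these times,
    then [s], then the shifted times of [l2], are sorted. *)
Lemma markov_cylinder i s j l1 l2 : 0 <= s ->
  sorted time_le l1 -> all (fun x => 0 <= x.1) l1 ->
  sorted time_le l2 -> all (fun x => 0 <= x.1) l2 ->
  Q i ([set f : Pi | f s = j] `&` stop s @^-1` cylinder l1 `&`
       shift s @^-1` cylinder l2) =
  (Q i ([set f : Pi | f s = j] `&` stop s @^-1` cylinder l1) * Q j (cylinder l2))%E.
Proof.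
move=> s0 l1s l10 l2s l20.
pose k1 := [seq (Num.min x.1 s, x.2) | x <- l1].
pose k2 := [seq (s + x.1, x.2) | x <- l2].
have E1 : stop s @^-1` cylinder l1 = cylinder k1.
  apply/seteqP; split => f /= h.
    by move=> _ /mapP[x xl ->] /=; rewrite -(h x xl) stopE.
  move=> x xl; rewrite stopE//.
  by have /= -> // := h (Num.min x.1 s, x.2) (map_f _ xl).
have E2 : shift s @^-1` cylinder l2 = cylinder k2.
  apply/seteqP; split => f /= h.
    by move=> _ /mapP[x xl ->] /=; rewrite -(h x xl) shiftE.
  move=> x xl; rewrite shiftE//.
  by have /= -> // := h (s + x.1, x.2) (map_f _ xl).
have E3 : [set f : Pi | f s = j] `&` cylinder k1 = cylinder (rcons k1 (s, j)).
  by rewrite -cats1 cylinder_cat cylinder_cons cylinder_nil setIT setIC.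
have ks : sorted time_le (k1 ++ (s, j) :: k2).
  rewrite (sorted_pairwise time_le_trans) pairwise_cat /=; apply/and4P; split.
  - apply/allrelP => _ y /mapP[x xl ->]; rewrite inE => /orP[/eqP ->|].
      by rewrite /time_le /= ge_min lexx orbT.
    move=> /mapP[z zl ->]; rewrite /time_le /= ge_min orbC ler_wpDr//.
    by move/allP : l20; exact.
  - rewrite pairwise_map; move: l1s; rewrite (sorted_pairwise time_le_trans).
    apply: sub_pairwise => x y; rewrite /time_le /= => xy.
    by rewrite le_min !ge_min xy lexx orbT.
  - rewrite all_map; apply: sub_all l20 => x /= x0.
    by rewrite /time_le /= lerDl.
  - rewrite pairwise_map; move: l2s; rewrite (sorted_pairwise time_le_trans).
    by apply: sub_pairwise => x y; rewrite /time_le /= lerD2l.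
have k1s : sorted time_le (rcons k1 (s, j)).
  by move: ks; rewrite -cat_rcons => /cat_sorted2[].
have k10 : all (fun x : R * S => 0 <= x.1) (rcons k1 (s, j)).
  rewrite all_rcons /= s0 /= all_map; apply: sub_all l10 => x /= x0.
  by rewrite le_min x0.
rewrite E1 E2 E3 -cylinder_cat cat_rcons !Q_cylinder//.
- by rewrite chain_prob_cat -(chain_prob_shift 0 j s l2) addr0 EFinM.
- move: k10; rewrite all_rcons all_cat /= => /andP[-> ->] /=.
  rewrite all_map; apply: sub_all l20 => x /= x0; exact: addr_ge0.
Qed.

Lemma measurable_state s j : 0 <= s -> measurable [set f : Pi | f s = j].
Proof. exact: measurable_coordinate. Qed.

(** Uniqueness of laws is used twice: the stopped path and the shifted path are
    handled one after the other. *)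
Lemma markov_rectangle i s j (A B : set Pi) : 0 <= s -> measurable A -> measurable B ->
  Q i ([set f : Pi | f s = j] `&` stop s @^-1` A `&` shift s @^-1` B) =
  (Q i ([set f : Pi | f s = j] `&` stop s @^-1` A) * Q j B)%E.
Proof.
move=> s0 mA mB.
have mSj := measurable_state j s0.
have mstop X : measurable X -> measurable (stop s @^-1` X).
  by apply: measurable_preimageT; exact: measurable_stop.
have mshift X : measurable X -> measurable (shift s @^-1` X).
  by apply: measurable_preimageT; exact: measurable_shift.
have fin E : measurable E -> (Q i E)%E = (fine (Q i E))%:E.
  by move=> mE; rewrite fineK// fin_num_measure.
(* the second argument is extended first, for a cylinder in the first one *)
have step1 l1 : sorted time_le l1 -> all (fun x => 0 <= x.1) l1 ->
    Q i ([set f : Pi | f s = j] `&` stop s @^-1` cylinder l1 `&` shift s @^-1` B) =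
    (Q i ([set f : Pi | f s = j] `&` stop s @^-1` cylinder l1) * Q j B)%E.
  move=> l1s l10.
  have mE : measurable ([set f : Pi | f s = j] `&` stop s @^-1` cylinder l1).
    by apply: measurableI => //; apply: mstop; exact: measurable_cylinder.
  rewrite (fin _ mE); apply: image_path_law_unique => //.
  - exact: measurable_shift.
  - exact: fine_ge0.
  - exact: probability_lty.
  - by move=> l2 l2s l20; rewrite -(fin _ mE); exact: markov_cylinder.
have E0 f : 0 <= \1_[set f : Pi | f s = j] f :> R by rewrite indicE.
have mE0 : measurable_fun setT (\1_[set f : Pi | f s = j] : Pi -> R).
  exact: measurable_indic.
pose W : {measure set Pi -> \bar R} := weighted_image (Q i) (measurable_stop s) mE0 E0.
have WE X : measurable X -> W X = Q i ([set f : Pi | f s = j] `&` stop s @^-1` X).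
  exact: weighted_image_indic.
have QB : (Q j B)%E = (fine (Q j B))%:E by rewrite fineK// fin_num_measure.
rewrite -WE// muleC QB setIAC.
apply: image_path_law_unique => //.
- exact: measurable_stop.
- by apply: measurableI => //; exact: mshift.
- exact: fine_ge0.
- by rewrite WE//; apply: probability_lty; apply: measurableI => //; exact: mstop.
- move=> l ls l0; rewrite WE; last exact: measurable_cylinder.
  by rewrite -QB muleC setIAC; exact: step1.
Qed.

(** On the event that the phase is [j] at time [s], the joint law of the stopped
    path, which is the past, and of the shifted path, which is the future, is a
    product. *)
Lemma markov i s j (G : Pi * Pi -> \bar R) : 0 <= s ->
  measurable_fun setT G -> (forall x, 0 <= G x)%E ->
  (\int[Q i]_f ((\1_[set f : Pi | f s = j] f)%:E * G (stop s f, shift s f)) =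
   \int[Q i]_f ((\1_[set f : Pi | f s = j] f)%:E * \int[Q j]_g G (stop s f, g)))%E.
Proof.
move=> s0 mG G0.
have mSj := measurable_state j s0.
have E0 f : 0 <= \1_[set f : Pi | f s = j] f :> R by rewrite indicE.
have mE0 : measurable_fun setT (\1_[set f : Pi | f s = j] : Pi -> R).
  exact: measurable_indic.
have mpair : measurable_fun setT (fun f : Pi => (stop s f, shift s f)).
  by apply: measurable_fun_pair; [exact: measurable_stop|exact: measurable_shift].
pose m1 : {measure set Pi -> \bar R} := weighted_image (Q i) (measurable_stop s) mE0 E0.
pose nu : {measure set (Pi * Pi) -> \bar R} := weighted_image (Q i) mpair mE0 E0.
have m1E X : measurable X -> m1 X = Q i ([set f : Pi | f s = j] `&` stop s @^-1` X).
  exact: weighted_image_indic.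
rewrite (@integral_transfer _ _ _ _ _ (Q i) _ _ mpair mE0 E0 nu)//.
rewrite (@integral_product_law _ _ _ _ _ m1 (Q j))//; first last.
- move=> A B mA mB; rewrite /nu /= weighted_image_indic//; last exact: measurableX.
  by rewrite m1E// -markov_rectangle// -setIA.
- by rewrite m1E//; apply: probability_lty; apply: measurableI => //; apply: measurable_preimageT => //; exact: measurable_stop.
rewrite -(@integral_transfer _ _ _ _ _ (Q i) _ _ (measurable_stop s) mE0 E0 m1)//.
- exact: measurable_fun_fubini_tonelli_F.
- by move=> f; exact: integral_ge0.
Qed.

End markov.

(** * The strong Markov property *)

Section strong_markov.
Context {R : realType} {m : nat}.
Notation Pi := (trajectory R m).
Notation S := 'I_m.+1.
Implicit Types (t s r : R) (i j : S) (l : seq (R * S)).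
Variable p : R -> S -> S -> R.
Variable Q : S -> probability Pi R.
Hypothesis Q_cylinder : forall i l, sorted time_le l -> all (fun x => 0 <= x.1) l ->
  Q i (cylinder l) = (chain_prob p 0 i l)%:E.

Lemma measurable_random_shift d (T : measurableType d) (a : T -> R) (q : T -> Pi) :
  measurable_fun setT a -> measurable_fun setT q ->
  measurable_fun setT (fun x => shift (a x) (q x)).
Proof.
move=> ma mq; apply: measurable_to_path => t j t0.
have mat : measurable_fun setT (fun x => `|a x| + t).
  by apply: measurable_funD => //; exact: measurableT_comp.
rewrite (_ : [set _ | _] = [set x | 0 <= `|a x| + t /\ q x (`|a x| + t) = j]).
  exact: measurable_state_at.
by apply/seteqP; split => x /=; [move=> ->; rewrite addr_ge0|case].
Qed.

Lemma up_homo n : {homo (@up R n) : s t / s <= t}.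
Proof.
move=> s t st; rewrite /up ler_pM2r ?invr_gt0 ?ltr0n// ler_nat ltnS.
by apply: le_truncn; rewrite ler_pM2r ?ltr0n.
Qed.

Definition upe n (x : \bar R) : \bar R := if x is r%:E then (up n r)%:E else x.

Lemma upe_fin n (x : \bar R) : (0 <= x)%E -> (upe n x < +oo)%E = (x < +oo)%E.
Proof. by case: x => [r| |]//= _; rewrite !ltry. Qed.

Lemma upe_ge0 n (x : \bar R) : (0 <= x)%E -> (0 <= upe n x)%E.
Proof.
by case: x => [r| |]//=; rewrite !lee_fin => r0; rewrite (le_trans r0)// ltW// up_gt.
Qed.

Lemma measurable_upe n : measurable_fun setT (upe n).
Proof.
rewrite (_ : upe n = (fun x => if (x \is a fin_num) then (up n (fine x))%:E else x)).
  apply: measurable_fun_ifT => //.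
    apply: (measurable_fun_bool true); rewrite setTI.
    have := @emeasurable_fin_num _ _ R setT id measurableT (@measurable_id _ _ _).
    by rewrite setTI.
  apply/measurable_EFinP; apply: measurableT_comp; last exact: fine_measurable.
  by apply: nondecreasing_measurable => // x y xy; exact: up_homo.
by apply/funext => -[].
Qed.

Variable tau : Pi -> \bar R.
Hypothesis mtau : measurable_fun setT tau.
Hypothesis tau_ge0 : forall f, (0 <= tau f)%E.
Hypothesis tau_stop : forall r f, 0 <= r ->
  (tau (stop r f) < r%:E)%E <-> (tau f < r%:E)%E.
Variable g : R -> R.
Hypothesis g_continuous : continuous g.
Hypothesis g_ge0 : forall t, 0 <= t -> 0 <= g t.
Hypothesis g_le1 : forall t, 0 <= t -> g t <= 1.

Lemma stopped_ge0 j (x : \bar R) (f : Pi) : (0 <= x)%E -> 0 <= stopped g j x f.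
Proof. by move=> x0; rewrite /stopped; case: ifP => // _; apply/g_ge0/fine_ge0. Qed.

Lemma stopped_le1 j (x : \bar R) (f : Pi) : (0 <= x)%E -> stopped g j x f <= 1.
Proof. by move=> x0; rewrite /stopped; case: ifP => // _; apply/g_le1/fine_ge0. Qed.

Let mg : measurable_fun setT g.
Proof. exact: continuous_measurable_fun. Qed.

(** The events on which the time [tau], approximated from above on the grid, is
    constant; they only depend on the path stopped at that constant. *)
Let slot n (k : nat) : set Pi :=
  [set f | ((k%:R / n.+1%:R)%:E <= tau f)%E /\ (tau f < (k.+1%:R / n.+1%:R)%:E)%E].

Let measurable_slot n k : measurable (slot n k).
Proof.
by apply: measurableI; rewrite -[X in measurable X]setTI;
  [exact: emeasurable_fun_c_infty|exact: emeasurable_fun_infty_o].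
Qed.

Let up_slot n k f : slot n k f -> upe n (tau f) = (k.+1%:R / n.+1%:R)%:E.
Proof.
rewrite /slot /=; case: (tau f) (tau_ge0 f) => [t| |]//=; last by move=> _ [].
rewrite !lee_fin lte_fin => t0 [kt tk].
rewrite /up (truncn_def (n := k))//.
by rewrite -ler_pdivrMr ?ltr0n// kt -ltr_pdivlMr ?ltr0n.
Qed.

Let slot_stop n k f : slot n k (stop (k.+1%:R / n.+1%:R) f) <-> slot n k f.
Proof.
have k0 : 0 <= k%:R / n.+1%:R :> R by [].
have k1 : 0 <= k.+1%:R / n.+1%:R :> R by [].
have kk : k%:R / n.+1%:R <= k.+1%:R / n.+1%:R :> R.
  by rewrite ler_pM2r ?invr_gt0 ?ltr0n// ler_nat.
have L h : ((k%:R / n.+1%:R)%:E <= tau h)%E <-> ~ (tau h < (k%:R / n.+1%:R)%:E)%E.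
  by rewrite leNgt; split; move/negP.
rewrite /slot /= !L tau_stop//.
by rewrite -(tau_stop (stop _ f) k0) stop_stop// tau_stop.
Qed.

(** For a time with values in a grid, the strong Markov property is the Markov
    property at each point of the grid. *)
Lemma strong_markov_grid n i j (B : set Pi) : measurable B ->
  (\int[Q i]_f (stopped g j (upe n (tau f)) f * \1_B (shift (fine (upe n (tau f))) f))%:E =
   \int[Q i]_f (stopped g j (upe n (tau f)) f)%:E * Q j B)%E.
Proof.
move=> mB.
pose D := [set f | (tau f < +oo)%E].
have mupe : measurable_fun setT (fun f => upe n (tau f)).
  by apply: measurableT_comp => //; exact: measurable_upe.
have mh : measurable_fun setT (fun f => stopped g j (upe n (tau f)) f).
  by apply: measurable_stopped => // f; exact: upe_ge0.
have mB1 : measurable_fun setT (fun f => \1_B (shift (fine (upe n (tau f))) f) : R).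
  apply: measurableT_comp; first exact: measurable_indic.
  by apply: measurable_random_shift => //; exact: measurableT_comp.
have DE : D = \bigcup_k slot n k.
  apply/seteqP; split => f; last by move=> [k _ [_ h]]; exact: (lt_trans h (ltry _)).
  rewrite /D /=; have := tau_ge0 f; case E : (tau f) => [t| |]//= t0 _.
  have := truncn_itv (_ : 0 <= t * n.+1%:R); rewrite mulr_ge0// => /(_ isT) /andP[h1 h2].
  exists (Num.truncn (t * n.+1%:R)) => //; rewrite /slot /= E lee_fin lte_fin.
  by rewrite ler_pdivrMr ?ltr0n// ltr_pdivlMr ?ltr0n.
have onD (G : Pi -> \bar R) : (forall f, ~ D f -> G f = 0%E) ->
    (\int[Q i]_f G f = \int[Q i]_(f in \bigcup_k slot n k) G f)%E.
  move=> G0; rewrite -DE [RHS]integral_mkcond; apply: eq_integral => f _.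
  by rewrite patchE; case: ifPn => //; rewrite notin_setE => /G0.
have h0 f : ~ D f -> stopped g j (upe n (tau f)) f = 0.
  by move=> /negP Df; rewrite /stopped upe_fin// (negbTE Df).
have hpos f : 0 <= stopped g j (upe n (tau f)) f by rewrite stopped_ge0// upe_ge0.
rewrite onD; last by move=> f /h0 ->; rewrite mul0r.
rewrite [X in (_ = X * _)%E]onD; last by move=> f /h0 ->.
have tS : trivIset setT (slot n).
  move=> k k' _ _ [f [/up_slot]] fk /up_slot; rewrite fk => -[].
  by move/(mulIf _) => /(_ _)/eqP; rewrite eqr_nat eqSS => H; apply/eqP/H; rewrite invr_neq0// pnatr_eq0.
rewrite ge0_integral_bigcup//; last 2 first.
- apply/measurable_funTS/measurable_EFinP; exact: measurable_funM.
- by move=> f _; rewrite lee_fin; apply: mulr_ge0.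
rewrite ge0_integral_bigcup//; last 2 first.
- exact/measurable_funTS/measurable_EFinP.
- by move=> f _; rewrite lee_fin.
have QB : (Q j B)%E = (fine (Q j B))%:E by rewrite fineK// fin_num_measure.
rewrite QB muleC -nneseriesZl; last first.
  by move=> k _; apply: integral_ge0 => f _; rewrite lee_fin.
apply: eq_eseriesr => k _; rewrite -QB.
have r0 : 0 <= k.+1%:R / n.+1%:R :> R by [].
set r := (k.+1%:R / n.+1%:R : R) in r0 *.
pose G (x : Pi * Pi) : \bar R := (g r * (\1_(slot n k) x.1 * \1_B x.2))%:E.
have mG : measurable_fun setT G.
  apply/measurable_EFinP/measurable_funM => //; apply: measurable_funM.
    by apply: measurableT_comp => //; exact: measurable_indic.
  by apply: measurableT_comp => //; exact: measurable_indic.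
have gr0 : 0 <= g r by exact: g_ge0.
have G0 x : (0 <= G x)%E by rewrite lee_fin !mulr_ge0.
have indS f : \1_(slot n k) (stop r f) = \1_(slot n k) f :> R.
  by rewrite !indicE; congr (_%:R); congr nat_of_bool; apply/idP/idP;
    rewrite !inE => /slot_stop.
have st f : slot n k f -> stopped g j (upe n (tau f)) f = g r * \1_[set f : Pi | f r = j] f.
  move=> fk; rewrite /stopped (up_slot fk) ltry /= indicE.
  have -> : (f \in [set f : Pi | f r = j]) = (f r == j) by apply/idP/eqP; rewrite inE.
  by case: eqP => _; rewrite ?mulr1 ?mulr0.
transitivity (\int[Q i]_f ((\1_[set f : Pi | f r = j] f)%:E * G (stop r f, shift r f)))%E.
  rewrite integral_mkcond; apply: eq_integral => f _; rewrite patchE -EFinM.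
  rewrite /G /= indS [\1_(slot n k) f]indicE; case: ifPn => [|_]; last by rewrite mul0r !mulr0.
  by rewrite inE => fk; rewrite st// (up_slot fk) mul1r; congr EFin; ring.
rewrite (markov Q_cylinder)//.
rewrite -ge0_integralZl//; last 2 first.
- exact/measurable_funTS/measurable_EFinP.
- by move=> f _; rewrite lee_fin.
rewrite [RHS]integral_mkcond; apply: eq_integral => f _; rewrite patchE.
have -> : (\int[Q j]_x G (stop r f, x) = (g r * \1_(slot n k) f)%:E * Q j B)%E.
  rewrite /G; under eq_integral do rewrite /= indS mulrA EFinM.
  rewrite ge0_integralZl//; last 2 first.
  - by apply/measurable_EFinP; exact: measurable_indic.
  - by rewrite lee_fin mulr_ge0.
  by rewrite integral_indic// setIT.
rewrite indicE [in \1_(slot n k) f]indicE.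
case: ifPn => [|_]; last by rewrite mulr0 mul0e mule0.
rewrite inE => fk; rewrite st// mulr1 indicE muleA muleC; congr (_ * _)%E.
by rewrite -EFinM mulrC.
Qed.

Lemma cvg_stopped j (f : Pi) :
  stopped g j (upe n (tau f)) f @[n --> \oo] --> stopped g j (tau f) f.
Proof.
have := tau_ge0 f; case: (tau f) => [t| |]//=; rewrite ?lee_fin => t0; last first.
  by rewrite /stopped ltxx; exact: cvg_cst.
rewrite /stopped /= ltry /=.
have [fj|fj] := eqVneq (f t) j.
  have gc : g (up n t) @[n --> \oo] --> g t.
    by apply: continuous_cvg; [exact: g_continuous|exact: cvg_up].
  apply: cvg_trans gc; apply: near_eq_cvg; have := path_up f t0; apply: filterS => n fn.
  by rewrite ltry /= fn fj eqxx.
apply: cvg_near_cst; have := path_up f t0; apply: filterS => n fn.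
by rewrite ltry /= fn (negbTE fj).
Qed.

Lemma cvg_shift_cylinder l (f : Pi) : all (fun x => 0 <= x.1) l -> (tau f < +oo)%E ->
  \forall n \near \oo, (\1_(cylinder l) (shift (fine (upe n (tau f))) f) =
                        \1_(cylinder l) (shift (fine (tau f)) f) :> R).
Proof.
move=> l0; have := tau_ge0 f; case: (tau f) => [t| |]//=; rewrite ?lee_fin => t0 _.
have : \forall n \near \oo, forall x, x \in l -> f (up n t + x.1) = f (t + x.1).
  elim: l l0 => [_|x l IH /= /andP[x0 l0]]; first by apply: nearW.
  have := path_up (shift x.1 f) t0; apply: filterS2 (IH l0) => n h hx y.
  rewrite inE => /orP[/eqP->|]; last exact: h.
  by move: hx; rewrite !shiftE// ![x.1 + _]addrC.
apply: filterS => n h; rewrite !indicE; congr (_%:R); congr nat_of_bool.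
have u0 : 0 <= up n t by rewrite (le_trans t0)// ltW// up_gt.
apply/idP/idP; rewrite !inE => k x xl; have := k x xl; rewrite !shiftE//.
  by rewrite h.
by rewrite -h.
Qed.

(** The approximations of [tau] decrease to [tau]; along them the phase at that
    time, and the finitely many phases that a cylinder tests, are eventually
    constant by right continuity. *)
Lemma strong_markov_cylinder i j l : all (fun x => 0 <= x.1) l ->
  (\int[Q i]_f (stopped g j (tau f) f * \1_(cylinder l) (shift (fine (tau f)) f))%:E =
   \int[Q i]_f (stopped g j (tau f) f)%:E * Q j (cylinder l))%E.
Proof.
move=> l0.
have mB := measurable_cylinder l0.
have mupe n : measurable_fun setT (fun f => upe n (tau f)).
  by apply: measurableT_comp => //; exact: measurable_upe.
have mh n : measurable_fun setT (fun f => stopped g j (upe n (tau f)) f).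
  by apply: measurable_stopped => // f; exact: upe_ge0.
have mB1 n : measurable_fun setT (fun f => \1_(cylinder l) (shift (fine (upe n (tau f))) f) : R).
  apply: measurableT_comp; first exact: measurable_indic.
  by apply: measurable_random_shift => //; exact: measurableT_comp.
have i1 : (Q i).-integrable setT (EFin \o cst (1 : R)).
  exact: finite_measure_integrable_cst.
have q E x : 0 <= (\1_E (x : Pi) : R) <= 1.
  by rewrite indicE; case: (_ \in _); rewrite ?lexx ?ler01.
have c1 : (\int[Q i]_f (stopped g j (upe n (tau f)) f)%:E)%E @[n --> \oo] -->
    (\int[Q i]_f (stopped g j (tau f) f)%:E)%E.
  apply: (@dominated_cvg _ _ _ _ setT measurableT _ _ (EFin \o cst (1 : R))) => //.
  - by move=> n; exact/measurable_EFinP.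
  - by move=> f _; apply: cvg_EFin; [exact: nearW|exact: cvg_stopped].
  - move=> n f _; rewrite /= lee_fin ger0_norm ?stopped_ge0 ?stopped_le1//; exact: upe_ge0.
have c2 : (\int[Q i]_f (stopped g j (upe n (tau f)) f *
      \1_(cylinder l) (shift (fine (upe n (tau f))) f))%:E)%E @[n --> \oo] -->
    (\int[Q i]_f (stopped g j (tau f) f * \1_(cylinder l) (shift (fine (tau f)) f))%:E)%E.
  apply: (@dominated_cvg _ _ _ _ setT measurableT _ _ (EFin \o cst (1 : R))) => //.
  - by move=> n; apply/measurable_EFinP; exact: measurable_funM.
  - move=> f _; apply: cvg_EFin; first exact: nearW.
    have [tf|/negP tf] := pselect (tau f < +oo)%E.
      apply: cvgM; first exact: cvg_stopped.
      by apply: cvg_near_cst; exact: cvg_shift_cylinder.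
    have st n : stopped g j (upe n (tau f)) f = 0 by rewrite /stopped upe_fin// (negbTE tf).
    have -> : stopped g j (tau f) f = 0 by rewrite /stopped (negbTE tf).
    by rewrite mul0r; under eq_fun do rewrite st mul0r; exact: cvg_cst.
  - move=> n f _; rewrite /= lee_fin.
    have h0 : 0 <= stopped g j (upe n (tau f)) f by rewrite stopped_ge0// upe_ge0.
    have h1 : stopped g j (upe n (tau f)) f <= 1 by rewrite stopped_le1// upe_ge0.
    have /andP[q0 q1] := q (cylinder l) (shift (fine (upe n (tau f))) f).
    by rewrite ger0_norm ?mulr_ge0// mulr_ile1.
have c3 := cvgeZr (fin_num_measure (Q j) _ mB) c1.
apply: (cvg_unique _ c2) => //.
apply: cvg_trans c3; apply: near_eq_cvg; apply: nearW => n /=.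
by rewrite strong_markov_grid.
Qed.

(** Under the weight [stopped g j], the shifted path has a law proportional to
    [Q j], since this holds on cylinders. *)
Lemma strong_markov i j (G : Pi -> \bar R) :
  measurable_fun setT G -> (forall f, 0 <= G f)%E ->
  (\int[Q i]_f ((stopped g j (tau f) f)%:E * G (shift (fine (tau f)) f)) =
   \int[Q i]_f (stopped g j (tau f) f)%:E * \int[Q j]_f G f)%E.
Proof.
move=> mG G0.
have msh : measurable_fun setT (fun f => shift (fine (tau f)) f).
  by apply: measurable_random_shift => //; exact: measurableT_comp.
have mh : measurable_fun setT (fun f => stopped g j (tau f) f).
  by apply: measurable_stopped.
have h0 f : 0 <= stopped g j (tau f) f by exact: stopped_ge0.
have h1 f : stopped g j (tau f) f <= 1 by exact: stopped_le1.
pose a := (\int[Q i]_f (stopped g j (tau f) f)%:E)%E.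
have a0 : (0 <= a)%E by apply: integral_ge0 => f _; rewrite lee_fin.
have afin : (a < +oo)%E.
  apply: (@le_lt_trans _ _ (\int[Q i]_f (cst 1 f))%E); last first.
    by rewrite integral_cst// mul1e; exact: probability_lty.
  apply: ge0_le_integral => //.
  - by move=> f _; rewrite lee_fin.
  - exact/measurable_EFinP.
  - by move=> f _; rewrite lee_fin.
have aE : a = (fine a)%:E by rewrite fineK// ge0_fin_numE.
pose W : {measure set Pi -> \bar R} := weighted_image (Q i) msh mh h0.
have fa0 : 0 <= fine a by exact: fine_ge0.
pose N : {measure set Pi -> \bar R} := mscale (NngNum fa0) (Q j).
have NE B : N B = (a * Q j B)%E by rewrite aE.
have WN B : measurable B -> W B = N B.
  apply: path_law_unique => [|l ls l0].
    by rewrite /W /= /weighted_image preimage_setT.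
  rewrite NE /W /= /weighted_image integral_mkcond -strong_markov_cylinder//.
  apply: eq_integral => f _; rewrite patchE indicE.
  have -> : (f \in (fun f0 : Pi => shift (fine (tau f0)) f0) @^-1` cylinder l) =
    (shift (fine (tau f)) f \in cylinder l) by [].
  by case: ifPn; rewrite ?mulr1 ?mulr0.
rewrite (@integral_transfer _ _ _ _ _ (Q i) _ _ msh mh h0 N)//.
by rewrite ge0_integral_mscale//= -/a aE.
Qed.

End strong_markov.

(** * Poisson weights *)

Section poisson_weights.
Context {R : realType}.
Variable nu : R.
Hypothesis nu_gt0 : 0 < nu.
Implicit Types (s t u : R) (k l n : nat).

(** The probability that a Poisson process of rate [nu] has [n] points in an
    interval of length [t]. *)
Definition poisson_weight n t : R := expR (- nu * t) * ((nu * t) ^+ n / n`!%:R).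
Local Notation g := poisson_weight.

(** The probability that fewer than [k] points fall in an interval of length [t]. *)
Definition erlang_tail k t : R := \sum_(l < k) g l t.

Lemma poisson_weight_ge0 n t : 0 <= t -> 0 <= g n t.
Proof.
move=> t0; rewrite mulr_ge0 ?expR_ge0// divr_ge0// exprn_ge0//.
by rewrite mulr_ge0// ltW.
Qed.

Lemma poisson_weight0 t : g 0 t = expR (- nu * t).
Proof. by rewrite /g expr0 fact0 divr1 mulr1. Qed.

Lemma poisson_weight_at0 n : g n 0 = (n == 0%N)%:R.
Proof.
rewrite /g !mulr0 expR0 mul1r expr0n; case: n => [|n] /=; last by rewrite mul0r.
by rewrite fact0 divr1.
Qed.

Lemma continuous_poisson_weight n : continuous (g n).
Proof.
move=> t; have cm (a : R) : a * s @[s --> t] --> a * t.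
  by apply: cvgM; [exact: cvg_cst|exact: cvg_id].
apply: cvgM.
  by apply: (@continuous_comp _ _ _ (fun s => - nu * s) expR); [exact: cm|exact: continuous_expR].
apply: cvgM; last exact: cvg_cst.
elim: n => [|n IH]; first by under eq_fun do rewrite expr0; rewrite expr0; exact: cvg_cst.
by under eq_fun do rewrite exprS; rewrite exprS; apply: cvgM.
Qed.

(** Points in consecutive intervals: the binomial formula. *)
Lemma poisson_weightD n s t : g n (s + t) = \sum_(l < n.+1) g l s * g (n - l)%N t.
Proof.
rewrite /g !mulrDr expRD exprDn mulr_suml mulr_sumr.
rewrite -(big_mkord xpredT (fun l => expR (- nu * s) * ((nu * s) ^+ l / l`!%:R) *
  (expR (- nu * t) * ((nu * t) ^+ (n - l) / (n - l)`!%:R)))) big_nat_rev big_mkord /=.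
apply: eq_bigr => -[l] /= ln _; rewrite ltnS in ln; rewrite add0n subSS subKn//.
have f0 q : (q`!)%:R != 0 :> R by rewrite pnatr_eq0 -lt0n fact_gt0.
have -> : (n`!)%:R = ('C(n, l) * (l`! * (n - l)`!))%:R :> R by rewrite bin_fact.
rewrite -mulr_natr !natrM.
have b0 : ('C(n, l))%:R != 0 :> R by rewrite pnatr_eq0 -lt0n bin_gt0.
field.
by rewrite !f0 b0.
Qed.

Lemma erlang_tailD k s t :
  erlang_tail k (s + t) = \sum_(n < k) g n s * erlang_tail (k - n) t.
Proof.
elim: k => [|k IH]; first by rewrite /erlang_tail !big_ord0.
rewrite /erlang_tail big_ord_recr /= -/(erlang_tail k _) IH big_ord_recr /=.
rewrite subSnn /erlang_tail big_ord1 poisson_weightD big_ord_recr /= subnn addrA.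
congr (_ + _); rewrite -big_split /=; apply: eq_bigr => -[n] /= nk _.
by rewrite subSn ?(ltnW nk)// big_ord_recr /= mulrDr.
Qed.

Lemma erlang_tail_ge0 k t : 0 <= t -> 0 <= erlang_tail k t.
Proof. by move=> t0; apply: sumr_ge0 => l _; exact: poisson_weight_ge0. Qed.

Lemma sum_exp_coeff_le k (a : R) : 0 <= a -> \sum_(l < k) a ^+ l / l`!%:R <= expR a.
Proof.
move=> a0; rewrite -(big_mkord xpredT (fun l => a ^+ l / l`!%:R)).
apply: (@nondecreasing_cvgn_le _ (series (exp_coeff a))) k; last first.
  exact: is_cvg_series_exp_coeff.
by apply/nondecreasing_seqP => n; rewrite seriesSr lerDl exp_coeff_ge0.
Qed.

Lemma erlang_tail_le1 k t : 0 <= t -> erlang_tail k t <= 1.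
Proof.
move=> t0; rewrite /erlang_tail /g -mulr_sumr mulNr expRN.
rewrite mulrC ler_pdivrMr ?expR_gt0// mul1r.
by apply: sum_exp_coeff_le; rewrite mulr_ge0// ltW.
Qed.

Lemma poisson_weight_le1 n t : 0 <= t -> g n t <= 1.
Proof.
move=> t0; apply: le_trans (erlang_tail_le1 n.+1 t0).
by rewrite /erlang_tail big_ord_recr /= lerDr; exact: erlang_tail_ge0.
Qed.

End poisson_weights.

(** * The Erlang clock *)

Section clock_law.
Context {R : realType} d (Omega : measurableType d).
Variables (P : probability Omega R) (Y : nat -> {mfun Omega >-> R}).
Variable SS : set (set Omega).
Hypothesis SS_measurable : forall E, SS E -> measurable E.
Hypothesis SS_setT : SS setT.
(* SS is the class of the events of the phase process *)
Hypothesis indep : forall E N (B : nat -> set R), SS E -> (forall l, measurable (B l)) ->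
  P (E `&` \bigcap_(l in [set l | (l < N)%N]) (Y l @^-1` B l)) =
  (P E * \prod_(l < N) P (Y l @^-1` B l))%E.

Definition mclock k : {mfun Omega >-> R} := \sum_(n < k) Y n.

Lemma mclockE k w : mclock k w = clock Y k w.
Proof. by rewrite /mclock mfun_sum. Qed.

Lemma mclockS k w : mclock k.+1 w = mclock k w + Y k w.
Proof. by rewrite !mclockE /clock big_ord_recr. Qed.

Definition erlang k := distribution P (mclock k).

Let mpre k (B : set R) : measurable B -> measurable (Y k @^-1` B).
Proof. by move=> mB; apply: measurable_preimageT. Qed.

Let mpre' k (B : set R) : measurable B -> measurable (mclock k @^-1` B).
Proof. by move=> mB; apply: measurable_preimageT. Qed.

Definition later k N (B : nat -> set R) : set Omega :=
  \bigcap_(l in [set l | (k <= l < N)%N]) (Y l @^-1` B l).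

Let measurable_later k N B : (forall l, measurable (B l)) -> measurable (later k N B).
Proof. by move=> mB; apply: bigcap_measurableType => l _; exact: mpre. Qed.

Lemma later_recl k N B : (k < N)%N ->
  later k N B = Y k @^-1` B k `&` later k.+1 N B.
Proof.
move=> kN; apply/seteqP; split => w h.
  split; first by apply: h; rewrite /= leqnn.
  by move=> l /andP[kl lN]; apply: h; rewrite /= (ltnW kl).
move=> l /andP[kl lN]; case: h => hk h.
by move: kl; rewrite leq_eqVlt => /orP[/eqP <-//|kl]; apply: h; rewrite /= kl.
Qed.

Let pair_mfun k : measurable_fun setT (fun w => (Y k w, mclock k w)).
Proof. by apply: measurable_fun_pair. Qed.

(** The induction step: the law of the sum of the first [k] variables is known to
    be independent of the event [F], which involves the later ones. *)
Let clock_step k (F : set Omega) (B : set R) (r : R) : measurable F -> 0 <= r ->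
  (forall A A', measurable A -> measurable A' ->
    P (F `&` (mclock k @^-1` A `&` Y k @^-1` A')) =
    (r%:E * (P (Y k @^-1` A') * erlang k A))%E) ->
  measurable B ->
  P (F `&` mclock k.+1 @^-1` B) =
  (r%:E * \int[distribution P (Y k)]_y erlang k [set x | B (y + x)%R])%E.
Proof.
move=> mF r0 h mB.
have mF1 : measurable_fun setT (\1_F : Omega -> R) by exact: measurable_indic.
have F0 w : 0 <= \1_F w :> R by rewrite indicE.
pose rho : {measure set (R * R) -> \bar R} := weighted_image P (pair_mfun k) mF1 F0.
have rhoE X : measurable X -> rho X = P (F `&` (fun w => (Y k w, mclock k w)) @^-1` X).
  exact: weighted_image_indic.
pose m1 : {measure set R -> \bar R} := mscale (NngNum r0) (distribution P (Y k)).
pose X := [set x : R * R | B (x.1 + x.2)].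
have mX : measurable X.
  have madd : measurable_fun setT (fun x : R * R => x.1 + x.2).
    by apply: measurable_funD; [exact: measurable_fst|exact: measurable_snd].
  exact: (measurable_preimageT madd mB).
have -> : F `&` mclock k.+1 @^-1` B = F `&` (fun w => (Y k w, mclock k w)) @^-1` X.
  congr (_ `&` _); apply/seteqP; split => w; rewrite /X /= mclockS addrC//.
rewrite -rhoE// -[X in rho X]setIT -integral_indic//.
rewrite (@integral_product_law _ _ _ _ _ m1 (erlang k))//.
- rewrite ge0_integral_mscale//; last 2 first.
  + apply: (@measurable_fun_fubini_tonelli_F _ _ _ _ _ (erlang k) (EFin \o \1_X)).
      by apply/measurable_EFinP; exact: measurable_indic.
    by move=> x; rewrite /= lee_fin indicE.
  + by move=> x _; apply: integral_ge0 => y _; rewrite lee_fin indicE.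
  congr (_ * _)%E; apply: eq_integral => y _.
  rewrite (_ : (fun x => _) = (fun x => (\1_[set x | B (y + x)] x)%:E)); last first.
    by apply/funext => x; rewrite !indicE /X; congr (_%:R%:E); congr nat_of_bool;
      apply/idP/idP; rewrite !inE.
  rewrite integral_indic// ?setIT//.
  have madd : measurable_fun setT (fun x : R => y + x) by exact: measurable_funD.
  exact: (measurable_preimageT madd mB).
- rewrite /m1 /= /mscale; apply: lte_mul_pinfty => //.
  exact: (@probability_lty _ _ _ (distribution P (Y k))).
- move=> A A' mA mA'; rewrite rhoE; last exact: measurableX.
  rewrite (_ : _ @^-1` _ = mclock k @^-1` A' `&` Y k @^-1` A); last first.
    by apply/seteqP; split => w /= [].
  by rewrite h// /m1 /= /mscale muleA.
- by apply/measurable_EFinP; exact: measurable_indic.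
Qed.

(** Independence of the sum from the class [SS] is proved together with its
    independence from the later variables, which the induction requires. *)
Lemma clock_indep_later k N E (B : nat -> set R) (A : set R) : (k <= N)%N -> SS E ->
  (forall l, measurable (B l)) -> measurable A ->
  P (E `&` later k N B `&` mclock k @^-1` A) =
  (P E * \prod_(k <= l < N) P (Y l @^-1` B l) * erlang k A)%E.
Proof.
have fin X : measurable X -> P X = (fine (P X))%:E.
  by move=> mX; rewrite fineK// fin_num_measure.
have prodE k' N' B' : (forall l, measurable (B' l)) ->
    (\prod_(k' <= l < N') P (Y l @^-1` B' l) =
     (\prod_(k' <= l < N') fine (P (Y l @^-1` B' l)))%:E)%E.
  move=> mB'; rewrite (big_morph EFin (@EFinM R) erefl); apply: eq_bigr => l _.
  by rewrite -fin//; exact: mpre.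
elim: k N E B A => [|k IH] N E B A kN SE mB mA.
  have -> : later 0 N B = \bigcap_(l in [set l | (l < N)%N]) (Y l @^-1` B l) by [].
  have := indep N SE mB => ind.
  rewrite big_mkord -ind.
  rewrite /erlang /distribution /= /pushforward.
  have [A0|A0] := pselect (A 0).
    rewrite (_ : mclock 0 @^-1` A = setT); last first.
      by apply/seteqP; split => w //= _; rewrite mclockE /clock big_ord0.
    by rewrite setIT probability_setT mule1.
  rewrite (_ : mclock 0 @^-1` A = set0); last first.
    by apply/seteqP; split => w //=; rewrite mclockE /clock big_ord0.
  by rewrite setI0 measure0 mule0.
have rect N' E' B' A1 A2 : (k < N')%N -> SS E' -> (forall l, measurable (B' l)) ->
    measurable A1 -> measurable A2 ->
    P (E' `&` later k.+1 N' B' `&` (mclock k @^-1` A1 `&` Y k @^-1` A2)) =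
    (P E' * \prod_(k.+1 <= l < N') P (Y l @^-1` B' l) *
     (P (Y k @^-1` A2) * erlang k A1))%E.
  move=> kN' SE' mB' mA1 mA2.
  (* the condition on the variable of index k joins those on the later ones *)
  pose B2 l := if l == k then A2 else B' l.
  have mB2 l : measurable (B2 l) by rewrite /B2; case: ifP.
  have B2E : later k.+1 N' B2 = later k.+1 N' B'.
    by apply/seteqP; split => w h l lk; have := h l lk; case/andP: lk => kl _;
      rewrite /B2 (gtn_eqF kl).
  have := IH N' E' B2 A1 (ltnW kN') SE' mB2 mA1.
  rewrite later_recl// B2E {1}/B2 eqxx big_ltn// {1}/B2 eqxx.
  rewrite (eq_big_nat _ _ (F2 := fun l => P (Y l @^-1` B' l))); last first.
    by move=> l /andP[kl _]; rewrite /B2 (gtn_eqF kl).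
  move=> H; rewrite (_ : _ `&` (_ `&` _) =
    E' `&` (Y k @^-1` A2 `&` later k.+1 N' B') `&` mclock k @^-1` A1); last first.
    apply/seteqP; split => w.
      by move=> [[a b] [c e]]; exact: (conj (conj a (conj e b)) c).
    by move=> [[a [e b]] c]; exact: (conj (conj a b) (conj c e)).
  rewrite H (fin _ (mpre k mA2)) (fin _ (SS_measurable SE')).
  have -> : erlang k A1 = (fine (erlang k A1))%:E by rewrite fineK// fin_num_measure.
  by rewrite (prodE _ _ _ mB') -!EFinM; congr EFin; ring.
have mE := SS_measurable SE.
have r0 : 0 <= fine (P E) * \prod_(k.+1 <= l < N) fine (P (Y l @^-1` B l)).
  by rewrite mulr_ge0 ?fine_ge0// prodr_ge0// => l _; rewrite fine_ge0.
rewrite (clock_step (r := fine (P E) * \prod_(k.+1 <= l < N) fine (P (Y l @^-1` B l))))//; first last.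
- by move=> A1 A2 mA1 mA2; rewrite rect// prodE// EFinM -fin.
- by apply: measurableI => //; exact: measurable_later.
have H : erlang k.+1 A = (\int[distribution P (Y k)]_y erlang k [set x | A (y + x)%R])%E.
  have := @clock_step k setT A 1 measurableT ler01.
  rewrite setTI mul1e; apply => // A1 A2 mA1 mA2.
  have := rect k.+1 setT (fun=> setT) A1 A2 (leqnn _) SS_setT (fun=> measurableT) mA1 mA2.
  rewrite big_geq// mule1 probability_setT !mul1e => <-.
  congr (P _); rewrite (_ : later _ _ _ = setT) ?setIT ?setTI//.
  by apply/seteqP; split => w.
by rewrite H prodE// EFinM -fin.
Qed.

Lemma erlangS k (A : set R) : measurable A ->
  erlang k.+1 A = (\int[distribution P (Y k)]_y erlang k [set x | A (y + x)%R])%E.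
Proof.
move=> mA; have := @clock_step k setT A 1 measurableT ler01.
rewrite setTI mul1e; apply => // A1 A2 mA1 mA2.
have := @clock_indep_later k k.+1 setT (fun=> A2) A1 (leqnSn _) SS_setT (fun=> mA2) mA1.
rewrite big_nat1 probability_setT mul1e !mul1e => <-; congr (P _).
rewrite later_recl// (_ : later k.+1 _ _ = setT); last first.
  by apply/seteqP; split => w // _ l /=; rewrite ltnNge => /andP[/negP].
by rewrite setIT !setTI setIC.
Qed.

Lemma clock_indep k E (A : set R) : SS E -> measurable A ->
  P (E `&` mclock k @^-1` A) = (P E * erlang k A)%E.
Proof.
move=> SE mA.
have := @clock_indep_later k k E (fun=> setT) A (leqnn _) SE (fun=> measurableT) mA.
rewrite big_geq// mule1 => <-; congr (P (_ `&` _)).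
rewrite (_ : later k k _ = setT) ?setIT//.
by apply/seteqP; split => w.
Qed.

End clock_law.

Section exponential_clock.
Context {R : realType} d (Omega : measurableType d).
Variables (P : probability Omega R) (Y : nat -> {mfun Omega >-> R}).
Variable SS : set (set Omega).
Hypothesis SS_measurable : forall E, SS E -> measurable E.
Hypothesis SS_setT : SS setT.
Hypothesis indep : forall E N (B : nat -> set R), SS E -> (forall l, measurable (B l)) ->
  P (E `&` \bigcap_(l in [set l | (l < N)%N]) (Y l @^-1` B l)) =
  (P E * \prod_(l < N) P (Y l @^-1` B l))%E.
Variable nu : R.
Hypothesis nu_gt0 : 0 < nu.
Hypothesis Y_exponential : forall n B, measurable B ->
  distribution P (Y n) B = exponential_prob nu B.
Notation mu := (@lebesgue_measure R).
Implicit Types (t : R) (k l n : nat).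
Notation pdf := (exponential_pdf nu).
Notation g := (poisson_weight nu).
Notation erlang := (erlang P Y).

Let pdf_ge0 x : 0 <= pdf x.
Proof. by apply: exponential_pdf_ge0; exact: ltW. Qed.

Lemma exponential_cdf n t : 0 <= t ->
  distribution P (Y n) `]-oo, t]%classic = (1 - expR (- nu * t))%:E.
Proof.
move=> t0; rewrite Y_exponential//.
transitivity (exponential_prob nu `[0, t]%classic).
  rewrite /exponential_prob integral_mkcond [RHS]integral_mkcond.
  apply: eq_integral => x _; rewrite !patchE !mem_setE !in_itv/=.
  by have [//|x0] := leP 0 x; rewrite lt0_exponential_pdf// if_same.
move: t0; rewrite le_eqVlt => /orP[/eqP<-|t0].
  by rewrite mulr0 expR0 subrr /exponential_prob set_itv1 integral_set1.
by rewrite exponential_prob_itv0c.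
Qed.

Lemma exponential_tail n t : 0 <= t ->
  distribution P (Y n) `]t, +oo[%classic = (g 0 t)%:E.
Proof.
move=> t0; rewrite -setCitvl.
have := probability_setC (distribution P (Y n)) (measurable_itv `]-oo, t]).
move=> /= ->; rewrite exponential_cdf// poisson_weight0 -EFinB.
by congr EFin; ring.
Qed.

(** Tail of the Erlang law on the whole line, the clock being nonnegative. *)
Definition full_tail k t : R := if t < 0 then 1 else erlang_tail nu k t.

Lemma measurable_full_tail k : measurable_fun setT (full_tail k).
Proof.
apply: measurable_fun_ifT => //.
  by apply: measurable_fun_ltr.
apply: measurable_sum => l; apply: continuous_measurable_fun.
exact: continuous_poisson_weight.
Qed.

Lemma full_tail_ge0 k t : 0 <= full_tail k t.
Proof. by rewrite /full_tail; case: ltP => // t0; exact: erlang_tail_ge0. Qed.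

Lemma integral_Y n (G : R -> \bar R) : measurable_fun setT G -> (forall y, 0 <= G y)%E ->
  (\int[distribution P (Y n)]_y G y = \int[mu]_y ((pdf y)%:E * G y))%E.
Proof.
move=> mG G0.
have mid : measurable_fun setT (fun x : measurableTypeR R => (x : R)) by [].
have mpdf : measurable_fun setT pdf by exact: measurable_exponential_pdf.
rewrite -(@integral_transfer _ _ (measurableTypeR R) _ R mu _ _ mid mpdf pdf_ge0 (distribution P (Y n)))//.
by move=> A mA; exact: (esym (Y_exponential n mA)).
Qed.

Lemma poisson_weight_convolution l t : 0 <= t ->
  (\int[mu]_(y in `[0%R, t]) (pdf y * g l (t - y))%:E = (g l.+1 t)%:E)%E.
Proof.
rewrite le_eqVlt => /orP[/eqP<-|t0].
  by rewrite set_itv1 integral_set1 poisson_weight_at0.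
pose K := nu ^+ l.+1 * expR (- nu * t) / l`!%:R.
pose F (y : R) := - K / l.+1%:R * (t - y) ^+ l.+1.
pose f (y : R) := K * (t - y) ^+ l.
have cf : continuous f.
  move=> y; apply: cvgM; first exact: cvg_cst.
  apply: (@continuous_comp _ _ _ (fun y => t - y) (fun x => x ^+ l)).
    by apply: cvgB; [exact: cvg_cst|exact: cvg_id].
  exact: exprn_continuous.
have cF : continuous F.
  move=> y; apply: cvgM; first exact: cvg_cst.
  apply: (@continuous_comp _ _ _ (fun y => t - y) (fun x => x ^+ l.+1)).
    by apply: cvgB; [exact: cvg_cst|exact: cvg_id].
  exact: exprn_continuous.
have dF (y : R) : is_derive y 1 F (f y).
  have d1 : is_derive y 1 (fun y : R => t - y) (- 1).
    have := @is_deriveB R R R (cst t) id y 1 0 1 (is_derive_cst _ _ _) (is_derive_id _ _).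
    by rewrite sub0r.
  have d2 := is_deriveX l.+1 d1.
  have d3 := @is_deriveZ R R R _ (- K / l.+1%:R) y 1 _ d2.
  have FE : F = (- K / l.+1%:R) \*: ((fun y : R => t - y) ^+ l.+1).
    by apply/funext => z; rewrite /F /= exprfctE.
  rewrite FE; apply: (is_derive_eq d3).
  rewrite /f /= /GRing.scale /=; field.
  by rewrite ?nat1r ?natr1 pnatr_eq0.
transitivity (\int[mu]_(y in `[0%R, t]) (f y)%:E)%E.
  apply: eq_integral => y; rewrite inE/= in_itv/= => /andP[y0 yt].
  rewrite exponential_pdfE// /f /K /poisson_weight; congr EFin.
  have -> : expR (- nu * t) = expR (- nu * y) * expR (- nu * (t - y)).
    by rewrite -expRD; congr expR; ring.
  rewrite exprMn; have f0 : l`!%:R != 0 :> R by rewrite pnatr_eq0 -lt0n fact_gt0.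
  by rewrite exprS; field.
rewrite (@continuous_FTC2 _ f F 0 t)//.
- rewrite -EFinB; congr EFin; rewrite /F subrr expr0n mulr0 sub0r subr0.
  rewrite /K /poisson_weight factS natrM exprMn.
  have f0 : l`!%:R != 0 :> R by rewrite pnatr_eq0 -lt0n fact_gt0.
  have l0 : l.+1%:R != 0 :> R by rewrite pnatr_eq0.
  by field; rewrite f0 nat1r l0.
- exact: continuous_subspaceT.
- split.
  + by move=> y _; exact: ex_derive.
  + by apply: cvg_at_right_filter; exact: cF.
  + by apply: cvg_at_left_filter; exact: cF.
- by move=> y _; rewrite derive1E; exact: derive_val.
Qed.

(** Conditioning on one more exponential variable convolves the tail with the
    exponential density, which turns the weights [g l] into [g l.+1]. *)
Lemma erlang_tailE k t : erlang k `]t, +oo[%classic = (full_tail k t)%:E.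
Proof.
elim: k t => [|k IH] t.
  rewrite /erlang /distribution /= /pushforward /full_tail /erlang_tail big_ord0.
  case: ltP => t0.
    rewrite (_ : _ @^-1` _ = setT) ?probability_setT//.
    by apply/seteqP; split => w //= _; rewrite in_itv/= andbT mclockE /clock big_ord0.
  rewrite (_ : _ @^-1` _ = set0) ?measure0//.
  apply/seteqP; split => w //=; rewrite in_itv/= andbT mclockE /clock big_ord0.
  by rewrite ltNge t0.
rewrite (erlangS SS_measurable SS_setT indep)//.
have mT : measurable_fun setT (fun y : R => full_tail k (t - y)).
  apply: measurableT_comp; first exact: measurable_full_tail.
  exact: measurable_funB.
transitivity (\int[distribution P (Y k)]_y (full_tail k (t - y))%:E)%E.
  apply: eq_integral => y _; rewrite -IH; congr (erlang k _).
  by apply/seteqP; split => x /=; rewrite !in_itv/= !andbT ltrBlDl.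
rewrite integral_Y//; last 2 first.
- exact/measurable_EFinP.
- by move=> y; rewrite lee_fin full_tail_ge0.
have mpdf : measurable_fun setT pdf by exact: measurable_exponential_pdf.
have [t0|t0] := ltP t 0.
  rewrite /full_tail t0; transitivity (distribution P (Y k) [set: R]); last first.
    exact: probability_setT.
  rewrite Y_exponential//.
  apply: eq_integral => y _; have [y0|y0] := ltP y 0.
    by rewrite lt0_exponential_pdf// mul0e.
  have -> : t - y < 0 by rewrite subr_lt0 (lt_le_trans t0).
  by rewrite mule1.
rewrite [in RHS]/full_tail [in RHS]ltNge t0 /=.
transitivity (\int[mu]_(y in `[0%R, t] `|` `]t, +oo[) ((pdf y)%:E * (full_tail k (t - y))%:E))%E.
  rewrite [RHS]integral_mkcond; apply: eq_integral => y _; rewrite patchE.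
  case: ifPn => // /negP yn; have [y0|y0] := ltP y 0.
    by rewrite lt0_exponential_pdf// mul0e.
  exfalso; apply: yn; rewrite inE /setU /= !in_itv/= andbT y0 /=.
  by have [|] := leP y t; [left|right].
rewrite ge0_integral_setU//=; last 3 first.
- by apply/measurable_funTS/measurable_EFinP; exact: measurable_funM.
- by move=> y _; rewrite -EFinM lee_fin mulr_ge0// full_tail_ge0.
- apply/disj_setPS => y /=; rewrite !in_itv/= andbT => -[/andP[_ yt] ty].
  by have := le_lt_trans yt ty; rewrite ltxx.
have -> : (\int[mu]_(y in `]t, +oo[) ((pdf y)%:E * (full_tail k (t - y))%:E) = (g 0 t)%:E)%E.
  rewrite -(exponential_tail k t0) Y_exponential//.
  apply: eq_integral => y; rewrite inE/= in_itv/= andbT => ty.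
  by rewrite /full_tail subr_lt0 ty mule1.
transitivity (\sum_(l < k) (g l.+1 t)%:E + (g 0 t)%:E)%E; last first.
  by rewrite /erlang_tail big_ord_recl EFinD -sumEFin addeC.
congr (_ + _)%E.
under [RHS]eq_bigr do rewrite -poisson_weight_convolution//.
rewrite -ge0_integral_sum//.
- apply: eq_integral => y; rewrite inE/= in_itv/= => /andP[y0 yt].
  by rewrite /full_tail ltNge subr_ge0 yt /= -EFinM /erlang_tail mulr_sumr sumEFin.
- move=> l; apply/measurable_funTS/measurable_EFinP/measurable_funM => //.
  apply: measurableT_comp; last exact: measurable_funB.
  by apply: continuous_measurable_fun; exact: continuous_poisson_weight.
- move=> l y /=; rewrite in_itv/= => /andP[y0 yt].
  by rewrite lee_fin mulr_ge0// poisson_weight_ge0// subr_ge0.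
Qed.

End exponential_clock.

(** Half-lines are stable by intersection and generate the events. *)
Lemma tails_law_unique (R : realType) (m1 m2 : {measure set R -> \bar R}) (B : set R) :
  (forall u : R, m1 `]u, +oo[%classic < +oo)%E ->
  (forall u : R, m1 `]u, +oo[%classic = m2 `]u, +oo[%classic) ->
  measurable B -> m1 B = m2 B.
Proof.
move=> fin1 tail mB.
pose GG : set (set R) := [set A | exists x, A = `]x, +oo[%classic].
apply: (@g_sigma_algebra_measure_unique _ _ _ GG _ (fun n => `](- n%:R), +oo[%classic)) => //.
- by move=> _ [x ->]; exact: measurable_itv.
- by move=> n; exists (- n%:R).
- apply/seteqP; split => // t _; exists (Num.truncn `|t|).+1 => //=.
  rewrite in_itv/= andbT ltrNl; apply: le_lt_trans (truncnS_gt _).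
  by rewrite -normrN ler_norm.
- move=> _ _ [x ->] [y ->]; exists (Num.max x y); rewrite predeqE => t.
  rewrite /setI /= !in_itv/= !andbT gt_max.
  by split => [[-> ->]|/andP[]].
- by move=> _ [x ->]; exact: tail.
- have /= h := congr1 (fun C => C B) (RGenOInfty.measurableE R).
  have : (ocitv (R:=R)).-sigma.-measurable B by [].
  by rewrite h.
Qed.

Section erlang_memoryless.
Context {R : realType}.
Variable nu : R.
Hypothesis nu_gt0 : 0 < nu.
Variable erl : nat -> probability R R.
Hypothesis erl_tail : forall k t, erl k `]t, +oo[%classic = (full_tail nu k t)%:E.
Notation g := (poisson_weight nu).

(** The memoryless property: after time [s], during which [n] points have
    occurred, the remaining time to the [k]-th point has the law of the time to
    the [k - n]-th one. *)
Lemma erlang_shift k (s : R) (B : set R) : 0 <= s -> measurable B ->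
  B `<=` `]0, +oo[%classic ->
  erl k ((fun t => t - s) @^-1` B) = (\sum_(n < k) (g n s)%:E * erl (k - n)%N B)%E.
Proof.
move=> s0 mB B0.
have ms : measurable_fun setT (fun t : R => t - s) by exact: measurable_funB.
have m1 (u : R) : measurable_fun setT (\1_(`]u, +oo[%classic) : R -> R).
  by exact: measurable_indic.
have p1 (u t : R) : 0 <= \1_(`]u, +oo[%classic) t :> R by rewrite indicE.
have g0 n : 0 <= g n s by exact: poisson_weight_ge0.
pose W1 : {measure set R -> \bar R} := weighted_image (erl k) ms (m1 s) (p1 s).
pose W2 n : {measure set R -> \bar R} :=
  mscale (NngNum (g0 n)) (weighted_image (erl (k - n)%N) (@measurable_id _ R setT) (m1 0) (p1 0)).
pose M2 : {measure set R -> \bar R} := msum W2 k.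
have W1E A : measurable A -> W1 A = erl k (`]s, +oo[%classic `&` (fun t => t - s) @^-1` A).
  by move=> mA; rewrite /W1 /= weighted_image_indic.
have M2E A : measurable A ->
    M2 A = (\sum_(n < k) (g n s)%:E * erl (k - n)%N (`]0%R, +oo[%classic `&` A))%E.
  move=> mA; rewrite /M2 /= /msum; apply: eq_bigr => n _.
  by rewrite /W2 /= /mscale; congr (_ * _)%E; exact: weighted_image_indic.
have -> : (fun t => t - s) @^-1` B = `]s, +oo[%classic `&` (fun t => t - s) @^-1` B.
  apply/esym/setIidr => t /= /B0 /=; rewrite !in_itv/= !andbT; by rewrite subr_gt0.
rewrite -W1E//; transitivity (M2 B); last first.
  rewrite M2E//; apply: eq_bigr => n _; congr (_ * erl _ _)%E.
  exact: setIidr.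
have tail (u : R) : W1 `]u, +oo[%classic = M2 `]u, +oo[%classic.
  rewrite W1E// M2E//.
  pose v := Num.max 0 u; have v0 : 0 <= v by rewrite le_max lexx.
  rewrite (_ : _ `&` _ = `]s + v, +oo[%classic); last first.
    rewrite predeqE => t; rewrite /setI /= !in_itv/= !andbT -ltrBrDl gt_max subr_gt0.
    by split => [[-> ->]|/andP[]].
  rewrite erl_tail /full_tail ltNge addr_ge0//= erlang_tailD// -sumEFin.
  apply: eq_bigr => n _; rewrite EFinM; congr (_ * _)%E.
  rewrite (_ : _ `&` _ = `]v, +oo[%classic).
    by rewrite erl_tail /full_tail ltNge v0.
  rewrite predeqE => t; rewrite /setI /= !in_itv/= !andbT gt_max.
  by split => [[-> ->]|/andP[]].
apply: tails_law_unique => // u; rewrite W1E//.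
by apply: probability_lty; apply: measurableI => //; exact: measurable_preimageT.
Qed.

End erlang_memoryless.

(** * First-passage probabilities *)

Section first_passage.
Context {R : realType} {m : nat}.
Notation Pi := (trajectory R m).
Notation S := 'I_m.+1.
Implicit Types (t s r z x y h : R) (i j k : S) (n l : nat) (f : Pi).
Variable p : R -> S -> S -> R.
Variable Q : S -> probability Pi R.
Hypothesis Q_cylinder : forall i (w : seq (R * S)), sorted time_le w ->
  all (fun tj => 0 <= tj.1) w -> Q i (cylinder w) = (chain_prob p 0 i w)%:E.
Variable c : S -> R.
Variable nu : R.
Hypothesis nu_gt0 : 0 < nu.
Notation g := (poisson_weight nu).
Notation hit := (hit c).
Notation lev := (lev c).

(** The weight of a path: the probability, given the path, that the clock is in
    stage [n] when the level first goes below [-z], on the event that this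
    happens in phase [j]. *)
Definition passage n z j f : R := stopped (g n) j (hit z f) f.
Local Notation F := passage.

Lemma passage_ge0 n z j f : 0 <= F n z j f.
Proof.
rewrite /F /stopped; case: ifP => // _; apply: poisson_weight_ge0 => //.
exact/fine_ge0/hit_ge0.
Qed.

Lemma sum_passage N z f : \sum_(n < N) \sum_j F n z j f =
  if (hit z f < +oo)%E then erlang_tail nu N (fine (hit z f)) else 0.
Proof.
rewrite /erlang_tail; under eq_bigr do rewrite stopped_sum.
by case: ifP => // _; rewrite big1.
Qed.

Lemma sum_passage_le1 N z f : \sum_(n < N) \sum_j F n z j f <= 1.
Proof.
rewrite sum_passage; case: ifP => // _.
by apply: erlang_tail_le1 => //; exact/fine_ge0/hit_ge0.
Qed.

Lemma passage_le1 n z j f : F n z j f <= 1.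
Proof.
rewrite /F /stopped; case: ifP => // _; apply: poisson_weight_le1 => //.
exact/fine_ge0/hit_ge0.
Qed.

Lemma measurable_passage2 d (T : measurableType d) n j (a : T -> R) (q : T -> Pi) :
  measurable_fun setT a -> measurable_fun setT q ->
  measurable_fun setT (fun e => F n (a e) j (q e)).
Proof.
move=> ma mq; apply: measurable_stopped => //.
- apply: continuous_measurable_fun; exact: continuous_poisson_weight.
- exact: measurable_hit_at.
- by move=> e; exact: hit_ge0.
Qed.

Lemma measurable_passage n z j : measurable_fun setT (F n z j).
Proof. by apply: (@measurable_passage2 _ _ n j (cst z) id) => //; exact: measurable_cst. Qed.

Lemma measurable_shift_at_hit z :
  measurable_fun setT (fun f : Pi => shift (fine (hit z f)) f).
Proof.
apply: measurable_random_shift => //.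
by apply: measurableT_comp; [exact: fine_measurable|exact: measurable_hit_at].
Qed.

Lemma passage_plus n z j f : 0 <= z -> 0 < c j -> F n z j f = 0.
Proof.
move=> z0 cj; rewrite /F /stopped; case: ifP => // /andP[hf /eqP fj].
have h0 := hit_ge0 c z f.
move: hf h0 fj; case E : (hit z f) => [t| |]//= _ _ fj.
by have := rate_at_hit z0 E; rewrite fj ltNge ltW.
Qed.

Lemma passage_add n x y j f : 0 <= x -> 0 <= y ->
  F n (x + y) j f = \sum_(l < n.+1) \sum_k
    F l x k f * F (n - l)%N y j (shift (fine (hit x f)) f).
Proof.
move=> x0 y0; have h0 := hit_ge0 c x f.
transitivity (\sum_(l < n.+1) (\sum_k F l x k f) *
    F (n - l)%N y j (shift (fine (hit x f)) f)); last first.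
  by apply: eq_bigr => l _; rewrite mulr_suml.
under eq_bigr do rewrite stopped_sum.
case E : (hit x f) => [t| |]; last 2 first.
- rewrite /= big1; last by move=> l _; rewrite mul0r.
  have : (hit x f <= hit (x + y) f)%E by apply: hit_homo; rewrite lerDl.
  by rewrite E leye_eq /F /stopped => /eqP ->.
- by move: h0; rewrite E.
rewrite ltry /= /F (hit_add x0 y0 E) /stopped.
have t0 : 0 <= t by move: h0; rewrite E.
have := hit_ge0 c y (shift t f); case E' : (hit y (shift t f)) => [u| |]//= u0.
  rewrite !ltry /= ger0_norm//.
  case: eqVneq => _; last by rewrite big1// => l _; rewrite mulr0.
  by rewrite -poisson_weightD.
by rewrite /= ?ltxx /= big1// => l _; rewrite ?ltxx /= mulr0.
Qed.

(** The probability, starting in phase [i], that the level first goes below [-z]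
    in phase [j] and during stage [n]. *)
Definition passage_prob n z i j : R := fine (\int[Q i]_f (F n z j f)%:E)%E.
Local Notation V := passage_prob.

Lemma integral_unit_fin i (G : Pi -> R) : measurable_fun setT G ->
  (forall f, 0 <= G f <= 1) -> (0 <= \int[Q i]_f (G f)%:E <= 1)%E.
Proof.
move=> mG G01; apply/andP; split.
  by apply: integral_ge0 => f _; rewrite lee_fin; case/andP: (G01 f).
apply: (@le_trans _ _ (\int[Q i]_f (cst 1%E f))%E).
  apply: ge0_le_integral => //.
  - by move=> f _; rewrite lee_fin; case/andP: (G01 f).
  - exact/measurable_EFinP.
  - by move=> f _; rewrite lee_fin; case/andP: (G01 f).
by rewrite integral_cst// mul1e; exact: probability_le1.
Qed.

Lemma passage_probE n z i j : (V n z i j)%:E = (\int[Q i]_f (F n z j f)%:E)%E.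
Proof.
rewrite /V fineK// ge0_fin_numE; last first.
  by apply: integral_ge0 => f _; rewrite lee_fin passage_ge0.
have /andP[_ h] : (0 <= \int[Q i]_f (F n z j f)%:E <= 1)%E.
  apply: integral_unit_fin; first exact: measurable_passage.
  by move=> f; rewrite passage_ge0 passage_le1.
by rewrite (le_lt_trans h)// ltry.
Qed.

Lemma passage_prob_ge0 n z i j : 0 <= V n z i j.
Proof.
by rewrite -lee_fin passage_probE; apply: integral_ge0 => f _; rewrite lee_fin passage_ge0.
Qed.

Lemma passage_prob_plus n z i j : 0 <= z -> 0 < c j -> V n z i j = 0.
Proof.
by move=> z0 cj; rewrite /V integral0_eq// => f _; rewrite passage_plus.
Qed.

Lemma sum_passage_prob N z i :
  (\sum_(n < N) \sum_j V n z i j)%:E =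
  (\int[Q i]_f (\sum_(n < N) \sum_j F n z j f)%:E)%E.
Proof.
under eq_integral do rewrite -sumEFin.
rewrite ge0_integral_sum//; first last.
- by move=> n f _; rewrite lee_fin sumr_ge0// => j _; exact: passage_ge0.
- move=> n; apply/measurable_EFinP; apply: measurable_sum => j.
  exact: measurable_passage.
rewrite -sumEFin; apply: eq_bigr => n _.
under eq_integral do rewrite -sumEFin.
rewrite ge0_integral_sum//; first last.
- by move=> j f _; rewrite lee_fin passage_ge0.
- by move=> j; apply/measurable_EFinP; exact: measurable_passage.
by rewrite -sumEFin; apply: eq_bigr => j _; exact: passage_probE.
Qed.

Lemma sum_passage_prob_le1 N z i : \sum_(n < N) \sum_j V n z i j <= 1.
Proof.
rewrite -lee_fin sum_passage_prob.
suff /andP[] : (0 <= \int[Q i]_f (\sum_(n < N) \sum_j F n z j f)%:E <= 1)%E by [].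
apply: integral_unit_fin.
- by do 2 apply: measurable_sum => ?; exact: measurable_passage.
- move=> f; rewrite sum_passage_le1 andbT; do 2 apply: sumr_ge0 => ? _.
  exact: passage_ge0.
Qed.

Lemma passage_prob_le1 n z i j : V n z i j <= 1.
Proof.
rewrite -lee_fin passage_probE.
suff /andP[] : (0 <= \int[Q i]_f (F n z j f)%:E <= 1)%E by [].
apply: integral_unit_fin => [|f]; first exact: measurable_passage.
by rewrite passage_ge0 passage_le1.
Qed.

Lemma strong_markov_passage n x i j (G : Pi -> \bar R) :
  measurable_fun setT G -> (forall f, 0 <= G f)%E ->
  (\int[Q i]_f ((F n x j f)%:E * G (shift (fine (hit x f)) f)) =
   (V n x i j)%:E * \int[Q j]_f G f)%E.
Proof.
move=> mG G0; rewrite passage_probE /F.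
have mh : measurable_fun setT (hit x) by exact: measurable_hit_at.
apply: (strong_markov Q_cylinder mh) => //.
- by move=> f; exact: hit_ge0.
- by move=> r f r0; exact: hit_stop.
- exact: continuous_poisson_weight.
- by move=> t t0; exact: poisson_weight_ge0.
- by move=> t t0; exact: poisson_weight_le1.
Qed.

(** Downward passages form a semigroup in the depth, because the level at the
    passage below [- x] is exactly [- x]. *)
Lemma passage_prob_add n x y i j : 0 <= x -> 0 <= y ->
  V n (x + y) i j = \sum_(l < n.+1) \sum_k V l x i k * V (n - l)%N y k j.
Proof.
move=> x0 y0; apply: EFin_inj; rewrite passage_probE.
have msh := measurable_shift_at_hit x.
have mF l k : measurable_fun setT (fun f =>
    F l x k f * F (n - l)%N y j (shift (fine (hit x f)) f)).
  apply: measurable_funM; first exact: measurable_passage.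
  by apply: measurableT_comp => //; exact: measurable_passage.
have F0 l k f : 0 <= F l x k f * F (n - l)%N y j (shift (fine (hit x f)) f).
  by rewrite mulr_ge0// passage_ge0.
under eq_integral do rewrite passage_add// -sumEFin.
rewrite ge0_integral_sum//; first last.
- by move=> l f _; rewrite lee_fin sumr_ge0.
- by move=> l; apply/measurable_EFinP; apply: measurable_sum => k; exact: mF.
rewrite -sumEFin; apply: eq_bigr => l _.
under eq_integral do rewrite -sumEFin.
rewrite ge0_integral_sum//; first last.
- by move=> k f _; rewrite lee_fin.
- by move=> k; apply/measurable_EFinP; exact: mF.
rewrite -sumEFin; apply: eq_bigr => k _.
under eq_integral do rewrite EFinM.
rewrite (@strong_markov_passage l x i k (fun f => (F (n - l)%N y j f)%:E)).
- by rewrite EFinM !passage_probE.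
- by apply/measurable_EFinP; exact: measurable_passage.
- by move=> f; rewrite lee_fin passage_ge0.
Qed.

End first_passage.

(** * The exponential of a matrix *)

Section matrix_exponential.
Context {R : realType}.
Implicit Types (z s t h e : R) (n k l : nat).

Definition taylor_monomial k z : R := z ^+ k / k`!%:R.
Local Notation mono := taylor_monomial.

Lemma taylor_monomial_ge0 k z : 0 <= z -> 0 <= mono k z.
Proof. by move=> z0; rewrite /mono mulr_ge0 ?invr_ge0 ?exprn_ge0. Qed.

Lemma is_derive_taylor_monomial k z : is_derive z 1 (mono k.+1) (mono k z).
Proof.
have -> : mono k.+1 = (k.+1`!%:R)^-1 \*: (id ^+ k.+1 : R -> R).
  by apply/funext => t; rewrite /mono mulrC fctE.
apply: is_derive_eq.
have fk : (k`!%:R : R) != 0 by rewrite pnatr_eq0 -lt0n fact_gt0.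
have sk : (k.+1%:R : R) != 0 by rewrite pnatr_eq0.
rewrite /mono /GRing.scale /= mulr1 factS natrM.
move: (k`!%:R) (k.+1%:R) (z ^+ k) fk sk => a b u a0 b0.
by field; rewrite a0 b0.
Qed.

Lemma is_derive_taylor_monomial0 z : is_derive z 1 (mono 0) 0.
Proof.
have -> : mono 0 = cst 1 by apply/funext => t; rewrite /mono expr0 fact0 divr1.
exact: is_derive_cst.
Qed.

(** One integration of the bound [K * z ^+ k / k`!], through the monotonicity of
    the primitive minus or plus the function. *)
Lemma taylor_growth (f df : R -> R) (K z : R) k : 0 <= z -> f 0 = 0 ->
  {within `[0, z], continuous f} ->
  (forall s, 0 < s < z -> is_derive s 1 f (df s)) ->
  (forall s, 0 < s < z -> `|df s| <= K * mono k s) ->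
  `|f z| <= K * mono k.+1 z.
Proof.
move=> z0 f0 cf Df bf.
have key (e : R) : `|e| = 1 -> e * f z <= K * mono k.+1 z.
  move=> e1.
  pose G : R -> R := K \*: mono k.+1 - e \*: f.
  have Dg s : s \in `]0, z[ -> is_derive s 1 G (K * mono k s - e * df s).
    rewrite in_itv /= => sz.
    have Dm := is_derive_taylor_monomial k s.
    have Df' := Df _ sz.
    exact: is_derive_eq.
  have cg : {within `[0, z], continuous G}.
    move=> u; rewrite /G; apply: cvgB; last by apply: cvgZl_tmp; exact: cf.
    apply: cvgZl_tmp; apply: continuous_subspaceT => {}u.
    apply: differentiable_continuous; apply/derivable1_diffP.
    by have [] := is_derive_taylor_monomial k u.
  have dg s : s \in `]0, z[ -> derivable G s 1.
    by move=> /Dg[].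
  have pg s : s \in `]0, z[ -> 0 <= derive1 G s.
    move=> sz; rewrite derive1E; have [_ ->] := Dg _ sz.
    rewrite subr_ge0; apply: le_trans (bf s _); last by move: sz; rewrite in_itv.
    by rewrite (le_trans (ler_norm _))// normrM e1 mul1r.
  have := ger0_derive1_le_cc dg pg cg (x := 0) (y := z).
  rewrite !in_itv /= !lexx z0 => /(_ isT isT isT).
  rewrite /G !fctE /= !f0 /GRing.scale /= mulr0 subr0 /mono expr0n /= mul0r mulr0.
  by rewrite subr_ge0.
apply/ler_normlP; split; last by rewrite -[leLHS]mul1r key// normr1.
by rewrite -mulN1r key// normrN1.
Qed.

Definition entry_sum q (U : 'M[R]_q) : R := \sum_i \sum_j `|U i j|.

Lemma entry_sum_ge0 q (U : 'M[R]_q) : 0 <= entry_sum U.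
Proof. by do 2!apply: sumr_ge0 => ? _. Qed.

Lemma entry_sum_ge q (U : 'M[R]_q) i j : `|U i j| <= entry_sum U.
Proof.
rewrite /entry_sum (bigD1 i)//= (bigD1 j)//= -addrA lerDl addr_ge0// sumr_ge0// => k _.
exact: sumr_ge0.
Qed.

Lemma mulmx_entry_le q r (U : 'M[R]_q) (X : 'M[R]_(q, r)) (b : R) i j : 0 <= b ->
  (forall i j, `|X i j| <= b) -> `|(U *m X) i j| <= entry_sum U * b.
Proof.
move=> b0 Xb; rewrite mxE (le_trans (ler_norm_sum _ _ _))//.
apply: (@le_trans _ _ (\sum_l `|U i l| * b)).
  by apply: ler_sum => l _; rewrite normrM ler_wpM2l.
rewrite -mulr_suml ler_wpM2r// /entry_sum [leRHS](bigD1 i)//= lerDl.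
by do 2!apply: sumr_ge0 => ? _.
Qed.

Lemma expmx_entry_le q (U : 'M[R]_q) k i j : `|(U ^+ k) i j| <= entry_sum U ^+ k.
Proof.
elim: k i j => [|k IH] i j.
  by rewrite !expr0 mxE; case: (i == j); rewrite ?mulr1n ?mulr0n ?normr1 ?normr0.
by rewrite !exprS mulmx_entry_le// exprn_ge0// entry_sum_ge0.
Qed.

Lemma scalemx_exp q (U : 'M[R]_q) z k i j : ((z *: U) ^+ k) i j = z ^+ k * (U ^+ k) i j.
Proof.
elim: k i j => [|k IH] i j; first by rewrite !expr0 mul1r.
rewrite !exprS !mxE mulr_sumr; apply: eq_bigr => l _.
by rewrite IH mxE; ring.
Qed.

Lemma taylor_monomial_cvg0 z : mono ^~ z @ \oo --> (0 : R).
Proof. exact: cvg_exp_coeff. Qed.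

(** A bounded solution of [M' = U M] with [M 0 = 1] is the exponential: integrating
    the equation [k] times bounds the remainder of order [k] by [z ^+ k / k`!]. *)
Lemma ode_expm q (U : 'M[R]_q) (M : R -> 'M[R]_q) (B : R) :
  M 0 = 1%:M -> 0 <= B -> (forall z i j, 0 <= z -> `|M z i j| <= B) ->
  (forall z i j, 0 <= z -> {within `[0, z], continuous (fun z => M z i j)}) ->
  (forall z i j, 0 < z -> is_derive z 1 (fun z => M z i j) ((U *m M z) i j)) ->
  forall z, 0 <= z -> expm (z *: U) = M z.
Proof.
move=> M0 B0 MB cM DM.
pose rem k z : 'M[R]_q := M z - \sum_(l < k) mono l z *: U ^+ l.
have remE k i j : (fun z => rem k z i j) =
    (fun z => M z i j) - \sum_(l < k) (U ^+ l) i j \*: mono l.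
  apply/funext => z; rewrite !fctE /rem !mxE summxE; congr (_ - _).
  rewrite fct_sumE; apply: eq_bigr => l _; rewrite mxE mulrC.
  by [].
have cmono l : continuous (mono l).
  move=> u; apply: differentiable_continuous; apply/derivable1_diffP.
  case: l => [|l]; first by have [] := is_derive_taylor_monomial0 u.
  by have [] := is_derive_taylor_monomial l u.
have crem k z i j : 0 <= z -> {within `[0, z], continuous (fun z => rem k z i j)}.
  move=> z0; rewrite remE => u; apply: cvgB; first exact: cM.
  elim/big_ind : _ => [|f g cf cg|l _]; first exact: cvg_cst.
    exact: cvgD.
  by apply: cvgZl_tmp; exact: continuous_subspaceT.
have Drem k z i j : 0 < z ->
    is_derive z 1 (fun z => rem k.+1 z i j) ((U *m rem k z) i j).
  move=> z0; rewrite remE big_ord_recl.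
  have D1 := DM z i j z0.
  have D0 := is_derive_taylor_monomial0 z.
  have Dl (l : 'I_k) : is_derive z 1 (mono (lift ord0 l)) (mono l z).
    exact: is_derive_taylor_monomial.
  apply: is_derive_eq.
  rewrite /rem mulmxBr [RHS]mxE scaler0 add0r [X in _ = _ + X]mxE; congr (_ - _).
  rewrite mulmx_sumr summxE; apply: eq_bigr => l _.
  by rewrite -scalemxAr mxE mulrC exprS.
have rem0 k i j : rem k.+1 0 i j = 0.
  rewrite /rem big_ord_recl M0 [X in _ - (_ + X)]big1 => [|l _].
    by rewrite /mono fact0 expr0 divr1 scale1r expr0 addr0 subrr mxE.
  by rewrite /mono expr0n /= mul0r scale0r.
have bound k z i j : 0 <= z -> `|rem k z i j| <= B * entry_sum U ^+ k * mono k z.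
  elim: k z i j => [|k IH] z i j z0.
    rewrite /rem big_ord0 subr0 expr0 /mono fact0 expr0 divr1 !mulr1.
    exact: MB.
  apply: (@taylor_growth (fun z => rem k.+1 z i j) (fun z => (U *m rem k z) i j)) => //.
  - exact: crem.
  - by move=> s /andP[s0 _]; exact: Drem.
  - move=> s /andP[s0 _]; rewrite exprS.
    have -> : B * (entry_sum U * entry_sum U ^+ k) * mono k s =
        entry_sum U * (B * entry_sum U ^+ k * mono k s) by ring.
    apply: mulmx_entry_le => [|i' j'].
      apply: mulr_ge0; last exact: taylor_monomial_ge0 (ltW s0).
      by rewrite mulr_ge0 ?exprn_ge0 ?entry_sum_ge0.
    by rewrite IH ?ltW.
move=> z z0; apply/matrixP => i j; rewrite mxE.
apply/cvg_lim => //.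
have -> : series (fun k => ((z *: U) ^+ k) i j / k`!%:R) = (fun k => M z i j - rem k z i j).
  apply/funext => k; rewrite /rem !mxE opprB addrC subrK summxE /series /=.
  rewrite big_mkord; apply: eq_bigr => l _; rewrite scalemx_exp mxE /mono.
  by rewrite mulrAC.
rewrite -[X in _ --> X]subr0; apply: cvgB; first exact: cvg_cst.
apply/norm_cvg0P.
apply: (@squeeze_cvgr _ _ _ _ (cst 0) (fun k => B * mono k (entry_sum U * z))).
- near=> k; rewrite normr_ge0 /=.
  by rewrite (le_trans (bound _ _ _ _ z0))// /mono exprMn !mulrA.
- exact: cvg_cst.
- rewrite -[X in _ --> X](mulr0 B); apply: cvgM; [exact: cvg_cst|exact: taylor_monomial_cvg0].
Unshelve. all: by end_near. Qed.

Lemma expm_cvg q (U : 'M[R]_q) i j :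
  cvgn (series (fun k => (U ^+ k) i j / k`!%:R)).
Proof.
apply: normed_cvg; apply: series_le_cvg (is_cvg_series_exp_coeff (entry_sum U)) => k //=.
  by rewrite mulr_ge0 ?invr_ge0 ?exprn_ge0 ?entry_sum_ge0.
by rewrite normrM normfV normr_nat ler_wpM2r ?invr_ge0// expmx_entry_le.
Qed.

Lemma expm0 q i j : expm (0 : 'M[R]_q) i j = (i == j)%:R.
Proof.
rewrite mxE; apply/cvg_lim => //.
have H k : (0 < k)%N ->
    series (fun k => ((0 : 'M[R]_q) ^+ k) i j / k`!%:R) k = (i == j)%:R.
  case: k => // k _; rewrite /series /= big_nat_recl//= big1 ?addr0 => [|l _].
    by rewrite expr0 fact0 divr1 mxE.
  by rewrite expr0n /= mxE mul0r.
apply: cvg_near_cst; near=> k; apply: H.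
by near: k; exact: nbhs_infty_gt.
Unshelve. all: by end_near. Qed.

(** A bound for the coefficients of the exponential series, from the second on. *)
Definition expm_remainder q (U : 'M[R]_q) : R := expR (entry_sum U).

(** For [h <= 1] every term from the second on has a factor [h ^+ 2]. *)
Lemma expm_expansion q (U : 'M[R]_q) h i j : 0 <= h <= 1 ->
  `|expm (h *: U) i j - (i == j)%:R - h * U i j| <= expm_remainder U * h ^+ 2.
Proof.
move=> /andP[h0 h1].
pose s k := series (fun k => ((h *: U) ^+ k) i j / k`!%:R) k.
have cs : (fun k => s k - (i == j)%:R - h * U i j) @ \oo -->
    expm (h *: U) i j - (i == j)%:R - h * U i j.
  do 2!(apply: cvgB; last exact: cvg_cst).
  by rewrite mxE; exact: expm_cvg.
have /cvg_norm cs' := cs.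
suff H k : (1 < k)%N ->
    `|s k - (i == j)%:R - h * U i j| <= expm_remainder U * h ^+ 2.
  rewrite -(cvg_lim (@Rhausdorff R) cs').
  apply: limr_le; first by apply/cvg_ex; eexists; exact: cs'.
  by near=> k; apply: H; near: k; exact: nbhs_infty_gt.
case: k => [|[|k]]// _.
rewrite /s /series /= !big_nat_recl//= expr0 expr1 !fact0 !divr1 [in X in X + _]mxE.
rewrite mxE.
set T := \sum_(_ <= _ < _) _.
have -> : (i == j)%:R + (h * U i j + T) - (i == j)%:R - h * U i j = T by ring.
rewrite /T (le_trans (ler_norm_sum _ _ _))//.
apply: (@le_trans _ _ (h ^+ 2 * \sum_(0 <= l < k) entry_sum U ^+ l.+2 / l.+2`!%:R)).
  rewrite mulr_sumr; apply: ler_sum => l _.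
  rewrite normrM normfV normr_nat mulrA ler_wpM2r ?invr_ge0//.
  rewrite scalemx_exp normrM ger0_norm ?exprn_ge0// ler_pM ?exprn_ge0//.
    by rewrite ler_wiXn2l.
  exact: expmx_entry_le.
rewrite mulrC ler_wpM2r ?exprn_ge0// /expm_remainder /expR.
have H : \sum_(0 <= l < k) entry_sum U ^+ l.+2 / l.+2`!%:R <= series (exp_coeff (entry_sum U)) k.+2.
  rewrite /series /= [leRHS]big_nat_recl//= [X in _ + X]big_nat_recl//= addrA lerDr.
  by rewrite /exp_coeff /= addr_ge0// mulr_ge0 ?invr_ge0 ?exprn_ge0 ?entry_sum_ge0.
apply: le_trans H _; apply: nondecreasing_cvgn_le; last exact: is_cvg_series_exp_coeff.
apply: nondecreasing_series => l _ _.
by rewrite /exp_coeff /= mulr_ge0 ?invr_ge0 ?exprn_ge0 ?entry_sum_ge0.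
Unshelve. all: by end_near. Qed.

End matrix_exponential.

(** * Short times *)

Section short_times.
Context {R : realType} {m : nat}.
Notation Pi := (trajectory R m).
Notation S := 'I_m.+1.
Implicit Types (t s r z x y h e : R) (i j k : S) (n l : nat) (f : Pi).
Variable p : R -> S -> S -> R.
Variable Q : S -> probability Pi R.
Hypothesis Q_cylinder : forall i (w : seq (R * S)), sorted time_le w ->
  all (fun tj => 0 <= tj.1) w -> Q i (cylinder w) = (chain_prob p 0 i w)%:E.
Variable c : S -> R.
Variable nu : R.
Hypothesis nu_gt0 : 0 < nu.
Variables (A : 'M[R]_m.+1) (Kp : R).
Hypothesis p0 : forall i j, p 0 i j = (i == j)%:R.
Hypothesis p_expansion : forall h i j, 0 <= h <= 1 ->
  `|p h i j - (i == j)%:R - h * A i j| <= Kp * h ^+ 2.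
Notation g := (poisson_weight nu).
Notation hit := (hit c).
Notation lev := (lev c).
Notation F := (passage c nu).
Notation V := (passage_prob Q c nu).

Lemma law_state h i j : 0 <= h -> Q i [set f : Pi | f h = j] = (p h i j)%:E.
Proof.
move=> h0; have := @Q_cylinder i [:: (h, j)].
rewrite /= h0 cylinder_cons cylinder_nil setIT subr0 mulr1; exact.
Qed.

Lemma transition_ge0 h i j : 0 <= h -> 0 <= p h i j.
Proof. by move=> h0; rewrite -lee_fin -law_state// measure_ge0. Qed.

Lemma transition_le1 h i j : 0 <= h -> p h i j <= 1.
Proof.
by move=> h0; rewrite -lee_fin -law_state// probability_le1//; exact: measurable_coordinate.
Qed.

Let Kp_ge0 : 0 <= Kp.
Proof.
have := p_expansion ord0 ord0 (_ : 0 <= 1 <= 1); rewrite ler01 lexx expr1n mulr1.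
by move=> /(_ isT); apply: le_trans.
Qed.

(** A constant such that the phase changes during a time [h] with probability at
    most [jump_bound * h]. *)
Definition jump_bound : R := 1 + Kp + entry_sum A.
Notation K := jump_bound.

Lemma jump_bound_ge1 : 1 <= K.
Proof. by rewrite /K -addrA lerDl addr_ge0// entry_sum_ge0. Qed.

Lemma transition_near_id h i j : 0 <= h -> `|p h i j - (i == j)%:R| <= K * h.
Proof.
move=> h0; have [h1|h1] := leP h 1.
  have H := p_expansion i j (_ : 0 <= h <= 1); rewrite h0 h1 in H.
  rewrite -[X in `|X|](subrK (h * A i j)); apply: le_trans (ler_normD _ _) _.
  have := H isT; have hh : h ^+ 2 <= h by rewrite expr2 ler_piMr.
  have : `|h * A i j| <= h * entry_sum A.
    by rewrite normrM ger0_norm// ler_wpM2l// entry_sum_ge.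
  move: (ler_wpM2l Kp_ge0 hh) => a b d.
  rewrite /K; apply: le_trans (lerD d b) _; apply: le_trans (lerD a (lexx _)) _.
  by rewrite [h * _]mulrC -mulrDl ler_wpM2r// -addrA lerDr.
apply: (@le_trans _ _ 1).
  rewrite ler_norml; have := transition_ge0 i j h0; have := transition_le1 i j h0.
  by case: (i == j) => /=; lra.
rewrite -[leLHS]mulr1; apply: ler_pM => //; last exact: ltW.
exact: jump_bound_ge1.
Qed.

Lemma bernoulli_ineq x n : 0 <= x <= 1 -> 1 - n%:R * (1 - x) <= x ^+ n.
Proof.
move=> /andP[x0 x1]; elim: n => [|n IH]; first by rewrite mul0r subr0 expr0.
have xn1 : x ^+ n <= 1 by rewrite exprn_ile1.
have : (1 - x) * x ^+ n <= 1 - x by rewrite ler_piMr// subr_ge0.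
rewrite exprS -natr1; lra.
Qed.

Definition stay e i : set Pi := [set f : Pi | forall u, 0 <= u <= e -> f u = i].

(** By right continuity a path which is in phase [i] at all the dyadic points of
    the interval from [0] to [e] stays in [i]. *)
Let dyadic e i n : seq (R * S) :=
  [seq (l.+1%:R * (e / 2 ^+ n), i) | l <- iota 0 (2 ^ n)].

Let chain_prob_const h i n t :
  chain_prob p t i [seq (t + l.+1%:R * h, i) | l <- iota 0 n] = p h i i ^+ n.
Proof.
have : forall q, chain_prob p (t + q%:R * h) i [seq (t + l.+1%:R * h, i) | l <- iota q n]
    = p h i i ^+ n.
  elim: n => [|n IH] q //=; rewrite IH exprS; congr (p _ _ _ * _).
  by rewrite -natr1; ring.
by move=> /(_ 0%N); rewrite mul0r addr0.
Qed.

Let stayE e i : 0 < e -> stay e i = \bigcap_n cylinder (dyadic e i n).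
Proof.
move=> e0; apply/seteqP; split => f.
  move=> fs n _ tj /mapP[l]; rewrite mem_iota add0n => /andP[_ ln] -> /=; apply: fs.
  rewrite mulr_ge0//=; last by rewrite divr_ge0// ltW.
  rewrite mulrCA ger_pMr// ler_pdivrMr// mul1r.
  by rewrite -natrX ler_nat.
move=> h u /andP[u0]; rewrite le_eqVlt => /orP[/eqP->|ue].
  have := h 0%N I (e, i); apply; apply/mapP; exists 0%N; first by rewrite mem_iota.
  by rewrite mul1r expr0 divr1.
have [d d0 fd] := path_constant_right f u0.
pose n := (Num.truncn (e / d)).+1.
have ned : e / 2 ^+ n < d.
  rewrite ltr_pdivrMr ?exprn_gt0// mulrC -ltr_pdivrMr//.
  apply: (lt_trans (truncnS_gt _)); rewrite -natrX ltr_nat.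
  exact: ltn_expl.
have en0 : 0 < e / 2 ^+ n by rewrite divr_gt0// exprn_gt0.
pose l := Num.truncn (u / (e / 2 ^+ n)).
have ul : u < l.+1%:R * (e / 2 ^+ n) by rewrite -ltr_pdivrMr// truncnS_gt.
have lu : l%:R * (e / 2 ^+ n) <= u.
  rewrite -ler_pdivlMr//; have /truncn_itv/andP[]// : 0 <= u / (e / 2 ^+ n).
  by rewrite divr_ge0// ltW.
rewrite -(fd (l.+1%:R * (e / 2 ^+ n))); last first.
  rewrite (ltW ul)/= -natr1 mulrDl mul1r; apply: ler_ltD => //.
apply: (h n I (l.+1%:R * (e / 2 ^+ n), i)); apply/mapP; exists l => //.
rewrite mem_iota /= add0n; rewrite /l truncn_lt_nat; last by rewrite divr_ge0// ltW.
by rewrite ltr_pdivrMr// mulrCA natrX divff ?mulr1// expf_neq0// pnatr_eq0.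
Qed.

Let dyadic_ge0 e i n : 0 < e -> all (fun tj => 0 <= tj.1) (dyadic e i n).
Proof.
move=> e0; apply/allP => _ /mapP[l _ ->] /=.
by apply: mulr_ge0 => //; apply: divr_ge0; [exact: ltW|exact: exprn_ge0].
Qed.

Lemma measurable_stay e i : 0 < e -> measurable (stay e i).
Proof.
move=> e0; rewrite stayE//; apply: bigcapT_measurable => n.
by apply: measurable_cylinder; exact: dyadic_ge0.
Qed.

(** At the [2 ^ n] dyadic points of order [n] the chain is in [i] with
    probability at least [(1 - K * e / 2 ^ n) ^ (2 ^ n)], which Bernoulli's
    inequality bounds below uniformly in [n]. *)
Lemma stay_prob e i : 0 < e -> ((1 - K * e)%:E <= Q i (stay e i))%E.
Proof.
move=> e0; rewrite stayE//.
have mc n : measurable (cylinder (dyadic e i n)).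
  by apply: measurable_cylinder; exact: dyadic_ge0.
have cvgD : Q i (cylinder (dyadic e i n)) @[n --> \oo] -->
    Q i (\bigcap_n cylinder (dyadic e i n)).
  apply: nonincreasing_cvg_mu => //.
  - by apply: probability_lty.
  - exact: bigcapT_measurable.
  - apply/nonincreasing_seqP => n; rewrite subsetEset => f h tj /mapP[l].
    rewrite mem_iota add0n => /andP[_ ln] -> /=.
    apply: (h (l.+1%:R * (e / 2 ^+ n), i)).
    apply/mapP; exists (l.*2.+1); first by rewrite mem_iota add0n /= expnS mul2n ltn_Sdouble.
    congr (_, _); rewrite exprS invfM.
    rewrite (_ : l.*2.+2%:R = 2 * l.+1%:R :> R); last by rewrite -natrM mul2n.
    have : 2 != 0 :> R by rewrite pnatr_eq0.
    have : (2 ^+ n : R) != 0 by rewrite expf_neq0// pnatr_eq0.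
    by move=> n2 n0; field; rewrite ?n2 ?n0.
rewrite -(cvg_lim _ cvgD)//; apply: lime_ge.
  by apply/cvg_ex; eexists; exact: cvgD.
apply: nearW => n.
have sd : sorted time_le (dyadic e i n).
  rewrite /dyadic sorted_map; apply: (sub_sorted _ (iota_sorted 0 _)) => a b ab.
  by rewrite /time_le /= ler_wpM2r ?divr_ge0 ?(ltW e0)// ler_nat ltnS.
rewrite Q_cylinder ?dyadic_ge0// lee_fin.
have -> : dyadic e i n = [seq (0 + l.+1%:R * (e / 2 ^+ n), i) | l <- iota 0 (2 ^ n)].
  by apply: eq_map => l; rewrite add0r.
rewrite chain_prob_const.
set d := e / 2 ^+ n; have d0 : 0 <= d by rewrite divr_ge0// ltW.
apply: le_trans (bernoulli_ineq _ _); last by rewrite transition_ge0// transition_le1.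
rewrite lerD2l lerN2 natrX.
have := transition_near_id i i d0; rewrite eqxx distrC => H.
have {}H := le_trans (ler_norm _) H.
have -> : K * e = 2 ^+ n * (K * d).
  by rewrite /d mulrCA [2 ^+ n * _]mulrC divfK// expf_neq0// pnatr_eq0.
by rewrite ler_wpM2l// exprn_ge0.
Qed.

Lemma law_start i : Q i [set f : Pi | f 0 = i] = 1%E.
Proof. by rewrite law_state// p0 eqxx. Qed.

End short_times.

(** * Regularity in the level *)

Section passage_regularity.
Context {R : realType} {m : nat}.
Notation Pi := (trajectory R m).
Notation S := 'I_m.+1.
Implicit Types (t s r z x y h e : R) (i j k : S) (n l : nat) (f : Pi).
Variable p : R -> S -> S -> R.
Variable Q : S -> probability Pi R.
Hypothesis Q_cylinder : forall i (w : seq (R * S)), sorted time_le w ->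
  all (fun tj => 0 <= tj.1) w -> Q i (cylinder w) = (chain_prob p 0 i w)%:E.
Variable c : S -> R.
Hypothesis c_neq0 : forall i, c i != 0.
Variable nu : R.
Hypothesis nu_gt0 : 0 < nu.
Variables (A : 'M[R]_m.+1) (Kp : R).
Hypothesis p0 : forall i j, p 0 i j = (i == j)%:R.
Hypothesis p_expansion : forall h i j, 0 <= h <= 1 ->
  `|p h i j - (i == j)%:R - h * A i j| <= Kp * h ^+ 2.
Notation g := (poisson_weight nu).
Notation hit := (hit c).
Notation lev := (lev c).
Notation F := (passage c nu).
Notation V := (passage_prob Q c nu).
Notation K := (jump_bound A Kp).

Let K_ge0 : 0 <= K.
Proof. exact: le_trans ler01 (jump_bound_ge1 p_expansion). Qed.

Lemma passage_prob_lower n z i j (D : set Pi) (a : R) : measurable D -> 0 <= a ->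
  (forall f, D f -> a <= F n z j f) -> (a%:E * Q i D <= (V n z i j)%:E)%E.
Proof.
move=> mD a0 DF; rewrite passage_probE// -[D]setIT -integral_indic// -ge0_integralZl//.
- apply: ge0_le_integral => //.
  + by move=> f _; rewrite -EFinM lee_fin mulr_ge0.
  + by apply: measurable_funeM; apply/measurable_EFinP; exact: measurable_indic.
  + by apply/measurable_EFinP; exact: measurable_passage.
  + move=> f _; rewrite -EFinM lee_fin indicE; case: (boolP (f \in D)) => [|_].
      by rewrite inE mulr1; exact: DF.
    by rewrite mulr0 passage_ge0.
- by apply/measurable_EFinP; exact: measurable_indic.
Qed.

(** Going down by [z] takes a time [z / `|c i|] in phase [i]; the coefficient [nu]
    accounts for a stage that ends before that time, and [2 * K] for a change of
    phase within twice that time. *)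
Definition passage_speed : R := \sum_i (nu + 2 * K) / `|c i|.
Notation B := passage_speed.

Let speed_ge0 i : 0 <= (nu + 2 * K) / `|c i|.
Proof. by rewrite divr_ge0// addr_ge0 ?(ltW nu_gt0)// mulr_ge0. Qed.

Lemma passage_speed_ge0 : 0 <= B.
Proof. by apply: sumr_ge0 => i _; exact: speed_ge0. Qed.

(** A path that stays in phase [i] until twice the time needed reaches the level
    [- z] in phase [i]. *)
Lemma passage_prob_diag i z : c i < 0 -> 0 <= z -> 1 - B * z <= V 0 z i i.
Proof.
move=> ci z0; have ci' : 0 < - c i by rewrite oppr_gt0.
have absci : `|c i| = - c i by rewrite ltr0_norm.
move: z0; rewrite le_eqVlt => /orP[/eqP<-|z0].
  rewrite mulr0 subr0 -lee_fin.
  have := @passage_prob_lower 0 0 i i [set f : Pi | f 0 = i] 1 (measurable_coordinate i (lexx 0)) ler01.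
  rewrite (law_start Q_cylinder p0) mul1e; apply => f /= f0.
  have [e e0 fe] := path_constant_right f (lexx 0).
  have H : hit 0 f = (0 / - c i)%:E.
    apply: (@hit_constant _ _ _ f i e) => //; last by rewrite mulr_gt0.
    by move=> u ue; rewrite fe ?f0// add0r.
  by rewrite /F /stopped H mul0r ltry /= f0 eqxx poisson_weight0 mulr0 expR0.
set a := expR (- nu * (z / - c i)).
have T0 : 0 < z / - c i by rewrite divr_gt0.
pose e := 2 * (z / - c i); have e0 : 0 < e by rewrite mulr_gt0.
have a0 : 0 <= a by exact: expR_ge0.
have := @passage_prob_lower 0 z i i (stay e i) a (measurable_stay i e0) a0.
have -> : (forall f, stay e i f -> a <= F 0 z i f) <-> True.
  split => // _ f fs.
  have H : hit z f = (z / - c i)%:E.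
    apply: (@hit_constant _ _ _ f i e) => //; first exact: ltW.
      by move=> u /andP[u0 ue]; apply: fs; rewrite u0 ltW.
    by rewrite /e mulrCA [- c i * _]mulrC divfK ?gt_eqF// mulr_natl mulr2n ltrDl.
  rewrite /F /stopped H ltry /= fs ?eqxx; last first.
    by rewrite (ltW T0) /e mulr_natl mulr2n lerDl ltW.
  by rewrite poisson_weight0.
move=> /(_ I); have := stay_prob Q_cylinder p_expansion i e0.
have : Q i (stay e i) \is a fin_num by apply: fin_num_measure; exact: measurable_stay.
have := probability_le1 (Q i) (measurable_stay i e0).
case: (Q i (stay e i)) => [q| |]//; rewrite -EFinM !lee_fin => q1 _ q2 q3.
apply: le_trans q3.
have a1 : 1 - nu * (z / - c i) <= a by rewrite -mulNr expR_ge1Dx.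
have aq : a - a * (1 - q) <= a * q by rewrite mulrBr mulr1; lra.
have a1' : a <= 1 by rewrite /a -expR0 ler_expR mulNr oppr_le0 mulr_ge0// ltW.
have aq2 : a * (1 - q) <= 1 - q by rewrite ler_piMl// subr_ge0.
have : B * z >= (nu + 2 * K) * (z / - c i).
  rewrite mulrA mulrAC; rewrite ler_wpM2r ?(ltW z0)//.
  rewrite /B (bigD1 i)//= absci lerDl sumr_ge0// => j _; exact: speed_ge0.
rewrite /e in q2; lra.
Qed.

(** The probabilities sum to at most [1], so that the lower bound on the diagonal
    entry of stage [0] bounds all the others above. *)
Lemma passage_prob_near_id n z i j : c i < 0 -> 0 <= z ->
  `|V n z i j - ((n == 0)%N && (i == j))%:R| <= B * z.
Proof.
move=> ci z0; have D := passage_prob_diag ci z0.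
have Vle1 := passage_prob_le1 Q c nu_gt0 n z i j.
have Vge0 := passage_prob_ge0 Q c nu_gt0 n z i j.
have [/andP[/eqP n0 /eqP ij]|nij] /= := boolP ((n == 0)%N && (i == j)).
  subst n j; rewrite distrC ger0_norm ?subr_ge0//; lra.
rewrite subr0 ger0_norm//.
have := sum_passage_prob_le1 Q c nu_gt0 n.+1 z i.
have S0 l : 0 <= \sum_k V l z i k by apply: sumr_ge0 => k _; exact: passage_prob_ge0.
have le1 : V n z i j + V 0 z i i <= \sum_(l < n.+1) \sum_k V l z i k.
  have [n0|n0] := eqVneq n 0%N.
    subst n; rewrite big_ord1 (bigD1 i)//= [leLHS]addrC lerD2l (bigD1 j)//=; last first.
      by move: nij; rewrite eqxx /= eq_sym.
    by rewrite lerDl sumr_ge0// => k _; exact: passage_prob_ge0.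
  rewrite (bigD1 ord_max)//= lerD//.
    by rewrite (bigD1 j)//= lerDl sumr_ge0// => k _; exact: passage_prob_ge0.
  have o : (ord0 : 'I_n.+1) != ord_max by apply/eqP => /(congr1 val)/= /eqP; rewrite eq_sym (negbTE n0).
  rewrite (bigD1 ord0)//= (bigD1 i)//= -addrA lerDl; apply: addr_ge0.
    by apply: sumr_ge0 => k _; exact: passage_prob_ge0.
  by apply: sumr_ge0 => l _; exact: S0.
lra.
Qed.

Definition passage_lipschitz n : R := (n.+1 * m.+1)%:R * B.

Lemma passage_lipschitz_ge0 n : 0 <= passage_lipschitz n.
Proof. by rewrite mulr_ge0// passage_speed_ge0. Qed.

(** By the semigroup property, an increment of the level costs one more passage,
    from a descending phase, over the distance [h]. *)
Lemma passage_prob_increment n z h i j : 0 <= z -> 0 <= h ->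
  `|V n (z + h) i j - V n z i j| <= passage_lipschitz n * h.
Proof.
move=> z0 h0; rewrite (passage_prob_add Q_cylinder)//.
(* the passage probabilities over the distance 0 *)
pose D l k : R := ((n - l == 0)%N && (k == j))%:R.
have E : V n z i j = \sum_(l < n.+1) \sum_k V l z i k * D l k.
  rewrite (bigD1 ord_max)//= (bigD1 j)//= {1}/D subnn !eqxx mulr1.
  rewrite big1 ?addr0 => [|k kj]; last by rewrite /D (negbTE kj) andbF mulr0.
  rewrite big1 ?addr0// => l ln; rewrite big1// => k _.
  rewrite /D subn_eq0 (_ : (n <= l)%N = false) ?mulr0//.
  apply/negP => nl; move: ln; rewrite -val_eqE /= eqn_leq nl andbT.
  by rewrite -ltnS ltn_ord.
rewrite [X in _ - X]E -sumrB.
apply: le_trans (ler_norm_sum _ _ _) _.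
apply: (@le_trans _ _ (\sum_(l < n.+1) \sum_(k : S) B * h)); last first.
  rewrite !sumr_const !card_ord -mulrnA /passage_lipschitz mulnC -mulrA.
  by rewrite [leRHS]mulr_natl.
apply: ler_sum => l _; rewrite -sumrB.
apply: le_trans (ler_norm_sum _ _ _) _.
apply: ler_sum => k _; rewrite -mulrBr normrM.
rewrite ger0_norm ?passage_prob_ge0//.
have [ck|ck] := ltP (c k) 0; last first.
  rewrite passage_prob_plus//; last by rewrite lt_neqAle eq_sym c_neq0.
  by rewrite mul0r mulr_ge0// passage_speed_ge0.
apply: (@le_trans _ _ (1 * (B * h))); last by rewrite mul1r.
by apply: ler_pM => //; [exact: passage_prob_ge0|exact: passage_prob_le1|exact: passage_prob_near_id].
Qed.

Lemma passage_prob_lipschitz n x y i j : 0 <= x -> 0 <= y ->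
  `|V n x i j - V n y i j| <= passage_lipschitz n * `|x - y|.
Proof.
move=> x0 y0.
have key u v : 0 <= v -> v <= u -> `|V n u i j - V n v i j| <= passage_lipschitz n * `|u - v|.
  move=> v0 vu; rewrite (ger0_norm (_ : 0 <= u - v)) ?subr_ge0// -{1}(subrKC v u).
  by apply: passage_prob_increment; rewrite ?subr_ge0.
have [yx|/ltW xy] := leP y x; first exact: key.
by rewrite distrC (distrC x y); exact: key.
Qed.

End passage_regularity.

(** * The backward equation *)

Section one_step.
Context {R : realType} {m : nat}.
Notation Pi := (trajectory R m).
Notation S := 'I_m.+1.
Implicit Types (t s r z x y h e : R) (i j k : S) (n l q : nat) (f : Pi).
Variable p : R -> S -> S -> R.
Variable Q : S -> probability Pi R.
Hypothesis Q_cylinder : forall i (w : seq (R * S)), sorted time_le w ->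
  all (fun tj => 0 <= tj.1) w -> Q i (cylinder w) = (chain_prob p 0 i w)%:E.
Variable c : S -> R.
Hypothesis c_neq0 : forall i, c i != 0.
Variable nu : R.
Hypothesis nu_gt0 : 0 < nu.
Variables (A : 'M[R]_m.+1) (Kp : R).
Hypothesis p0 : forall i j, p 0 i j = (i == j)%:R.
Hypothesis p_expansion : forall h i j, 0 <= h <= 1 ->
  `|p h i j - (i == j)%:R - h * A i j| <= Kp * h ^+ 2.
Notation g := (poisson_weight nu).
Notation hit := (hit c).
Notation lev := (lev c).
Notation F := (passage c nu).
Notation V := (passage_prob Q c nu).
Notation K := (jump_bound A Kp).
Notation C := (rate_bound c).
Notation Lip := (passage_lipschitz c nu A Kp).

Let C0 : 0 < C. Proof. exact: rate_bound_gt0. Qed.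
Let K_ge0 : 0 <= K.
Proof. exact: le_trans ler01 (jump_bound_ge1 p_expansion). Qed.

(** During a time [h] with [C * h <= z] the level does not go below [- z], so that
    the path can be restarted at time [h]. *)
Lemma passage_step n z j f h : 0 <= h -> C * h <= z ->
  F n z j f = \sum_(l < n.+1) g l h * F (n - l)%N (z + lev f h) j (shift h f).
Proof.
move=> h0 hz.
have E : hit z f = (h%:E + hit (z + lev f h) (shift h f))%E.
  apply: hit_shift => // u /andP[u0 uh].
  have := lev_bound c f u0; move=> /ler_normlP[a _].
  have : C * u <= C * h by rewrite ler_wpM2l// ltW.
  lra.
rewrite /F E /stopped; have := hit_ge0 c (z + lev f h) (shift h f).
case: (hit _ _) => [u| |]//= u0.
  rewrite !ltry /= ger0_norm//.
  case: eqVneq => _; last by rewrite big1// => l _; rewrite mulr0.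
  by rewrite -poisson_weightD.
by rewrite ?ltxx /= big1// => l _; rewrite ?ltxx /= mulr0.
Qed.

Let lev_lower f h z : 0 <= h -> C * h <= z -> 0 <= z + lev f h.
Proof.
by move=> h0 hz; have := lev_bound c f h0; move=> /ler_normlP[a _]; lra.
Qed.

(** The contribution of the phase [k] at time [h] to [passage_prob_step]. *)
Definition after_step q z h i j k : \bar R :=
  (\int[Q i]_f ((\1_[set f : Pi | f h = k] f)%:E * (V q (z + lev f h) k j)%:E))%E.

Lemma measurable_V_lev q z h k j :
  measurable_fun setT (fun f : Pi => (V q (z + lev f h) k j)%:E).
Proof.
pose G (x : Pi * Pi) : \bar R := (F q (z + lev x.1 h) j x.2)%:E.
have mG : measurable_fun setT G.
  apply/measurable_EFinP; apply: measurable_passage2 => //.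
  apply: measurable_funD => //.
  have mh : measurable_fun setT (fun x : Pi * Pi => (h, x.1)).
    by apply: measurable_fun_pair => //; exact: measurable_fst.
  exact: (measurableT_comp (measurable_lev c) mh).
have G0 w : (0 <= G w)%E by rewrite lee_fin passage_ge0.
have := measurable_fun_fubini_tonelli_F (m2 := Q k) G mG G0.
congr (measurable_fun _ _); apply/funext => f; rewrite /fubini_F /G /=.
by rewrite passage_probE.
Qed.

Lemma passage_prob_step n z i j h : 0 <= h -> C * h <= z ->
  (V n z i j)%:E = (\sum_(l < n.+1) (g l h)%:E * \sum_k after_step (n - l)%N z h i j k)%E.
Proof.
move=> h0 hz; rewrite passage_probE//.
have mlev : measurable_fun setT (fun f : Pi => z + lev f h).
  apply: measurable_funD => //.
  have mh : measurable_fun setT (fun f : Pi => (h, f)) by exact: measurable_fun_pair.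
  exact: (measurableT_comp (measurable_lev c) mh).
have mF q : measurable_fun setT (fun f : Pi => F q (z + lev f h) j (shift h f)).
  by apply: measurable_passage2 => //; exact: measurable_shift.
under eq_integral do rewrite (passage_step _ _ _ h0 hz) -sumEFin.
rewrite ge0_integral_sum//; first last.
- by move=> l f _; rewrite lee_fin mulr_ge0 ?passage_ge0 ?poisson_weight_ge0.
- by move=> l; apply/measurable_EFinP/measurable_funM.
apply: eq_bigr => l _; under eq_integral do rewrite EFinM.
rewrite ge0_integralZl//; first last.
- by rewrite lee_fin poisson_weight_ge0.
- by move=> f _; rewrite lee_fin passage_ge0.
- exact/measurable_EFinP.
congr (_ * _)%E; set q := (n - l)%N.
pose G k (x : Pi * Pi) : \bar R := (F q (z + lev x.1 h) j x.2)%:E.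
have mG k : measurable_fun setT (G k).
  apply/measurable_EFinP; apply: measurable_passage2 => //.
  apply: measurable_funD => //.
  have mh : measurable_fun setT (fun x : Pi * Pi => (h, x.1)).
    by apply: measurable_fun_pair => //; exact: measurable_fst.
  exact: (measurableT_comp (measurable_lev c) mh).
have G0 k w : (0 <= G k w)%E by rewrite lee_fin passage_ge0.
have levstop f : lev (stop h f) h = lev f h by rewrite lev_stop.
transitivity (\int[Q i]_f (\sum_k
    ((\1_[set f : Pi | f h = k] f)%:E * G k (stop h f, shift h f))))%E.
  apply: eq_integral => f _; rewrite (bigD1 (f h))//= big1 ?adde0.
    by rewrite indicE mem_set// mul1e /G /= levstop.
  move=> k; rewrite eq_sym => /eqP fk.
  by rewrite indicE memNset ?mul0e.
rewrite ge0_integral_sum//; first last.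
- by move=> k f _; rewrite mule_ge0// lee_fin.
- move=> k; apply: emeasurable_funM.
    by apply/measurable_EFinP; apply: measurable_indic; exact: measurable_coordinate.
  apply: (measurableT_comp (mG k)).
  by apply: measurable_fun_pair; [exact: measurable_stop|exact: measurable_shift].
apply: eq_bigr => k _; rewrite (markov Q_cylinder i k h0 (mG k) (G0 k)).
apply: eq_integral => f _; congr (_ * _)%E.
rewrite [RHS](passage_probE Q c nu_gt0); apply: eq_integral => w _.
by rewrite /G [(_, w).1]/= [(_, w).2]/= levstop.
Qed.

(** Replacing the passage probability at the random level by a constant [v] costs
    at most [a] on an event of probability of order [h]. *)
Lemma after_step_approx q z h i j k (D : set Pi) (v a : R) :
  0 < h -> 0 <= v -> 0 <= a -> measurable D ->
  (Q i ([set f : Pi | f h = k] `&` D) <= (K * h)%:E)%E ->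
  (forall f, f h = k -> `|V q (z + lev f h) k j - v| <= a * \1_D f) ->
  exists2 b, after_step q z h i j k = b%:E & `|b - p h i k * v| <= a * (K * h).
Proof.
move=> h0 v0 a0 mD QD Hv.
have mS : measurable [set f : Pi | f h = k] by apply: measurable_coordinate; exact: ltW.
have mI (E : set Pi) : measurable E -> measurable_fun setT (fun f => (\1_E f : R)%:E).
  by move=> mE; apply/measurable_EFinP; exact: measurable_indic.
have mV := measurable_V_lev q z h k j.
have I0 (E : set Pi) f : (0 <= (\1_E f : R)%:E)%E by rewrite lee_fin.
have V0 f : (0 <= (V q (z + lev f h) k j)%:E)%E by rewrite lee_fin passage_prob_ge0.
pose X := [set f : Pi | f h = k].
have QX : (\int[Q i]_f ((\1_X f)%:E * v%:E) = (p h i k * v)%:E)%E.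
  rewrite ge0_integralZr//; last exact: mI.
  rewrite integral_indic// setIT EFinM; congr (_ * _)%E.
  by apply: (law_state Q_cylinder); exact: ltW.
have QXD : (\int[Q i]_f ((\1_(X `&` D) f)%:E * a%:E) <= (a * (K * h))%:E)%E.
  rewrite ge0_integralZr//; last by apply: mI; exact: measurableI.
  rewrite integral_indic//; last exact: measurableI.
  by rewrite setIT muleC EFinM; apply: lee_wpmul2l => //; rewrite lee_fin.
have up : (after_step q z h i j k <= (p h i k * v + a * (K * h))%:E)%E.
  apply: (@le_trans _ _ (\int[Q i]_f ((\1_X f)%:E * v%:E + (\1_(X `&` D) f)%:E * a%:E))%E).
    apply: ge0_le_integral => //.
    - by move=> f _; rewrite mule_ge0.
    - by apply: emeasurable_funM => //; exact: mI.
    - apply: emeasurable_funD; apply: emeasurable_funM => //; apply: mI => //.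
      exact: measurableI.
    move=> f _; rewrite -!EFinM -EFinD lee_fin indicI.
    rewrite /= /X !indicE; case: (boolP (f \in [set f : Pi | f h = k])) => [|_]; last by rewrite !mul0r addr0.
    rewrite inE /= => fk; rewrite !mul1r.
    have := Hv f fk; rewrite indicE => /ler_normlP[_]; lra.
  rewrite ge0_integralD//; last 4 first.
  - by move=> f _; rewrite mule_ge0// lee_fin.
  - by apply: emeasurable_funM => //; exact: mI.
  - by move=> f _; rewrite mule_ge0// lee_fin.
  - by apply: emeasurable_funM => //; apply: mI; exact: measurableI.
  by rewrite QX EFinD leeD2l.
have down : ((p h i k * v)%:E <= after_step q z h i j k + (a * (K * h))%:E)%E.
  apply: (@le_trans _ _ (after_step q z h i j k +
      \int[Q i]_f ((\1_(X `&` D) f)%:E * a%:E))%E); last exact: leeD2l.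
  rewrite -QX /after_step -ge0_integralD//; last 4 first.
  - by move=> f _; rewrite mule_ge0.
  - by apply: emeasurable_funM => //; exact: mI.
  - by move=> f _; rewrite mule_ge0// lee_fin.
  - by apply: emeasurable_funM => //; apply: mI; exact: measurableI.
  apply: ge0_le_integral => //.
  - by move=> f _; rewrite mule_ge0// lee_fin.
  - by apply: emeasurable_funM => //; exact: mI.
  - apply: emeasurable_funD; apply: emeasurable_funM => //; apply: mI => //.
    exact: measurableI.
  move=> f _; rewrite -!EFinM -EFinD lee_fin indicI.
  rewrite /= /X !indicE; case: (boolP (f \in [set f : Pi | f h = k])) => [|_]; last by rewrite !mul0r addr0.
  rewrite inE /= => fk; rewrite !mul1r.
  have := Hv f fk; rewrite indicE => /ler_normlP[]; lra.
have : (0 <= after_step q z h i j k)%E by apply: integral_ge0 => f _; rewrite mule_ge0.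
move: up down; case: (after_step q z h i j k) => [b| |]; last 2 first.
- by move=> + _ _; rewrite leye_eq.
- by [].
rewrite -EFinD !lee_fin => up down _; exists b => //.
by rewrite ler_norml; apply/andP; split; lra.
Qed.

(** If the phase stays in [i] the level moves by exactly [c i * h]. In all other
    cases, whose probability is of order [h], the error on the level is also of
    order [h]. *)
Lemma after_step_expansion q z h i j k : 0 < h <= 1 -> C * h <= z ->
  exists2 b, after_step q z h i j k = b%:E &
   `|b - p h i k * V q (z + (if k == i then c i * h else 0)) k j| <=
      2 * Lip q * C * K * h ^+ 2.
Proof.
move=> /andP[h0 h1] hz; have h0' := ltW h0.
set v := V q _ k j.
have v0 : 0 <= v by exact: passage_prob_ge0.
have Lq0 : 0 <= Lip q by exact: (passage_lipschitz_ge0 c nu_gt0 p_expansion).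
have a0 : 0 <= 2 * Lip q * C * h.
  by do 3?[apply: mulr_ge0 => //]; exact: ltW.
have E : 2 * Lip q * C * K * h ^+ 2 = (2 * Lip q * C * h) * (K * h) by ring.
have ci : `|c i * h| <= C * h.
  by rewrite normrM (ger0_norm h0') ler_wpM2r// rate_le_bound.
have base k' f b : `|b| <= C * h -> `|V q (z + lev f h) k' j - V q (z + b) k' j| <= 2 * Lip q * C * h.
  move=> hb; have zb : 0 <= z + b by move/ler_normlP : hb => [? _]; lra.
  apply: le_trans (passage_prob_lipschitz Q_cylinder c_neq0 nu_gt0 p0 p_expansion _ _ _ _ zb) _.
    exact: lev_lower.
  have -> : 2 * Lip q * C * h = Lip q * (2 * C * h) by ring.
  rewrite ler_wpM2l//.
  have -> : z + lev f h - (z + b) = lev f h - b by ring.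
  apply: le_trans (ler_normB _ _) _.
  have := lev_bound c f h0'; lra.
rewrite E; have [ki|ki] := eqVneq k i.
  have vE : v = V q (z + c i * h) i j by rewrite /v ki eqxx.
  apply: (@after_step_approx _ _ _ _ _ _ (~` stay h i)) => //.
  - by apply: measurableC; exact: measurable_stay.
  - apply: (@le_trans _ _ (Q i (~` stay h i))).
      apply: le_measure; rewrite ?inE//; last by apply: measurableC; exact: measurable_stay.
      apply: measurableI; first exact: measurable_coordinate.
      by apply: measurableC; exact: measurable_stay.
    rewrite probability_setC; last exact: measurable_stay.
    have := stay_prob Q_cylinder p_expansion i h0.
    have : Q i (stay h i) \is a fin_num by apply: fin_num_measure; exact: measurable_stay.
    case: (Q i (stay h i)) => [x| |]//= _.
    by rewrite -EFinB !lee_fin; lra.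
  - move=> f fk; rewrite indicE; case: (boolP (f \in ~` stay h i)) => [_|].
      by rewrite mulr1 vE ki; exact: base.
    rewrite notin_setE /setC /= => /contrapT fs.
    rewrite mulr0 vE ki (@lev_constant _ _ _ f h i)//; last first.
      by move=> u /andP[u0 uh]; apply: fs; rewrite u0 ltW.
    by rewrite subrr normr0.
apply: (@after_step_approx _ _ _ _ _ _ setT) => //.
- rewrite setIT (law_state Q_cylinder)// lee_fin.
  have := transition_near_id Q_cylinder p_expansion i k h0'.
  by rewrite eq_sym (negbTE ki) subr0; apply: le_trans; exact: ler_norm.
- move=> f _; rewrite indicE in_setT mulr1 /v (negbTE ki); apply: base.
  by rewrite normr0; apply: mulr_ge0 => //; exact: ltW.
Qed.

End one_step.

Section big_O.
Context {R : realType}.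
Variable C : R.
Implicit Types (X Y : R -> R -> R) (r : nat).

(** A bound of order [h ^+ r], uniform in [z], as the step [h] tends to [0]; the
    steps are those during which the level cannot change by more than [z]. *)
Definition isO r X := exists2 M, 0 <= M &
  forall z h : R, 0 < h <= 1 -> C * h <= z -> `|X z h| <= M * h ^+ r.

Lemma isO_ext r X Y : (forall z h : R, 0 < h <= 1 -> C * h <= z -> X z h = Y z h) ->
  isO r Y -> isO r X.
Proof. by move=> XY [M M0 H]; exists M => // z h h1 hz; rewrite XY// H. Qed.

Lemma isO_add r X Y : isO r X -> isO r Y -> isO r (fun z h => X z h + Y z h).
Proof.
move=> [M M0 H] [N N0 H']; exists (M + N); first exact: addr_ge0.
move=> z h h1 hz; rewrite mulrDl (le_trans (ler_normD _ _))// lerD//.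
  exact: H.
exact: H'.
Qed.

Lemma isO_opp r X : isO r X -> isO r (fun z h => - X z h).
Proof. by move=> [M M0 H]; exists M => // z h h1 hz; rewrite normrN H. Qed.

Lemma isO_mul r s X Y : isO r X -> isO s Y -> isO (r + s) (fun z h => X z h * Y z h).
Proof.
move=> [M M0 H] [N N0 H']; exists (M * N); first exact: mulr_ge0.
move=> z h h1 hz; rewrite normrM exprD mulrACA ler_pM//.
  exact: H.
exact: H'.
Qed.

Lemma isO_weaken r s X : (s <= r)%N -> isO r X -> isO s X.
Proof.
move=> sr [M M0 H]; exists M => // z h h1 hz; apply: le_trans (H z h h1 hz) _.
rewrite ler_wpM2l//; case/andP: h1 => h0 h1.
by rewrite ler_wiXn2l// ltW.
Qed.

Lemma isO_cst (a : R) : isO 0 (fun _ _ => a).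
Proof. by exists `|a| => // z h _ _; rewrite expr0 mulr1. Qed.

Lemma isO_step : isO 1 (fun _ h => h).
Proof.
by exists 1 => // z h /andP[h0 _] _; rewrite mul1r expr1 ger0_norm// ltW.
Qed.

Lemma isO_zero r : isO r (fun _ _ => 0).
Proof. by exists 0 => // z h _ _; rewrite normr0 mul0r. Qed.

Lemma isO_sum r (I : finType) (X : I -> R -> R -> R) :
  (forall i, isO r (X i)) -> isO r (fun z h => \sum_i X i z h).
Proof.
move=> H.
have : forall w : seq I, isO r (fun z h => \sum_(i <- w) X i z h).
  elim=> [|i w IH].
    by apply: isO_ext (isO_zero r) => z h _ _; rewrite big_nil.
  apply: isO_ext (isO_add (H i) IH) => z h _ _.
  by rewrite big_cons.
exact.
Qed.

End big_O.

Section backward_equation.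
Context {R : realType} {m : nat}.
Notation Pi := (trajectory R m).
Notation S := 'I_m.+1.
Implicit Types (t s r z x y h e : R) (i j k : S) (n l q : nat) (f : Pi).
Variable p : R -> S -> S -> R.
Variable Q : S -> probability Pi R.
Hypothesis Q_cylinder : forall i (w : seq (R * S)), sorted time_le w ->
  all (fun tj => 0 <= tj.1) w -> Q i (cylinder w) = (chain_prob p 0 i w)%:E.
Variable c : S -> R.
Hypothesis c_neq0 : forall i, c i != 0.
Variable nu : R.
Hypothesis nu_gt0 : 0 < nu.
Variables (A : 'M[R]_m.+1) (Kp : R).
Hypothesis p0 : forall i j, p 0 i j = (i == j)%:R.
Hypothesis p_expansion : forall h i j, 0 <= h <= 1 ->
  `|p h i j - (i == j)%:R - h * A i j| <= Kp * h ^+ 2.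
Notation g := (poisson_weight nu).
Notation V := (passage_prob Q c nu).
Notation K := (jump_bound A Kp).
Notation C := (rate_bound c).
Notation Lip := (passage_lipschitz c nu A Kp).
Notation O := (isO C).

Let dom_z z h : 0 < h <= 1 -> C * h <= z -> 0 <= z.
Proof.
move=> /andP[h0 _]; apply: le_trans; apply: mulr_ge0; last exact: ltW.
exact/ltW/rate_bound_gt0.
Qed.

Let dom_zc z h i : 0 < h <= 1 -> C * h <= z -> 0 <= z + c i * h.
Proof.
move=> /andP[h0 _] hz.
have : `|c i * h| <= C * h.
  by rewrite normrM (ger0_norm (ltW h0)) ler_wpM2r ?(ltW h0)// rate_le_bound.
by move=> /ler_normlP[? _]; lra.
Qed.

Let Kp_ge0 : 0 <= Kp.
Proof.
have := p_expansion ord0 ord0 (_ : 0 <= 1 <= 1); rewrite ler01 lexx expr1n mulr1.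
by move=> /(_ isT); apply: le_trans.
Qed.

Lemma O_poisson0 : O 2 (fun _ h => g 0 h - 1 + nu * h).
Proof.
exists (nu ^+ 2); first exact: exprn_ge0 (ltW nu_gt0).
move=> _ h /andP[h0 h1] _; rewrite poisson_weight0 -exprMn mulNr expRN.
set x := nu * h; have x0 : 0 < x by rewrite mulr_gt0.
have e1 : 1 + x <= expR x by exact: expR_ge1Dx.
have e2 : 1 - x <= (expR x)^-1 by rewrite -expRN expR_ge1Dx.
have e3 : (expR x)^-1 <= (1 + x)^-1 by rewrite lef_pV2// ?posrE ?expR_gt0 ?addr_gt0.
have e4 : (1 + x)^-1 <= 1 - x + x ^+ 2.
  rewrite -[leLHS]mul1r ler_pdivrMr ?addr_gt0//.
  have -> : (1 - x + x ^+ 2) * (1 + x) = 1 + x ^+ 3 by ring.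
  by rewrite lerDl exprn_ge0// ltW.
rewrite ger0_norm; lra.
Qed.

Lemma O_poisson1 : O 2 (fun _ h => g 1 h - nu * h).
Proof.
have H : O 1 (fun _ h => g 0 h - 1).
  apply: (@isO_ext _ _ _ _ (fun _ h => (g 0 h - 1 + nu * h) + - (nu * h))).
    by move=> z h _ _; ring.
  apply: isO_add; first by apply: (@isO_weaken _ _ 2 1) => //; exact: O_poisson0.
  apply: isO_opp; rewrite -[1%N]/(0 + 1)%N; apply: isO_mul; [exact: isO_cst|exact: isO_step].
apply: (@isO_ext _ _ _ _ (fun _ h => (nu * h) * (g 0 h - 1))).
  move=> z h _ _; rewrite /poisson_weight expr0 expr1 !fact0.
  by ring.
rewrite -[2%N]/(0 + 1 + 1)%N; apply: isO_mul H.
by apply: isO_mul; [exact: isO_cst|exact: isO_step].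
Qed.

Lemma O_poisson n : O 2 (fun _ h => g n.+2 h).
Proof.
exists (nu ^+ n.+2); first exact: exprn_ge0 (ltW nu_gt0).
move=> _ h /andP[h0 h1] _; rewrite ger0_norm ?poisson_weight_ge0// ?(ltW h0)//.
have -> : g n.+2 h = nu ^+ n.+2 * (h ^+ n.+2 * (expR (- nu * h) * (n.+2`!%:R)^-1)).
  rewrite /poisson_weight exprMn; move: (_ ^+ _) (_ ^+ _) (expR _) (_^-1) => a b u v.
  by ring.
have e1 : expR (- nu * h) <= 1.
  by rewrite -expR0 ler_expR mulNr oppr_le0 mulr_ge0// ltW.
have f1 : (n.+2`!%:R : R)^-1 <= 1 by rewrite invf_le1 ?ltr0n ?fact_gt0// ler1n fact_gt0.
have h2 : h ^+ n.+2 <= h ^+ 2 by rewrite ler_wiXn2l// ltW.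
apply: ler_wpM2l; first exact: exprn_ge0 (ltW nu_gt0).
apply: le_trans h2; apply: ler_piMr; first exact: exprn_ge0 (ltW h0).
by apply: mulr_ile1 => //; rewrite ?expR_ge0// invr_ge0 ler0n.
Qed.

Lemma O_passage q i j : O 0 (fun z _ => V q z i j).
Proof.
exists 1 => // z h h1 hz; rewrite expr0 mulr1 ger0_norm ?passage_prob_ge0//.
exact: passage_prob_le1.
Qed.

Lemma O_passage_increment q i j k : O 1 (fun z h => V q (z + c k * h) i j - V q z i j).
Proof.
exists (Lip q * C).
  apply: mulr_ge0; last exact/ltW/rate_bound_gt0.
  exact: (passage_lipschitz_ge0 c nu_gt0 p_expansion).
move=> z h h1 hz; rewrite expr1.
apply: le_trans (passage_prob_lipschitz Q_cylinder c_neq0 nu_gt0 p0 p_expansion _ _ _ _ _) _.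
- exact: dom_zc h1 hz.
- exact: dom_z h1 hz.
rewrite -[leRHS]mulrA; apply: ler_wpM2l.
  exact: (passage_lipschitz_ge0 c nu_gt0 p_expansion).
have -> : z + c k * h - z = c k * h by ring.
case/andP: h1 => h0 _.
by rewrite normrM (ger0_norm (ltW h0)) ler_wpM2r ?(ltW h0)// rate_le_bound.
Qed.

Definition mean_passage q z i j : R := \sum_k A i k * V q z k j.

Lemma O_mean_passage q i j : O 0 (fun z _ => mean_passage q z i j).
Proof.
apply: isO_sum => k; rewrite -[0%N]/(0 + 0)%N; apply: isO_mul.
  exact: isO_cst.
exact: O_passage.
Qed.

Definition after q z h i j : R := fine (\sum_k after_step Q c nu q z h i j k)%E.

Lemma afterE q z h i j : 0 < h <= 1 -> C * h <= z ->
  (\sum_k after_step Q c nu q z h i j k)%E = (after q z h i j)%:E.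
Proof.
move=> h1 hz; rewrite /after fineK//; apply/sum_fin_numP => k _ _.
have [b -> _] := after_step_expansion Q_cylinder c_neq0 nu_gt0 p0 p_expansion q i j k h1 hz.
by [].
Qed.

Lemma O_after q i j : O 2 (fun z h =>
  after q z h i j - V q (z + c i * h) i j - h * mean_passage q z i j).
Proof.
pose v k z h := V q (z + (if k == i then c i * h else 0)) k j.
apply: (@isO_ext _ _ _ _ (fun z h =>
    \sum_k (fine (after_step Q c nu q z h i j k) - p h i k * v k z h) +
    \sum_k ((p h i k - (i == k)%:R - h * A i k) * v k z h +
       h * (A i k * (v k z h - V q z k j))))).
  move=> z h h1 hz; rewrite sumrB big_split /=.
  have -> : after q z h i j = \sum_k fine (after_step Q c nu q z h i j k).
    rewrite /after sum_fine// => k _.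
    have [b -> _] := after_step_expansion Q_cylinder c_neq0 nu_gt0 p0 p_expansion q i j k h1 hz.
    by [].
  rewrite /mean_passage mulr_sumr.
  have -> : V q (z + c i * h) i j = \sum_k (i == k)%:R * v k z h.
    rewrite (bigD1 i)//= eqxx mul1r /v eqxx big1 ?addr0// => k ki.
    by rewrite eq_sym (negbTE ki) mul0r.
  rewrite -!big_split /= -!sumrB -!big_split /=.
  by apply: eq_bigr => k _; ring.
have vO k : O 0 (v k).
  exists 1 => // z h h1 hz; rewrite expr0 mulr1 ger0_norm ?passage_prob_ge0//.
  exact: passage_prob_le1.
apply: isO_add; apply: isO_sum => k.
  have Lq0 : 0 <= Lip q by exact: (passage_lipschitz_ge0 c nu_gt0 p_expansion).
  exists (2 * Lip q * C * K).
    do 3?[apply: mulr_ge0 => //]; first exact/ltW/rate_bound_gt0.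
    exact: le_trans ler01 (jump_bound_ge1 p_expansion).
  move=> z h h1 hz.
  have [b -> H] := after_step_expansion Q_cylinder c_neq0 nu_gt0 p0 p_expansion q i j k h1 hz.
  exact: H.
apply: isO_add.
  rewrite -[2%N]/(2 + 0)%N; apply: isO_mul (vO k).
  exists Kp => // z h /andP[h0 h1] _; apply: p_expansion.
  by rewrite (ltW h0).
rewrite -[2%N]/(1 + (0 + 1))%N; apply: isO_mul; first exact: isO_step.
apply: isO_mul; first exact: isO_cst.
rewrite /v; case: (eqVneq k i) => [->|_]; first exact: O_passage_increment.
by apply: isO_ext (isO_zero C 1) => z h _ _; rewrite addr0 subrr.
Qed.

(** The right-hand side of the backward equation: killing of the current stage,
    passage to the next one, and a jump of the phase. *)
Definition backward_rate n z i j : R :=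
  (if n is n'.+1 then nu * V n' z i j else 0) - nu * V n z i j + mean_passage n z i j.

(** Up to the second order, during the step the clock has at most one point: only
    the terms [l = 0] and [l = 1] of the one-step identity contribute. *)
Lemma O_backward n i j : O 2 (fun z h =>
  V n z i j - V n (z + c i * h) i j - h * backward_rate n z i j).
Proof.
pose e q z h := after q z h i j - V q (z + c i * h) i j - h * mean_passage q z i j.
have eO q : O 2 (e q) by exact: O_after.
have hM q : O 1 (fun z h => h * mean_passage q z i j).
  by rewrite -[1%N]/(1 + 0)%N; apply: isO_mul; [exact: isO_step|exact: O_mean_passage].
have nh : O 1 (fun _ h => nu * h).
  by rewrite -[1%N]/(0 + 1)%N; apply: isO_mul; [exact: isO_cst|exact: isO_step].
have aO1 q : O 1 (fun z h => after q z h i j - V q z i j).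
  apply: (@isO_ext _ _ _ _ (fun z h => e q z h +
      (h * mean_passage q z i j + (V q (z + c i * h) i j - V q z i j)))).
    by move=> z h _ _; rewrite /e; ring.
  apply: isO_add; first exact: (@isO_weaken _ _ 2 1).
  by apply: isO_add => //; exact: O_passage_increment.
have aO q : O 0 (fun z h => after q z h i j).
  apply: (@isO_ext _ _ _ _ (fun z h => (after q z h i j - V q z i j) + V q z i j)).
    by move=> z h _ _; ring.
  apply: isO_add; last exact: O_passage.
  exact: (@isO_weaken _ _ 1 0).
(* the part of the term l which is not of the second order *)
pose T l z h : R := if l is l'.+1 then (if l' is 0%N then h * (nu * V n.-1 z i j) else 0)
  else V n (z + c i * h) i j - h * (nu * V n z i j) + h * mean_passage n z i j.
have TO l : (l < n.+1)%N -> O 2 (fun z h => g l h * after (n - l)%N z h i j - T l z h).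
  case: l => [_|[n1|l _]].
  - rewrite subn0 /T.
    apply: (@isO_ext _ _ _ _ (fun z h => (g 0 h - 1 + nu * h) * after n z h i j +
        ((1 + - (nu * h)) * e n z h +
        (- ((nu * h) * (V n (z + c i * h) i j - V n z i j)) +
         - ((nu * h) * (h * mean_passage n z i j)))))).
      by move=> z h _ _; rewrite /e; ring.
    apply: isO_add.
      by rewrite -[2%N]/(2 + 0)%N; apply: isO_mul (aO n); exact: O_poisson0.
    apply: isO_add.
      rewrite -[2%N]/(0 + 2)%N; apply: isO_mul (eO n); apply: isO_add.
        exact: isO_cst.
      by apply: isO_opp; exact: (@isO_weaken _ _ 1 0).
    apply: isO_add; apply: isO_opp; rewrite -[2%N]/(1 + 1)%N; apply: isO_mul => //.
    exact: O_passage_increment.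
  - rewrite /T subn1.
    apply: (@isO_ext _ _ _ _ (fun z h => (g 1 h - nu * h) * after n.-1 z h i j +
        (nu * h) * (after n.-1 z h i j - V n.-1 z i j))).
      by move=> z h _ _; ring.
    apply: isO_add.
      by rewrite -[2%N]/(2 + 0)%N; apply: isO_mul (aO _); exact: O_poisson1.
    by rewrite -[2%N]/(1 + 1)%N; apply: isO_mul.
  - rewrite /T; apply: (@isO_ext _ _ _ _ (fun z h => g l.+2 h * after (n - l.+2) z h i j)).
      by move=> z h _ _; rewrite subr0.
    by rewrite -[2%N]/(2 + 0)%N; apply: isO_mul (aO _); exact: O_poisson.
apply: (@isO_ext _ _ _ _ (fun z h => \sum_(l < n.+1)
    (g l h * after (n - l)%N z h i j - T l z h))); last first.
  by apply: isO_sum => l; exact: TO.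
move=> z h h1 hz; rewrite sumrB.
have h0 : 0 <= h by case/andP: h1 => /ltW.
have -> : V n z i j = \sum_(l < n.+1) g l h * after (n - l)%N z h i j.
  apply: EFin_inj; rewrite (passage_prob_step Q_cylinder nu_gt0 n i j h0 hz) -sumEFin.
  by apply: eq_bigr => l _; rewrite afterE// EFinM.
rewrite -[LHS]addrA -[RHS]/(_ - _) -opprD; congr (_ - _).
rewrite /backward_rate big_ord_recl /T /=.
case: n {aO hM eO TO e aO1 T} => [|n].
  rewrite big_ord0.
  by move: (V _ (z + _) i j) (V _ z i j) (mean_passage _ _ _ _) => u v w; ring.
rewrite big_ord_recl /= big1 => [|l _]; last by [].
by move: (V _ (z + _) i j) (V n.+1 z i j) (V n z i j) (mean_passage _ _ _ _) => u v v' w; ring.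
Qed.

End backward_equation.

Section calculus.
Context {R : realType}.
Implicit Types (z h s x y e : R).

Lemma is_derive_quadratic (f : R -> R) (a z del N : R) : 0 < del -> 0 <= N ->
  (forall h, 0 < `|h| < del -> `|f (z + h) - f z - h * a| <= N * h ^+ 2) ->
  is_derive z 1 f a.
Proof.
move=> del0 N0 H.
have cv : (fun h => h^-1 *: ((f \o +%R^~ z) (h *: 1) - f z)) @ 0^' --> a.
  apply/cvgrPdist_le => e e0; near=> h.
  have h0 : h != 0 by near: h; exact: nbhs_dnbhs_neq.
  have hd : `|h| < del by near: h; exact: dnbhs0_lt.
  have he : `|h| < e / (N + 1) by near: h; apply: dnbhs0_lt; rewrite divr_gt0// ltr_wpDl.
  rewrite /= /GRing.scale /= mulr1 [h + z]addrC distrC.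
  have -> : h^-1 * (f (z + h) - f z) - a = h^-1 * (f (z + h) - f z - h * a) by field.
  rewrite normrM normfV -ler_pdivlMl ?invr_gt0 ?normr_gt0// invrK.
  apply: le_trans (H h _) _; first by rewrite normr_gt0 h0.
  rewrite -real_normK ?num_real// expr2 mulrCA ler_wpM2l//.
  have : `|h| * (N + 1) < e by rewrite -ltr_pdivlMr// ltr_wpDl.
  by have := normr_ge0 h; nra.
by apply: DeriveDef; [apply/cvg_ex; exists a|exact/cvg_lim].
Unshelve. all: by end_near. Qed.

(** A one-sided expansion along the steps [- k * h], uniform in the base point,
    determines the two-sided derivative: a forward increment from [z] is a
    backward increment from a nearby point. *)
Lemma is_derive_backward (f u : R -> R) (k C N Lip z : R) : 0 < k -> 0 < C -> 0 <= N ->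
  0 <= Lip ->
  (forall x h, 0 < h <= 1 -> C * h <= x ->
     `|f x - f (x - k * h) - h * u x| <= N * h ^+ 2) ->
  (forall x y, 0 <= x -> 0 <= y -> `|u x - u y| <= Lip * `|x - y|) ->
  0 < z -> is_derive z 1 f (u z / k).
Proof.
move=> k0 C0 N0 L0 H uL z0.
pose del := Order.min k (k * z / C).
have del0 : 0 < del by rewrite /del lt_min k0 divr_gt0// mulr_gt0.
have sOK h : 0 < `|h| < del -> 0 < `|h| / k <= 1 /\ C * (`|h| / k) <= z.
  rewrite /del lt_min => /and3P[h0 h1 h2]; split.
    by rewrite divr_gt0//= ler_pdivrMr// mul1r ltW.
  by rewrite mulrA ler_pdivrMr// mulrC -ler_pdivlMr// [z * k]mulrC ltW.
apply: (@is_derive_quadratic _ _ _ del (N / k ^+ 2 + Lip / k)) => //.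
  by rewrite addr_ge0// divr_ge0// ?exprn_ge0// ltW.
have k0' : k != 0 by rewrite gt_eqF.
move=> h hd; have [s1 s2] := sOK h hd; have h2 : `|h| ^+ 2 = h ^+ 2 by rewrite real_normK ?num_real.
have [h0|h0] := leP 0 h.
  rewrite ger0_norm// in s1 s2.
  have zh : C * (h / k) <= z + h by rewrite (le_trans s2)// lerDl.
  have := H (z + h) (h / k) s1 zh.
  have -> : z + h - k * (h / k) = z by field.
  move=> H1.
  have H2 := uL (z + h) z (addr_ge0 (ltW z0) h0) (ltW z0).
  have -> : f (z + h) - f z - h * (u z / k) =
     (f (z + h) - f z - h / k * u (z + h)) + h / k * (u (z + h) - u z) by field.
  apply: le_trans (ler_normD _ _) _; rewrite mulrDl; apply: lerD.
    by apply: le_trans H1 _; rewrite expr_div_n mulrA mulrAC.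
  rewrite normrM (ger0_norm (_ : 0 <= h / k)) ?divr_ge0 ?(ltW k0)//.
  have {H2} : `|u (z + h) - u z| <= Lip * h.
    by apply: le_trans H2 _; rewrite addrAC subrr add0r ger0_norm.
  move=> H2; apply: (@le_trans _ _ (h / k * (Lip * h))).
    by rewrite ler_wpM2l// divr_ge0// ltW.
  rewrite le_eqVlt; apply/orP; left; apply/eqP; by field.
rewrite ltr0_norm// in s1 s2.
have := H z (- h / k) s1 s2.
have -> : z - k * (- h / k) = z + h by field.
move=> H1.
have -> : f (z + h) - f z - h * (u z / k) = - (f z - f (z + h) - (- h / k) * u z) by field.
rewrite normrN; apply: le_trans H1 _.
rewrite expr_div_n sqrrN mulrA mulrAC mulrDl lerDl.
by rewrite mulr_ge0 ?sqr_ge0// divr_ge0// ltW.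
Qed.

(** Composition with the absolute value extends the function to the line. *)
Lemma lipschitz_within_continuous (f : R -> R) (Lip z : R) : 0 <= Lip ->
  (forall x y, 0 <= x -> 0 <= y -> `|f x - f y| <= Lip * `|x - y|) ->
  {within `[0, z], continuous f}.
Proof.
move=> L0 H.
have cF : continuous (fun x => f `|x|).
  move=> x; apply/cvgrPdist_le => e e0; near=> y.
  apply: le_trans (H _ _ _ _) _ => //.
  apply: (@le_trans _ _ (Lip * `|x - y|)); first by rewrite ler_wpM2l// ler_dist_dist.
  have : `|x - y| <= e / (Lip + 1).
    near: y; apply: cvgr_dist_le; first exact: cvg_id.
    by rewrite divr_gt0// ltr_wpDl.
  rewrite ler_pdivlMr ?ltr_wpDl//.
  by have := normr_ge0 (x - y); nra.
apply: (@subspace_eq_continuous _ _ _ (fun x => f `|x|)).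
  by move=> x; rewrite inE/= in_itv/= => /andP[x0 _]; rewrite ger0_norm.
exact: continuous_subspaceT.
Unshelve. all: by end_near. Qed.

Definition lipschitz_half (f : R -> R) := exists2 M, 0 <= M &
  forall x y, 0 <= x -> 0 <= y -> `|f x - f y| <= M * `|x - y|.

Lemma lipschitz_halfD (f1 f2 : R -> R) : lipschitz_half f1 -> lipschitz_half f2 ->
  lipschitz_half (fun x => f1 x + f2 x).
Proof.
move=> [M M0 H] [N N0 H']; exists (M + N); first exact: addr_ge0.
move=> x y x0 y0; have -> : f1 x + f2 x - (f1 y + f2 y) = (f1 x - f1 y) + (f2 x - f2 y) by ring.
rewrite (le_trans (ler_normD _ _))// mulrDl lerD//; [exact: H|exact: H'].
Qed.

Lemma lipschitz_halfZ (a : R) (f1 : R -> R) : lipschitz_half f1 ->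
  lipschitz_half (fun x => a * f1 x).
Proof.
move=> [M M0 H]; exists (`|a| * M); first exact: mulr_ge0.
by move=> x y x0 y0; rewrite -mulrBr normrM -mulrA ler_wpM2l// H.
Qed.

Lemma lipschitz_half_sum (I : finType) (u : I -> R -> R) :
  (forall i, lipschitz_half (u i)) -> lipschitz_half (fun x => \sum_i u i x).
Proof.
move=> H.
suff : forall w : seq I, lipschitz_half (fun x => \sum_(i <- w) u i x) by exact.
elim=> [|i w [M M0 IH]].
  by exists 0 => // x y _ _; rewrite !big_nil subrr normr0 mul0r.
have [N N0 H'] : lipschitz_half (fun x => u i x + \sum_(j <- w) u j x).
  by apply: lipschitz_halfD => //; exists M.
by exists N => // x y x0 y0; rewrite !big_cons H'.
Qed.

End calculus.

Section passage_derivative.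
Context {R : realType} {m : nat}.
Notation Pi := (trajectory R m).
Notation S := 'I_m.+1.
Implicit Types (t s r z x y h e : R) (i j k : S) (n l q : nat) (f : Pi).
Variable p : R -> S -> S -> R.
Variable Q : S -> probability Pi R.
Hypothesis Q_cylinder : forall i (w : seq (R * S)), sorted time_le w ->
  all (fun tj => 0 <= tj.1) w -> Q i (cylinder w) = (chain_prob p 0 i w)%:E.
Variable c : S -> R.
Hypothesis c_neq0 : forall i, c i != 0.
Variable nu : R.
Hypothesis nu_gt0 : 0 < nu.
Variables (A : 'M[R]_m.+1) (Kp : R).
Hypothesis p0 : forall i j, p 0 i j = (i == j)%:R.
Hypothesis p_expansion : forall h i j, 0 <= h <= 1 ->
  `|p h i j - (i == j)%:R - h * A i j| <= Kp * h ^+ 2.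
Notation V := (passage_prob Q c nu).
Notation Lip := (passage_lipschitz c nu A Kp).
Notation rate := (backward_rate Q c nu A).

Lemma passage_lipschitz_exists n i j : lipschitz_half (fun z => V n z i j).
Proof.
exists (Lip n); first exact: (passage_lipschitz_ge0 c nu_gt0 p_expansion).
move=> x y x0 y0.
exact: (passage_prob_lipschitz Q_cylinder c_neq0 nu_gt0 p0 p_expansion).
Qed.

Lemma backward_rate_lipschitz n i j : lipschitz_half (fun z => rate n z i j).
Proof.
have VL q k : lipschitz_half (fun z => V q z k j) by exact: passage_lipschitz_exists.
rewrite /backward_rate; apply: lipschitz_halfD; first apply: lipschitz_halfD.
- case: n => [|n]; last exact: lipschitz_halfZ.
  by exists 0 => // x y _ _; rewrite subrr normr0 mul0r.
- have [M M0 H] := lipschitz_halfZ (- nu) (VL n i); exists M => // x y x0 y0.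
  by have := H x y x0 y0; rewrite !mulNr.
- by apply: lipschitz_half_sum => k; exact: lipschitz_halfZ.
Qed.

Lemma is_derive_passage_prob n i j z : c i < 0 -> 0 < z ->
  is_derive z 1 (fun z => V n z i j) (rate n z i j / - c i).
Proof.
move=> ci z0; have [M M0 H] := O_backward Q_cylinder c_neq0 nu_gt0 p0 p_expansion n i j.
have [N N0 H'] := backward_rate_lipschitz n i j.
apply: (@is_derive_backward _ _ (fun z => rate n z i j) _ (rate_bound c) M N) => //.
- by rewrite oppr_gt0.
- exact: rate_bound_gt0.
- by move=> x h h1 hx; have := H x h h1 hx; rewrite mulNr opprK.
Qed.

End passage_derivative.

(** * The generator of the downward records *)

Section toeplitz.
Context {R : realType} {q : nat}.
Implicit Types (L n l : nat).

Definition toeplitz L (B : nat -> 'M[R]_q) : 'M[R]_(\sum_(i < L) q) :=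
  \mxblock_(i < L, j < L) (if (i <= j)%N then B (j - i)%N else 0).

(** This reduces the conditions of [ode_expm], which bear on entries, to the
    blocks. *)
Lemma toeplitz_entry L (s t : 'I_(\sum_(i < L) q)) : (exists n u v, forall B, toeplitz L B s t = B n u v) \/
  (forall B, toeplitz L B s t = 0).
Proof.
have [le_st|lt_ts] := boolP (tagnat.sig1 s <= tagnat.sig1 t)%N.
  left; exists (tagnat.sig1 t - tagnat.sig1 s)%N, (tagnat.sig2 s), (tagnat.sig2 t) => B.
  by rewrite /toeplitz mxE le_st.
by right=> B; rewrite /toeplitz mxE (negbTE lt_ts) mxE.
Qed.

Lemma toeplitz_id L (B : nat -> 'M[R]_q) : B 0%N = 1%:M -> (forall n, B n.+1 = 0) ->
  toeplitz L B = 1%:M.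
Proof.
move=> B0 BS; rewrite -mxdiagZ; apply: eq_mxblock => i j.
case: (ltngtP i j) => [ij|ji|/val_inj ->].
- rewrite (_ : i == j = false); last by apply/eqP => E; rewrite E ltnn in ij.
  by move: ij; rewrite -subn_gt0; case: (j - i)%N.
- by rewrite (_ : i == j = false)//; apply/eqP => E; rewrite E ltnn in ji.
- by rewrite eqxx subnn B0 conform_mx_id.
Qed.

(** The triangular shape leaves in the block [(i, j)] of the product the terms from
    [i] to [j]; counted from [i], they depend on [j - i] only. *)
Lemma toeplitz_mul L (B B' : nat -> 'M[R]_q) :
  toeplitz L B *m toeplitz L B' =
  toeplitz L (fun n => \sum_(l < n.+1) B l *m B' (n - l)%N).
Proof.
rewrite /toeplitz mul_mxblock; apply: eq_mxblock => i j.
pose F l := (if (i <= l)%N then B (l - i)%N else 0) *m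
            (if (l <= j)%N then B' (j - l)%N else 0).
transitivity (\sum_(0 <= l < L) F l); first by rewrite big_mkord.
case: (leqP i j) => ij; last first.
  apply: big1_seq => l _; rewrite /F.
  case: (leqP i l) => il; last by rewrite mul0mx.
  by rewrite leqNgt (leq_trans ij il) mulmx0.
rewrite (big_cat_nat (n := i))//=; last exact/ltnW/ltn_ord.
rewrite [X in _ + X](big_cat_nat (n := j.+1))//=; last by rewrite leqW.
rewrite [X in X + _]big_nat_cond big1 ?add0r; last first.
  by move=> l; rewrite andbT => /andP[_ li]; rewrite /F leqNgt li mul0mx.
rewrite [X in _ + X]big_nat_cond [X in _ + X]big1 ?addr0; last first.
  by move=> l; rewrite andbT => /andP[jl _]; rewrite /F [(l <= j)%N]leqNgt jl mulmx0.
rewrite -{1}[val i]add0n big_addn big_mkord subSn//.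
apply: eq_bigr => l _; rewrite /F leq_addl addnK.
have lj : (l <= j - i)%N by rewrite -ltnS ltn_ord.
by rewrite addnC -leq_subRL// lj subnDA.
Qed.

End toeplitz.

Section downward_records.
Context {R : realType} {m : nat}.
Notation Pi := (trajectory R m).
Notation S := 'I_m.+1.
Implicit Types (t s r z x y h e : R) (i j k : S) (n l q : nat) (f : Pi).
Variable p : R -> S -> S -> R.
Variable Q : S -> probability Pi R.
Hypothesis Q_cylinder : forall i (w : seq (R * S)), sorted time_le w ->
  all (fun tj => 0 <= tj.1) w -> Q i (cylinder w) = (chain_prob p 0 i w)%:E.
Variable c : S -> R.
Hypothesis c_neq0 : forall i, c i != 0.
Variable nu : R.
Hypothesis nu_gt0 : 0 < nu.
Variables (A : 'M[R]_m.+1) (Kp : R).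
Hypothesis p0 : forall i j, p 0 i j = (i == j)%:R.
Hypothesis p_expansion : forall h i j, 0 <= h <= 1 ->
  `|p h i j - (i == j)%:R - h * A i j| <= Kp * h ^+ 2.
Notation V := (passage_prob Q c nu).
Notation rate := (backward_rate Q c nu A).
Notation up := (phase_plus (c := c)).
Notation dn := (phase_minus (c := c)).
Context d (Omega : measurableType d) (P : S -> probability Omega R)
  (phi : R -> Omega -> S) (Y : nat -> {mfun Omega >-> R}).
Hypothesis Psi_passage : forall n u v, Psi P phi Y c n u v = V n 0 (up u) (dn v).

Lemma phase_minus_lt0 u : c (dn u) < 0.
Proof. by have := enum_valP u; rewrite inE. Qed.

Lemma phase_plus_gt0 u : 0 < c (up u).
Proof. by have := enum_valP u; rewrite inE. Qed.

Lemma sum_phases (a : S -> R) : \sum_k a k = \sum_u a (up u) + \sum_u a (dn u).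
Proof.
rewrite (bigID (mem (Sp c))) /=; congr (_ + _); first exact: big_enum_val.
rewrite -[RHS](big_enum_val (A := mem (Sm c)) a); apply: eq_bigl => k; rewrite !inE.
by rewrite -leNgt le_eqVlt (negbTE (c_neq0 k)).
Qed.

Definition passage_minus n z : 'M[R]_#|Sm c| := \matrix_(u, v) V n z (dn u) (dn v).
Definition passage_plus_minus n z : 'M[R]_(#|Sp c|, #|Sm c|) :=
  \matrix_(u, v) V n z (up u) (dn v).
Notation Vm := passage_minus.
Notation Vp := passage_plus_minus.

(** A passage from an ascending phase starts by a return to the initial level. *)
Lemma passage_from_plus n z : 0 <= z ->
  Vp n z = \sum_(l < n.+1) Psi P phi Y c l *m Vm (n - l) z.
Proof.
move=> z0; apply/matrixP => u v; rewrite mxE summxE -{1}[z]add0r.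
rewrite (passage_prob_add Q_cylinder c nu_gt0)//; apply: eq_bigr => l _.
rewrite sum_phases big1 ?add0r => [|k _]; last first.
  by rewrite passage_prob_plus ?mul0r// phase_plus_gt0.
by rewrite mxE; apply: eq_bigr => k _; rewrite Psi_passage mxE.
Qed.

Lemma absCm_mulE w (X : 'M[R]_(#|Sm c|, w)) u v : (absCm c *m X) u v = - c (dn u) * X u v.
Proof. by rewrite /absCm mul_diag_mx !mxE. Qed.

Lemma absCm_unit : absCm c \in unitmx.
Proof.
rewrite unitmxE /absCm det_diag unitfE; apply/prodf_neq0 => u _.
by rewrite mxE oppr_eq0.
Qed.

(** The backward equation, once the passages from the ascending phases are
    expressed through those from the descending ones. *)
Lemma generator_passage n z : 0 <= z ->
  \sum_(l < n.+1) U_block P phi Y c A nu l *m Vm (n - l) z =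
  \matrix_(u, v) (rate n z (dn u) (dn v) / - c (dn u)).
Proof.
move=> z0.
(* the blocks of U without their common factor *)
pose N0 l : 'M[R]_#|Sm c| :=
  match l with 0%N => A_mm c A - nu%:M | 1%N => nu%:M | _ => 0 end.
pose N l : 'M[R]_#|Sm c| := N0 l + A_mp c A *m Psi P phi Y c l.
have UN l : U_block P phi Y c A nu l = invmx (absCm c) *m N l.
  rewrite /N /N0 mulmxDr mulmxA /U_block; case: l => [|[|l]] //.
    by rewrite mul_mx_scalar.
  by rewrite mulmx0 add0r.
under eq_bigr do rewrite UN -mulmxA.
rewrite -mulmx_sumr; apply: (canLR (mulKmx absCm_unit)).
apply/matrixP => u v; rewrite absCm_mulE [in RHS]mxE.
have cu : - c (dn u) != 0 by rewrite oppr_eq0.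
rewrite [RHS]mulrC divfK// /N.
under eq_bigr do rewrite mulmxDl -mulmxA.
rewrite big_split /= -mulmx_sumr -passage_from_plus// big_ord_recl subn0 mxE.
rewrite /backward_rate /mean_passage sum_phases.
have -> : (A_mp c A *m Vp n z) u v = \sum_w A (dn u) (up w) * V n z (up w) (dn v).
  by rewrite mxE; apply: eq_bigr => w _; rewrite !mxE.
rewrite mulmxBl mul_scalar_mx !mxE.
have -> : \sum_j (A_mm c A) u j * (Vm n z) j v = \sum_w A (dn u) (dn w) * V n z (dn w) (dn v).
  by apply: eq_bigr => w _; rewrite !mxE.
have -> : (\sum_(i < n) N0 (lift ord0 i) *m
     Vm (n - lift ord0 i) z) u v =
   (if n is n'.+1 then nu * V n' z (dn u) (dn v) else 0).
  case: n => [|n]; first by rewrite big_ord0 mxE.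
  rewrite big_ord_recl big1 ?addr0 => [|l _]; last by rewrite mul0mx.
  by rewrite /= mul_scalar_mx subSS subn0 !mxE.
move: (\sum_w _) (\sum_w _) (V n z _ _) => a b v'.
by case: n => [|n]; ring.
Qed.

(** The equation [M' = U M], with [M 0 = 1] since a path that starts in a
    descending phase goes down at once. *)
Lemma toeplitz_passage L z : 0 <= z ->
  expm (z *: U_mx P phi Y c A nu L) = toeplitz L (Vm ^~ z).
Proof.
apply: (@ode_expm _ _ _ (fun z => toeplitz L (Vm ^~ z)) 1) => //.
- apply: toeplitz_id => [|n]; apply/matrixP => u v; rewrite !mxE.
    have := passage_prob_near_id Q_cylinder nu_gt0 p0 p_expansion 0 (dn v)
      (phase_minus_lt0 u) (lexx 0).
    rewrite mulr0 normr_le0 subr_eq0 => /eqP ->.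
    by rewrite (inj_eq enum_val_inj); case: (u == v).
  have := passage_prob_near_id Q_cylinder nu_gt0 p0 p_expansion n.+1 (dn v)
    (phase_minus_lt0 u) (lexx 0).
  by rewrite mulr0 normr_le0 subr0 => /eqP.
- move=> {}z s t z0; have [[n [u [v E]]]|E] := @toeplitz_entry R _ L s t; rewrite E; last first.
    by rewrite normr0.
  by rewrite mxE ger0_norm ?passage_prob_ge0 ?passage_prob_le1.
- move=> {}z s t z0; have [[n [u [v E]]]|E] := @toeplitz_entry R _ L s t.
    have [M M0 H] := passage_lipschitz_exists Q_cylinder c_neq0 nu_gt0 p0 p_expansion n (dn u) (dn v).
    apply: (@lipschitz_within_continuous _ _ M _ M0) => x y x0 y0.
    by rewrite !E !mxE H.
  by apply: (@lipschitz_within_continuous _ _ 0 _ (lexx 0)) => x y x0 y0; rewrite !E subrr normr0 mul0r.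
- move=> {}z s t z0.
  have -> : U_mx P phi Y c A nu L = toeplitz L (U_block P phi Y c A nu) by [].
  rewrite toeplitz_mul; have [[n [u [v E]]]|E] := @toeplitz_entry R _ L s t; last first.
    rewrite E (_ : (fun z => _) = cst 0); last by apply/funext => x; exact: E.
    exact: is_derive_cst.
  rewrite E generator_passage ?ltW// mxE.
  rewrite (_ : (fun z => _) = (fun z => V n z (dn u) (dn v))); last first.
    by apply/funext => x; rewrite E mxE.
  apply: (is_derive_passage_prob Q_cylinder c_neq0 nu_gt0 p0 p_expansion) => //.
  exact: phase_minus_lt0.
Qed.

Lemma W_block_passage L z (n : 'I_L) : 0 <= z ->
  W_block P phi Y c A nu z n = Vm n z.
Proof.
by move=> z0; rewrite /W_block toeplitz_passage// /toeplitz mxblockK /= ?leq0n subn0.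
Qed.

End downward_records.

(** * The law of the path *)

Lemma measure_eq_off_null d (T : measurableType d) (R : realType)
    (mu : {measure set T -> \bar R}) (E F N : set T) :
  measurable E -> measurable F -> measurable N -> mu N = 0%E ->
  (forall w, ~ N w -> E w <-> F w) -> mu E = mu F.
Proof.
move=> mE mF mN N0 EF.
have null G : measurable G -> mu G = mu (G `\` N).
  move=> mG; rewrite (measureDI mu mG mN) [X in (_ + X)%E](_ : _ = 0%E) ?adde0//.
  apply/eqP; rewrite eq_le measure_ge0 andbT -N0.
  by apply: le_measure; rewrite ?inE//; exact: measurableI.
rewrite null// [RHS]null//; congr (mu _).
by apply/seteqP; split => w [? nN]; split => //; apply/(EF w nN).
Qed.

Section path_law.
Context {R : realType} {m : nat} d (Omega : measurableType d).
Notation Pi := (trajectory R m).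
Notation S := 'I_m.+1.
Implicit Types (t s r z x y h e : R) (i j k : S) (n l q : nat) (f : Pi).
Variables (P : S -> probability Omega R) (phi : R -> Omega -> S) (A : 'M[R]_m.+1).
Hypothesis hphi : is_markov_chain P phi A.

Definition path_of (w : Omega) : Pi :=
  Path (fun t tge0 => @chain_right_continuous _ _ _ _ _ _ _ hphi t w tge0).

Lemma measurable_path_of : measurable_fun setT path_of.
Proof. by apply: measurable_to_path => t j t0; exact: chain_measurable hphi _ _ t0. Qed.

HB.instance Definition _ := isMeasurableFun.Build _ _ Omega Pi path_of measurable_path_of.

Definition path_law i : probability Pi R := distribution (P i) path_of.

Definition transition t i j : R := expm (t *: A) i j.

Lemma start_full i : P i [set w | phi 0 w = i] = 1%E.
Proof.
have := @chain_fdd _ _ _ _ _ _ _ hphi i 0%N (fun=> 0) (fun=> i) erefl (fun=> lexx _) erefl.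
rewrite big_ord0 => <-; congr (P i _).
by apply/seteqP; split => w /= h => [l|]; [rewrite h|exact: (h 0%N)].
Qed.

Lemma chain_prob_big (tj : R * S) (w : seq (R * S)) (x : R * S) :
  \prod_(l < size w) transition ((nth tj (x :: w) l.+1).1 - (nth tj (x :: w) l).1)
     (nth tj (x :: w) l).2 (nth tj (x :: w) l.+1).2 = chain_prob transition x.1 x.2 w.
Proof.
elim: w x => [|y w IH] x; first by rewrite big_ord0.
by rewrite big_ord_recl /= -IH.
Qed.

Lemma path_law_cylinder i (w : seq (R * S)) : sorted time_le w ->
  all (fun tj => 0 <= tj.1) w -> path_law i (cylinder w) = (chain_prob transition 0 i w)%:E.
Proof.
move=> sw w0; (* The time [0], in phase [i], is put first: this is an almost sure event. The
   sequence is constant after its last element. *)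
pose x0 := last (0, i) w.
pose u l := nth x0 ((0, i) :: w) l.
have mstart : measurable [set v | phi 0 v = i] by exact: chain_measurable hphi _ _ (lexx 0).
have mw : measurable (path_of @^-1` cylinder w).
  by apply: measurable_preimageT; [exact: measurable_path_of|exact: measurable_cylinder].
have mu : measurable (path_of @^-1` cylinder w `&` [set v | phi 0 v = i]) by exact: measurableI.
have -> : path_law i (cylinder w) =
    P i (path_of @^-1` cylinder w `&` [set v | phi 0 v = i]).
  apply: (@measure_eq_off_null _ _ _ _ _ _ (~` [set v | phi 0 v = i])) => //.
  - exact: measurableC.
  - by apply: etrans (probability_setC (P i) mstart) _; rewrite start_full subee.
  - by move=> v /contrapT h; split => [?|[]].
have sorted0 : sorted time_le ((0, i) :: w).
  rewrite /= (path_sortedE time_le_trans) sw andbT.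
  by apply: sub_all w0 => tj.
have umono l : (u l).1 <= (u l.+1).1.
  have [lw|wl] := ltnP l (size w).
    have := (pathP x0 sorted0) l lw.
    by rewrite /u /time_le.
  rewrite /u; have [->|neq] := eqVneq l (size w).
    rewrite [X in _ <= X.1]nth_default//=.
    by have /= -> := nth_last x0 ((0, i) :: w).
  by rewrite !nth_default//= ltn_neqAle eq_sym neq.
have := @chain_fdd _ _ _ _ _ _ _ hphi i (size w) (fun l => (u l).1) (fun l => (u l).2)
  erefl umono erefl.
rewrite chain_prob_big => /= <-; congr (P i _); apply/seteqP; split => v /=.
  move=> [h v0] [|l] lw //=; apply: h.
  by rewrite /u /= mem_nth.
move=> h; split; last exact: (h 0%N).
move=> x /(nthP x0)[l lw <-].
exact: (h l.+1).
Qed.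

Lemma sigma_phi_path_of (B : set Pi) : measurable B -> sigma_phi phi (path_of @^-1` B).
Proof.
move=> mB.
pose C : set (set Pi) := [set B | sigma_phi phi (path_of @^-1` B)].
suff : coordinate_events.-sigma.-measurable `<=` C by apply.
apply: smallest_sub => [|_ [t [j [t0 ->]]]]; last first.
  by apply: sub_gen_smallest; exists t, j.
have [h0 hD hU] := @smallest_sigma_algebra _ setT
  [set E | exists t j, 0 <= t /\ E = [set w | phi t w = j]].
split => [|B' /hD|F hF].
- by rewrite /C /= preimage_set0.
- by rewrite /C /= !setTD preimage_setC.
- by rewrite /C /= preimage_bigcup; exact: hU.
Qed.

Lemma sigma_phi_measurable E : sigma_phi phi E -> measurable E.
Proof.
apply: smallest_sub; first exact: sigma_algebra_measurable.
by move=> _ [t [j [t0 ->]]]; exact: chain_measurable hphi _ _ t0.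
Qed.

End path_law.

(** * The joint law of the path and of the clock *)

Section model_clocks.
Context {R : realType} {m : nat} d (Omega : measurableType d).
Notation Pi := (trajectory R m).
Notation S := 'I_m.+1.
Implicit Types (s r z x y h e : R) (i j : S) (n l k : nat) (f : Pi).
Variables (P : S -> probability Omega R) (phi : R -> Omega -> S) (A : 'M[R]_m.+1).
Variables (Y : nat -> {mfun Omega >-> R}) (nu : R).
Hypothesis hphi : is_markov_chain P phi A.
Hypothesis hY : is_erlang_clock P phi Y nu.
Hypothesis nu_gt0 : 0 < nu.
Notation path := (path_of hphi).
Notation Q := (path_law hphi).

(** The family of independent classes is restricted to the phase process and the
    first [N] exponential variables. *)
Lemma model_indep i E N (B : nat -> set R) : sigma_phi phi E ->
  (forall l, measurable (B l)) ->
  P i (E `&` \bigcap_(l in [set l | (l < N)%N]) (Y l @^-1` B l)) =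
  (P i E * \prod_(l < N) P i (Y l @^-1` B l))%E.
Proof.
move=> SE mB.
pose s : seq (option nat) := None :: [seq Some l | l <- iota 0 N].
pose D (o : option nat) : set Omega := if o is Some l then Y l @^-1` B l else E.
have us : uniq s.
  rewrite /= map_inj_uniq ?iota_uniq ?andbT; last by move=> ? ? [].
  by apply/mapP => -[].
have sE : (seq_fset tt s : seq (option nat)) =i s by exact: seq_fsetE.
have DG o : o \in seq_fset tt s -> clock_classes phi Y o (D o).
  case: o => [l|_] //= _; exists (B l) => //.
  by rewrite setTI.
have := hY.2 i _ D DG.
have ps : perm_eq (seq_fset tt s) s.
  by apply: uniq_perm => //; exact: fset_uniq.
rewrite (perm_big s) //=.
rewrite big_cons big_map (_ : iota 0 N = index_iota 0 N); last by rewrite /index_iota subn0.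
rewrite big_mkord => <-.
congr (P i _); apply/seteqP; split => w.
  move=> [Ew Yw] o /=; rewrite sE inE => /predU1P[->//|/mapP[l lN ->]].
  by apply: Yw; move: lN; rewrite mem_iota.
move=> h; split; first by apply: (h None); rewrite /= sE mem_head.
move=> l /= lN; apply: (h (Some l)); rewrite /= sE inE /=.
by apply/mapP; exists l => //; rewrite mem_iota.
Qed.

Let setT_sigma : sigma_phi phi setT.
Proof.
by have := sigma_phi_path_of hphi (@measurableT _ Pi); rewrite preimage_setT.
Qed.

(** The law of the clock does not depend on the initial phase; the first phase is
    taken as a reference. *)
Definition erl k : probability R R := erlang (P ord0) Y k.

Lemma erlang_law_tail i k (t : R) : erlang (P i) Y k `]t, +oo[%classic = (full_tail nu k t)%:E.
Proof.
apply: (erlang_tailE (SS := sigma_phi phi)) => //.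
- exact: sigma_phi_measurable hphi.
- exact: model_indep.
- by move=> n B mB; exact: hY.1.
Qed.

Lemma erl_tail k (t : R) : erl k `]t, +oo[%classic = (full_tail nu k t)%:E.
Proof. exact: erlang_law_tail. Qed.

Lemma erlang_law_start i k (B : set R) : measurable B -> erlang (P i) Y k B = erl k B.
Proof.
move=> mB; apply: tails_law_unique => // u.
  by apply: probability_lty; exact: measurable_itv.
by apply: etrans (erlang_law_tail i k u) _; apply/esym; exact: erl_tail.
Qed.

Definition clocked_path k (w : Omega) : Pi * R := (path w, mclock Y k w).

Lemma measurable_clocked_path k : measurable_fun setT (clocked_path k).
Proof. by apply: measurable_fun_pair => //; exact: measurable_path_of. Qed.

Lemma xsection_comp (J : set (Pi * R)) f : xsection J f = [set u : R | J (f, u)].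
Proof. by apply/seteqP; split => u; rewrite /xsection /= inE. Qed.

(** All the probabilities of the model are computed on the product of the path
    space and of the line, by independence of the path and the clock. *)
Lemma joint_law i k (J : set (Pi * R)) : measurable J ->
  P i [set w | J (path w, clock Y k w)] = (\int[Q i]_f erl k [set u : R | J (f, u)])%E.
Proof.
move=> mJ.
have m1 : measurable_fun setT (\1_setT : Omega -> R) by exact: measurable_indic.
have p1 (w : Omega) : 0 <= \1_setT w :> R by rewrite indicE.
pose rho : {measure set (Pi * R) -> \bar R} :=
  weighted_image (P i) (measurable_clocked_path k) m1 p1.
have rhoE X : measurable X -> rho X = P i (clocked_path k @^-1` X).
  by move=> mX; rewrite /rho /= weighted_image_indic// setTI.
transitivity (rho J).
  rewrite rhoE//; congr (P i _); apply/seteqP; split => w /=.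
    by rewrite /clocked_path mclockE.
  by rewrite /clocked_path mclockE.
have prodE : (Q i \x erl k)%E J = rho J.
  apply: product_measure_unique => // B C mB mC; rewrite rhoE; last exact: measurableX.
  transitivity (P i (path @^-1` B) * erlang (P i) Y k C)%E.
    apply: (clock_indep (SS := sigma_phi phi)) => //.
    - exact: sigma_phi_measurable hphi.
    - exact: model_indep.
    - exact: sigma_phi_path_of.
  by congr (_ * _)%E; exact: erlang_law_start.
rewrite -prodE /product_measure1; apply: eq_integral => f _ /=.
by rewrite xsection_comp.
Qed.

End model_clocks.

(** * Decomposition at the first passage *)

Section first_passage_decomposition.
Context {R : realType} {m : nat}.
Notation Pi := (trajectory R m).
Notation S := 'I_m.+1.
Implicit Types (s r z x y h e : R) (i j : S) (n l k : nat) (f : Pi).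
Variable p : R -> S -> S -> R.
Variable Q : S -> probability Pi R.
Hypothesis Q_cylinder : forall i (w : seq (R * S)), sorted time_le w ->
  all (fun tj => 0 <= tj.1) w -> Q i (cylinder w) = (chain_prob p 0 i w)%:E.
Variable c : S -> R.
Variable nu : R.
Hypothesis nu_gt0 : 0 < nu.
Variable erl : nat -> probability R R.
Hypothesis erl_tail : forall k t, erl k `]t, +oo[%classic = (full_tail nu k t)%:E.
Notation g := (poisson_weight nu).
Notation F := (passage c nu).
Notation V := (passage_prob Q c nu).
Implicit Type J : set (Pi * R).

Lemma measurable_slice k J : measurable J ->
  measurable_fun setT (fun f : Pi => erl k [set u : R | J (f, u)]).
Proof.
move=> mJ; have := @measurable_fun_xsection _ _ _ _ _ (erl k) J mJ.
by congr (measurable_fun _ _); apply/funext => f /=; rewrite xsection_comp.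
Qed.

(** Up to its first passage below [- z], reached while [n] stages have been
    completed, the path only matters through the phase reached; the event
    considered then depends on the shifted path and on the [k - n] remaining
    stages. *)
Lemma first_passage_decomposition z i k J J' : 0 <= z -> measurable J -> measurable J' ->
  (forall f u, J (f, u) -> (hit c z f < u%:E)%E) ->
  (forall f u, J' (f, u) -> 0 < u) ->
  (forall f s u, hit c z f = s%:E -> J (f, u) <-> J' (shift s f, u - s)) ->
  (\int[Q i]_f erl k [set u : R | J (f, u)] =
   \sum_(n < k) \sum_j (V n z i j)%:E * \int[Q j]_f erl (k - n)%N [set u : R | J' (f, u)])%E.
Proof.
move=> z0 mJ mJ' Jhit J'0 JJ'.
pose G n f := erl (k - n)%N [set u : R | J' (f, u)].
have mG n : measurable_fun setT (G n) by exact: measurable_slice.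
have msh := measurable_shift_at_hit c z.
have G0 n f : (0 <= G n f)%E by exact: measure_ge0.
have F0 n j f : (0 <= (F n z j f)%:E * G n (shift (fine (hit c z f)) f))%E.
  by apply: mule_ge0 => //; rewrite lee_fin passage_ge0.
have mF n j : measurable_fun setT (fun f : Pi =>
    (F n z j f)%:E * G n (shift (fine (hit c z f)) f))%E.
  apply: emeasurable_funM; last exact: (measurableT_comp (mG n) msh).
  by apply/measurable_EFinP; exact: measurable_passage.
transitivity (\int[Q i]_f \sum_(n < k) \sum_j
    (F n z j f)%:E * G n (shift (fine (hit c z f)) f))%E.
  apply: eq_integral => f _; have := hit_ge0 c z f.
  case E : (hit c z f) => [s| |]// s0.
    have -> : [set u : R | J (f, u)] = (fun t => t - s) @^-1` [set u : R | J' (shift s f, u)].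
      by apply/seteqP; split => u /(JJ' _ _ _ E).
    rewrite (erlang_shift nu_gt0 erl_tail)//; last 2 first.
    - by rewrite -xsection_comp; exact: measurable_xsection.
    - by move=> u /J'0 /=; rewrite in_itv/= andbT.
    apply: eq_bigr => n _ /=.
    rewrite -ge0_sume_distrl; last by move=> j _; rewrite lee_fin passage_ge0.
    by rewrite sumEFin stopped_sum E /= ltry.
  rewrite (_ : [set u : R | J (f, u)] = set0); last first.
    by apply/seteqP; split => u // /Jhit; rewrite E.
  rewrite measure0; apply/esym; rewrite big1 => // n _; rewrite big1 => // j _.
  by rewrite /F /passage /stopped E ltxx mul0e.
rewrite ge0_integral_sum//; first last.
- by move=> n f _; apply: sume_ge0.
- by move=> n; exact: emeasurable_sum.
apply: eq_bigr => n _; rewrite ge0_integral_sum//.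
by apply: eq_bigr => j _; exact: (strong_markov_passage Q_cylinder c nu_gt0).
Qed.

(** The clock is positive almost surely after at least one stage. *)
Lemma erl_positive k (B : set R) : (0 < k)%N -> measurable B ->
  erl k [set u : R | 0 < u /\ B u] = erl k B.
Proof.
move=> k0 mB; have mI : measurable (`]0, +oo[%classic : set R) by exact: measurable_itv.
apply: (@measure_eq_off_null _ _ _ (erl k) _ _ (~` `]0, +oo[%classic)) => //.
- rewrite (_ : [set u : R | _] = `]0, +oo[%classic `&` B); first exact: measurableI.
  by apply/seteqP; split => u /=; rewrite in_itv/= andbT.
- exact: measurableC.
- apply: etrans (probability_setC (erl k) mI) _.
  rewrite erl_tail /full_tail ltxx /erlang_tail.
  case: k k0 => // k _; rewrite big_ord_recl poisson_weight0 mulr0 expR0.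
  rewrite big1 ?addr0 ?subee// => l _.
  by rewrite poisson_weight_at0.
- move=> u /= /contrapT; rewrite in_itv/= andbT => u0; split=> [[]//|Bu]; by split.
Qed.

Definition level_law (D : set R) k j : \bar R :=
  (\int[Q j]_f erl k [set u : R | D (lev c f u)])%E.

Definition after_passage (D : set R) z : set (Pi * R) :=
  [set x | (hit c z x.1 < x.2%:E)%E /\ D (lev c x.1 x.2)].

Lemma measurable_level_event (D : set R) : measurable D ->
  measurable [set x : Pi * R | D (lev c x.1 x.2)].
Proof.
move=> mD; have msw : measurable_fun setT (fun x : Pi * R => (x.2, x.1)).
  by apply: measurable_fun_pair.
exact: (measurable_preimageT (measurableT_comp (measurable_lev c) msw) mD).
Qed.

Lemma measurable_after_passage (D : set R) z : measurable D ->
  measurable (after_passage D z).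
Proof.
move=> mD; apply: measurableI; last exact: measurable_level_event.
have mh : measurable_fun setT (fun x : Pi * R => hit c z x.1) by exact: measurable_hit_at.
have mu : measurable_fun setT (fun x : Pi * R => x.2%:E).
  by apply/measurable_EFinP.
apply: measurable_bool_set; exact: measurable_fun_lte.
Qed.

(** For a condition on the final level only, the shifted event is again one: after
    the passage the level is counted from [- z]. *)
Lemma after_passage_law (D : set R) z i k : 0 <= z -> measurable D ->
  (\int[Q i]_f erl k [set u : R | after_passage D z (f, u)] =
   \sum_(n < k) \sum_j (V n z i j)%:E *
      level_law [set y : R | D (y - z)%R] (k - n) j)%E.
Proof.
move=> z0 mD; pose D' : set R := [set y : R | D (y - z)].
have mD' : measurable D'.
  have ms : measurable_fun setT (fun y : R => y - z) by exact: measurable_funB.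
  exact: (measurable_preimageT ms mD).
pose J' : set (Pi * R) := [set x | 0 < x.2 /\ D' (lev c x.1 x.2)].
have mJ' : measurable J'.
  apply: measurableI; last exact: measurable_level_event.
  apply: measurable_bool_set; exact: measurable_fun_ltr.
rewrite (first_passage_decomposition (J' := J') i k z0) //.
- apply: eq_bigr => n _; apply: eq_bigr => j _; congr (_ * _)%E.
  apply: eq_integral => f _; apply: erl_positive; first by rewrite subn_gt0.
  have := measurable_xsection f (measurable_level_event mD').
  by rewrite xsection_comp.
- exact: measurable_after_passage.
- by move=> f u [].
- by move=> f u [].
- move=> f s u E; have s0 : 0 <= s by rewrite -lee_fin -E hit_ge0.
  rewrite /after_passage /J' /D' /= E lte_fin subr_gt0.
  have lE : s < u -> lev c f u = lev c (shift s f) (u - s) - z.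
    move=> su; rewrite -{1}(subrKC s u) [LHS]lev_shift//; last by rewrite subr_ge0 ltW.
    by rewrite (lev_hit z0 E) addrC.
  by split=> -[su]; rewrite lE.
Qed.

(* The event that the minimum is at most [x] is expressed by the passages below
   the levels [- zs q], for a sequence [zs] which increases to [- x]. *)
Variable zs : nat -> R.
Hypothesis zs_ge0 : forall q, 0 <= zs q.

Definition after_passages (D : set R) : set (Pi * R) :=
  [set x | (forall q, hit c (zs q) x.1 < x.2%:E)%E /\ D (lev c x.1 x.2)].

Lemma after_passagesE (D : set R) : after_passages D = \bigcap_q after_passage D (zs q).
Proof.
apply/seteqP; split => x /=; first by move=> [h Dx] q _; split.
by move=> h; split => [q|]; [case: (h q I)|case: (h 0%N I)].
Qed.

Lemma measurable_after_passages (D : set R) : measurable D -> measurable (after_passages D).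
Proof.
move=> mD; rewrite after_passagesE; apply: bigcap_measurableType => q _.
exact: measurable_after_passage.
Qed.

(** The decomposition at the first passage below the initial level: afterwards
    the path starts at level [0] again, and the event is the same. *)
Lemma after_passages_law (D : set R) i k : measurable D ->
  (\int[Q i]_f erl k [set u : R | after_passages D (f, u)] =
   \sum_(n < k) \sum_j (V n 0 i j)%:E *
      \int[Q j]_f erl (k - n)%N [set u : R | after_passages D (f, u)])%E.
Proof.
move=> mD; apply: first_passage_decomposition => //.
- exact: measurable_after_passages.
- exact: measurable_after_passages.
- by move=> f u [h _]; apply: le_lt_trans (h 0%N); exact: hit_homo.
- move=> f u [h _]; rewrite -lte_fin; exact: le_lt_trans (hit_ge0 _ _ _) (h 0%N).
- move=> f s u E; have s0 : 0 <= s by rewrite -lee_fin -E hit_ge0.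
  have hE q : (hit c (zs q) f < u%:E)%E = (hit c (zs q) (shift s f) < (u - s)%:E)%E.
    have := hit_add (lexx 0) (zs_ge0 q) E; rewrite add0r => ->.
    by rewrite EFinB lteBrDl.
  have lE : s < u -> lev c f u = lev c (shift s f) (u - s).
    move=> su; rewrite -{1}(subrKC s u) [LHS]lev_shift//; last by rewrite subr_ge0 ltW.
    by rewrite (lev_hit (lexx 0) E) oppr0 add0r.
  have su q : (hit c (zs q) (shift s f) < (u - s)%:E)%E -> s < u.
    by move=> h; rewrite -subr_gt0 -lte_fin; exact: le_lt_trans (hit_ge0 _ _ _) h.
  rewrite /after_passages /=; split=> -[h Df].
    have h' q : (hit c (zs q) (shift s f) < (u - s)%:E)%E by rewrite -hE.
    by split=> //; rewrite -(lE (su 0%N (h' 0%N))).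
  by split => [q|]; [rewrite hE|rewrite (lE (su 0%N (h 0%N)))].
Qed.

End first_passage_decomposition.

(** * The running minimum *)

Section running_minimum.
Context {R : realType} {m : nat}.
Notation Pi := (trajectory R m).
Notation S := 'I_m.+1.
Implicit Types (s r z x y h e u : R) (i j : S) (n l k q : nat) (f : Pi).
Variable c : S -> R.

Lemma has_lbound_lev f u : has_lbound [set lev c f s | s in `[0, u]].
Proof.
exists (- (rate_bound c * u)) => _ [s + <-]; rewrite /= in_itv/= => /andP[s0 su].
have := lev_bound c f s0; rewrite ler_norml => /andP[+ _]; apply: le_trans.
rewrite lerN2 ler_wpM2l//; exact/ltW/rate_bound_gt0.
Qed.

Lemma inf_lev_le0 f u : inf [set lev c f s | s in `[0, u]] <= 0.
Proof.
have [u0|u0] := leP 0 u; last first.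
  by rewrite set_itv_ge ?image_set0 ?inf0// bnd_simp -ltNge.
apply: ge_inf; first exact: has_lbound_lev.
by exists 0; rewrite ?lev0//= in_itv/= lexx u0.
Qed.

(** By continuity of the level, a value reached at the final time is also
    approached strictly before it. *)
Lemma inf_lev_leP f u z (zs : nat -> R) : (forall q, 0 <= zs q) -> (forall q, zs q < z) ->
  (forall e, 0 < e -> exists q, z - zs q < e) ->
  (inf [set lev c f s | s in `[0, u]] <= - z <-> forall q, (hit c (zs q) f < u%:E)%E).
Proof.
move=> zs0 zsz zslim; split=> [h q|h].
  have [u0|u0] := leP 0 u; last first.
    move: h; rewrite set_itv_ge ?image_set0 ?inf0; last by rewrite bnd_simp -ltNge.
    by rewrite oppr_ge0 leNgt (le_lt_trans (zs0 q) (zsz q)).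
  have ne : [set lev c f s | s in `[0, u]] !=set0.
    by exists (lev c f 0), 0 => //=; rewrite in_itv/= lexx u0.
  have lt : inf [set lev c f s | s in `[0, u]] < - zs q.
    by apply: le_lt_trans h _; rewrite ltrN2.
  have [_ [s + <-] fs] := inf_lt ne lt.
  rewrite /= in_itv/= => /andP[s0 su].
  have spos : 0 < s.
    rewrite lt_neqAle s0 andbT; apply/eqP => E; move: fs.
    by rewrite -E lev0 ltNge oppr_le0 zs0.
  pose e := (- zs q - lev c f s) / rate_bound c.
  have C0 := rate_bound_gt0 c.
  have e0 : 0 < e by rewrite divr_gt0// subr_gt0.
  (* an earlier time, kept positive by the first argument of the maximum *)
  pose s' := Num.max (s / 2) (s - e / 2).
  have s's : s' < s by rewrite /s' gt_max; apply/andP; split; lra.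
  have s'0 : 0 < s' by rewrite /s' lt_max divr_gt0.
  apply/hit_ltP; exists s'; first by rewrite s'0 (lt_le_trans s's).
  have := lev_lipschitz c f (ltW s'0) (ltW s's); rewrite ler_norml => /andP[H _].
  have : s - s' < e.
    have : s - e / 2 <= s' by rewrite /s' le_max lexx orbT.
    lra.
  rewrite /e ltr_pdivlMr// => H2.
  lra.
have key e : 0 < e -> inf [set lev c f s | s in `[0, u]] <= - z + e.
  move=> e0; have [q zq] := zslim e e0.
  have /hit_ltP[s /andP[s0 su] fs] := h q.
  have : inf [set lev c f s | s in `[0, u]] <= lev c f s.
    apply: ge_inf; first exact: has_lbound_lev.
    by exists s => //=; rewrite in_itv/= !ltW.
  lra.
by apply/ler_addgt0Pr => e /key.
Qed.

Variable p : R -> S -> S -> R.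
Variable Q : S -> probability Pi R.
Hypothesis Q_cylinder : forall i (w : seq (R * S)), sorted time_le w ->
  all (fun tj => 0 <= tj.1) w -> Q i (cylinder w) = (chain_prob p 0 i w)%:E.
Hypothesis c_neq0 : forall i, c i != 0.
Variable nu : R.
Hypothesis nu_gt0 : 0 < nu.
Variables (A : 'M[R]_m.+1) (Kp : R).
Hypothesis p0 : forall i j, p 0 i j = (i == j)%:R.
Hypothesis p_expansion : forall h i j, 0 <= h <= 1 ->
  `|p h i j - (i == j)%:R - h * A i j| <= Kp * h ^+ 2.
Variable erl : nat -> probability R R.
Hypothesis erl_tail : forall k (t : R), erl k `]t, +oo[%classic = (full_tail nu k t)%:E.
Notation V := (passage_prob Q c nu).

Lemma slice_measure i k (J : set (Pi * R)) :
  (Q i \x erl k)%E J = (\int[Q i]_f erl k [set u : R | J (f, u)])%E.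
Proof. by apply: eq_integral => f _ /=; rewrite xsection_comp. Qed.

(** The probability that the passage below [- z] occurs before stage [k]. *)
Definition passage_mass k z i : R := \sum_(n < k) \sum_j V n z i j.

Lemma after_passage_mass k z i : 0 <= z ->
  (Q i \x erl k)%E (after_passage c setT z) = (passage_mass k z i)%:E.
Proof.
move=> z0; rewrite slice_measure (after_passage_law Q_cylinder c nu_gt0 erl_tail)//.
rewrite -sumEFin; apply: eq_bigr => n _; rewrite -sumEFin; apply: eq_bigr => j _.
rewrite [X in (_ * X)%E](_ : _ = 1%E) ?mule1// /level_law.
transitivity (\int[Q j]_f (cst 1%E f : \bar R))%E.
  by apply: eq_integral => f _; exact: probability_setT.
rewrite integral_cst//= mul1e; exact: probability_setT.
Qed.

Lemma passage_mass_limit k z i (zs : nat -> R) (a : \bar R) : 0 <= z ->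
  (forall q, 0 <= zs q) -> (forall q, zs q < z) ->
  (forall e, 0 < e -> exists q, z - zs q < e) ->
  (forall q, a <= (passage_mass k (zs q) i)%:E)%E -> (a <= (passage_mass k z i)%:E)%E.
Proof.
move=> z0 zs0 zsz zslim H.
have [M M0 L] : lipschitz_half (passage_mass k ^~ i).
  apply: lipschitz_half_sum => n; apply: lipschitz_half_sum => j.
  exact: (passage_lipschitz_exists Q_cylinder c_neq0 nu_gt0 p0 p_expansion n i j).
apply/lee_addgt0Pr => e e0.
have M1 : 0 < M + 1 by rewrite ltr_wpDl.
have [q zq] := zslim (e / (M + 1)) (divr_gt0 e0 M1).
apply: le_trans (H q) _; rewrite -EFinD lee_fin -lerBlDl.
apply: le_trans (ler_norm _) _; apply: le_trans (L _ _ (zs0 q) z0) _.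
rewrite distrC ger0_norm ?subr_ge0 ?ltW//.
move: zq; rewrite ltr_pdivlMr//; have := zsz q; nra.
Qed.

(** The law of the running minimum has no atom at a negative level, since the
    passage probabilities depend continuously on the level. *)
Lemma after_passages_limit i k z (zs : nat -> R) (D : set R) : 0 <= z ->
  (forall q, 0 <= zs q) -> (forall q, zs q < z) ->
  (forall e, 0 < e -> exists q, z - zs q < e) -> measurable D ->
  (\int[Q i]_f erl k [set u : R | after_passages c zs D (f, u)] =
   \int[Q i]_f erl k [set u : R | after_passage c D z (f, u)])%E.
Proof.
move=> z0 zs0 zsz zslim mD; rewrite -!slice_measure.
have mT : measurable (setT : set R) by exact: measurableT.
have mps := measurable_after_passages c zs mT.
have mp := measurable_after_passage c z mT.
have sub : after_passage c setT z `<=` after_passages c zs setT.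
  move=> x [hx _]; split => // q; apply: le_lt_trans hx.
  by apply: hit_homo; exact/ltW.
apply: (@measure_eq_off_null _ _ _ _ _ _ (after_passages c zs setT `\` after_passage c setT z)).
- exact: measurable_after_passages.
- exact: measurable_after_passage.
- exact: measurableD.
- have fin : ((Q i \x erl k)%E (after_passage c setT z) < +oo)%E.
    by rewrite after_passage_mass// ltry.
  have le : ((Q i \x erl k)%E (after_passages c zs setT) <=
      (Q i \x erl k)%E (after_passage c setT z))%E.
    rewrite [leRHS]after_passage_mass//; apply: (passage_mass_limit z0 zs0 zsz zslim) => q.
    rewrite -after_passage_mass//; apply: le_measure; rewrite ?inE//.
      exact: measurable_after_passage.
    by rewrite after_passagesE => x /(_ q I).
  have E : ((Q i \x erl k)%E (after_passages c zs setT) =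
      (Q i \x erl k)%E (after_passages c zs setT `\` after_passage c setT z) +
      (Q i \x erl k)%E (after_passage c setT z))%E.
    by rewrite (measureDI (Q i \x erl k)%E mps mp) (setIidr sub).
  suff : ((Q i \x erl k)%E (after_passages c zs setT `\` after_passage c setT z) = 0)%E by [].
  move: le fin; rewrite E.
  set a := (Q i \x erl k)%E (_ `\` _); set b := (Q i \x erl k)%E _.
  have : (0 <= a)%E by exact: measure_ge0.
  have : (0 <= b)%E by exact: measure_ge0.
  case: b => [b| |]//; case: a => [a| |]// b0 a0; rewrite -?EFinD ?lee_fin.
    by rewrite gerDr => a1 _; apply/eqP; rewrite eq_le lee_fin a1 a0.
- move=> x nx; split=> -[h Dx]; split => //.
    apply: contrapT => hx; apply: nx; split; first by split.
    by move=> [].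
  by case: (sub x (conj h I)).
Qed.

End running_minimum.

(** * Stages and vectors of the model *)

Section stage_of_passage.
Context {R : realType} {m : nat}.
Notation Pi := (trajectory R m).
Notation S := 'I_m.+1.
Implicit Types (s r z x y h e : R) (i j : S) (n l k : nat) (f : Pi).
Variable p : R -> S -> S -> R.
Variable Q : S -> probability Pi R.
Hypothesis Q_cylinder : forall i (w : seq (R * S)), sorted time_le w ->
  all (fun tj => 0 <= tj.1) w -> Q i (cylinder w) = (chain_prob p 0 i w)%:E.
Hypothesis p0 : forall i j, p 0 i j = (i == j)%:R.
Variable c : S -> R.
Variable nu : R.
Hypothesis nu_gt0 : 0 < nu.
Variable erl : nat -> probability R R.
Hypothesis erl_tail : forall k (t : R), erl k `]t, +oo[%classic = (full_tail nu k t)%:E.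
Notation V := (passage_prob Q c nu).

Definition passage_in j : set (Pi * R) :=
  [set x : Pi * R | (hit c 0 x.1 < x.2%:E)%E /\ x.1 (fine (hit c 0 x.1)) = j].

Lemma measurable_passage_in j : measurable (passage_in j).
Proof.
have mh : measurable_fun setT (fun x : Pi * R => hit c 0 x.1) by exact: measurable_hit_at.
have mu : measurable_fun setT (fun x : Pi * R => x.2%:E) by apply/measurable_EFinP.
rewrite (_ : passage_in j = [set x : Pi * R | (hit c 0 x.1 < x.2%:E)%E] `&`
    [set x : Pi * R | 0 <= fine (hit c 0 x.1) /\ x.1 (fine (hit c 0 x.1)) = j]).
  apply: measurableI; first by apply: measurable_bool_set; exact: measurable_fun_lte.
  by apply: measurable_state_at => //; apply: measurableT_comp mh; exact: fine_measurable.
apply/seteqP; split => x /= [h1 h2]; last by case: h2.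
by do 2!split => //; exact/fine_ge0/hit_ge0.
Qed.

(** The probability that the passage precedes the [k]-th point of the clock is the
    sum over the earlier stages. *)
Lemma passage_in_law i j k :
  (\int[Q i]_f erl k [set u : R | passage_in j (f, u)] = (\sum_(l < k) V l 0 i j)%:E)%E.
Proof.
have m0 : measurable [set x : Pi * R | x.1 0 = j].
  have mp : measurable_fun setT (fst : Pi * R -> Pi) by [].
  exact: (measurable_preimageT mp (measurable_coordinate j (lexx 0))).
pose J' : set (Pi * R) := [set x : Pi * R | 0 < x.2 /\ x.1 0 = j].
have mJ' : measurable J'.
  apply: measurableI => //; apply: measurable_bool_set; exact: measurable_fun_ltr.
rewrite (first_passage_decomposition (c := c) Q_cylinder nu_gt0 erl_tail i k (J' := J') (lexx 0)) //.
- rewrite -sumEFin; apply: eq_bigr => l _.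
  have start (q : S) : (\int[Q q]_f erl (k - l)%N [set u : R | J' (f, u)] = ((q == j)%:R)%:E)%E.
    rewrite -p0 -(law_state Q_cylinder q j (lexx 0)) -[RHS]mul1e -integral_cst; last first.
      exact: measurable_coordinate.
    rewrite [RHS]integral_mkcond; apply: eq_integral => f _; rewrite patchE.
    have kl : (0 < k - l)%N by rewrite subn_gt0.
    case: ifPn; rewrite ?inE ?notin_setE /= => fj.
      rewrite (_ : [set u | _] = [set u : R | 0 < u /\ setT u]); last first.
        by apply/seteqP; split => u [].
      by apply: etrans (erl_positive erl_tail kl measurableT) _; exact: probability_setT.
    by rewrite (_ : [set u | _] = set0) ?measure0//; apply/seteqP; split => u // [].
  rewrite (bigD1 j)//= start eqxx mule1 big1 ?adde0// => q qj.
  by rewrite start (negbTE qj) mule0.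
- exact: measurable_passage_in.
- by move=> f u [].
- by move=> f u [].
- move=> f s u E; have s0 : 0 <= s by rewrite -lee_fin -E hit_ge0.
  by rewrite /passage_in /J' /= E lte_fin subr_gt0 /= ger0_norm// addr0.
Qed.

End stage_of_passage.

Lemma measurable_le_set (R : realType) (y : R) : measurable [set v : R | v <= y].
Proof.
rewrite (_ : [set v | _] = `]-oo, y]%classic); first exact: measurable_itv.
by apply/seteqP; split => t; rewrite /= in_itv.
Qed.

Section model_level.
Context {R : realType} {m : nat} d (Omega : measurableType d).
Notation Pi := (trajectory R m).
Notation S := 'I_m.+1.
Implicit Types (s r z x y h e u : R) (i j : S) (n l k q : nat) (f : Pi).
Variables (P : S -> probability Omega R) (phi : R -> Omega -> S) (A : 'M[R]_m.+1).
Variables (Y : nat -> {mfun Omega >-> R}) (nu : R) (c : S -> R).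
Hypothesis hphi : is_markov_chain P phi A.
Hypothesis hY : is_erlang_clock P phi Y nu.
Hypothesis nu_gt0 : 0 < nu.
Hypothesis c_neq0 : forall i, c i != 0.
Notation path := (path_of hphi).
Notation Q := (path_law hphi).
Notation V := (passage_prob Q c nu).
Notation erl := (erl P Y).

Lemma level_path t w : level phi c 0 t w = lev c (path w) t.
Proof. by rewrite /level add0r. Qed.

Lemma tau_minus_path w : tau_minus phi c 0 0 w = hit c 0 (path w).
Proof.
rewrite /tau_minus /hit oppr0; congr (ereal_inf [set t%:E | t in _]).
by apply/seteqP; split => t /=; rewrite level_path.
Qed.

Lemma level_min_path t w :
  level_min phi c 0 t w = inf [set lev c (path w) s | s in `[0, t]].
Proof.
rewrite /level_min; congr (inf _).
by apply/seteqP; split => _ [s st <-]; exists s => //; rewrite level_path.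
Qed.

Lemma clock_step_nonneg i n : P i (~` (Y n @^-1` `]0, +oo[%classic)) = 0%E.
Proof.
have mI : measurable (Y n @^-1` (`]0, +oo[%classic : set R)).
  by apply: measurable_preimageT => //; exact: measurable_itv.
apply: etrans (probability_setC (P i) mI) _.
have := exponential_tail (hY.1 i) n (lexx 0).
rewrite poisson_weight0 mulr0 expR0 => h.
by rewrite [X in (_ - X)%E](_ : _ = 1%E) ?subee.
Qed.

Let Q_cylinder := @path_law_cylinder _ _ _ _ _ _ _ hphi.
Let erl_law := erl_tail hphi hY nu_gt0.

Lemma transition0 i j : transition A 0 i j = (i == j)%:R.
Proof. by rewrite /transition scale0r expm0. Qed.

(** The event is the difference of two events as above, for [n.+1] and [n] points,
    which are nested up to a null event. *)
Lemma stage_law n i j :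
  P i (phase_stage_at phi Y (tau_minus phi c 0 0) j n) = (V n 0 i j)%:E.
Proof.
pose E k : set Omega := [set w | passage_in c j (path w, clock Y k w)].
have PE k : P i (E k) = (\sum_(l < k) V l 0 i j)%:E.
  rewrite /E (joint_law hphi hY nu_gt0); last exact: measurable_passage_in.
  exact: (passage_in_law Q_cylinder transition0 c nu_gt0 erl_law).
have mE k : measurable (E k).
  have := measurable_preimageT (measurable_clocked_path Y hphi k) (measurable_passage_in c j).
  by congr measurable; apply/seteqP; split => w; rewrite /E /= /clocked_path mclockE.
have -> : phase_stage_at phi Y (tau_minus phi c 0 0) j n = E n.+1 `\` E n.
  rewrite /phase_stage_at /E /passage_in; apply/seteqP; split => w /=.
    move=> [t [tE tj /andP[nt tn]]]; rewrite -tau_minus_path tE lte_fin.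
    by split => //= -[]; rewrite lte_fin ltNge nt.
  rewrite -tau_minus_path; have : (0 <= tau_minus phi c 0 0 w)%E.
    by rewrite tau_minus_path hit_ge0.
  case: (tau_minus phi c 0 0 w) => [t| |]//; last by move=> _ [[]].
  rewrite lte_fin => _ [[tn tj] h]; exists t; split => //.
  rewrite tn andbT leNgt; apply/negP => nt; apply: h.
  by rewrite lte_fin.
have EI : P i (E n.+1 `&` E n) = P i (E n).
  apply: (@measure_eq_off_null _ _ _ (P i) _ _ (~` (Y n @^-1` `]0, +oo[%classic))) => //.
  - exact: measurableI.
  - by apply: measurableC; apply: measurable_preimageT => //; exact: measurable_itv.
  - exact: clock_step_nonneg.
  - move=> w /contrapT /=; rewrite in_itv/= andbT => Yw; split => [[]//|En]; split => //.
    case: En => h1 h2; split => //=; apply: lt_le_trans h1 _.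
    by rewrite lee_fin /clock big_ord_recr /= lerDl ltW.
have D : P i (E n.+1) = (P i (E n.+1 `\` E n) + P i (E n))%E.
  by rewrite -EI; exact: (measureDI (P i) (mE n.+1) (mE n)).
rewrite !PE big_ord_recr /= in D; move: D.
have mD : measurable (E n.+1 `\` E n) by exact: measurableD.
have fin : P i (E n.+1 `\` E n) \is a fin_num.
  by rewrite ge0_fin_numE ?measure_ge0// probability_lty.
rewrite -(fineK fin) -EFinD => -[]; rewrite addrC => /addIr <-.
by [].
Qed.

Lemma r_vec_law y k i : (r_vec P phi Y c y k i)%:E =
  level_law Q c erl [set v : R | v <= y] k i.
Proof.
have mJ : measurable [set x : Pi * R | lev c x.1 x.2 <= y].
  exact: (measurable_level_event c (measurable_le_set y)).
rewrite /level_law -(joint_law hphi hY nu_gt0 i k mJ) /r_vec /=.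
rewrite (_ : [set w | level phi c 0 (clock Y k w) w <= y] =
   [set w | lev c (path w) (clock Y k w) <= y]).
  rewrite fineK// ge0_fin_numE ?measure_ge0//; apply: probability_lty.
  have := measurable_preimageT (measurable_clocked_path Y hphi k) mJ.
  by congr measurable; apply/seteqP; split => w /=; rewrite /clocked_path mclockE.
by apply/seteqP; split => w /=; rewrite level_path.
Qed.

Definition below z (q : nat) : R := z - z / q.+1%:R.

Lemma below_ge0 z q : 0 < z -> 0 <= below z q.
Proof.
move=> z0; rewrite /below subr_ge0 ler_pdivrMr ?ltr0n// ler_peMr ?(ltW z0)//.
by rewrite ler1n.
Qed.

Lemma below_lt z q : 0 < z -> below z q < z.
Proof. by move=> z0; rewrite /below ltrBlDr ltrDl divr_gt0. Qed.

Lemma below_lim z e : 0 < z -> 0 < e -> exists q, z - below z q < e.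
Proof.
move=> z0 e0; exists (Num.truncn (z / e)); rewrite /below opprB addrC subrK.
rewrite ltr_pdivrMr ?ltr0n// mulrC -ltr_pdivrMr//.
exact: truncnS_gt.
Qed.

Lemma P_vec_law x y k i : x < 0 -> (P_vec P phi Y c x y k i)%:E =
  (\int[Q i]_f erl k [set u : R | after_passages c (below (- x)) [set v : R | (v <= y)%R] (f, u)])%E.
Proof.
move=> x0; have z0 : 0 < - x by rewrite oppr_gt0.
have mD := measurable_le_set y.
have mJ := measurable_after_passages c (below (- x)) mD.
rewrite -(joint_law hphi hY nu_gt0 i k mJ) /P_vec /=.
rewrite (_ : [set w | _ /\ _] =
   [set w | after_passages c (below (- x)) [set v : R | v <= y] (path w, clock Y k w)]).
  rewrite fineK// ge0_fin_numE ?measure_ge0//; apply: probability_lty.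
  have := measurable_preimageT (measurable_clocked_path Y hphi k) mJ.
  by congr measurable; apply/seteqP; split => w /=; rewrite /clocked_path mclockE.
have H w := inf_lev_leP c (path w) (clock Y k w) (fun q => below_ge0 q z0)
  (fun q => below_lt q z0) (fun e => below_lim z0).
rewrite /after_passages; apply/seteqP; split => w /=; rewrite level_path level_min_path => -[h1 h2].
  by split => //; apply/H; rewrite opprK.
by split => //; rewrite -[x]opprK; apply/H.
Qed.

Lemma P_vec_nonneg x y k i : 0 <= x -> P_vec P phi Y c x y k i = r_vec P phi Y c y k i.
Proof.
move=> x0; rewrite /P_vec /r_vec; congr (fine (P i _)).
apply/seteqP; split => w /=; first by case.
by move=> h; split => //; rewrite level_min_path; exact: le_trans (inf_lev_le0 _ _ _) x0.
Qed.

End model_level.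

(** * The formulas *)

Section entrywise.
Context {R : realType} {m : nat} d (Omega : measurableType d).
Notation S := 'I_m.+1.
Implicit Types (x y : R) (i j : S) (n k : nat).
Variables (P : S -> probability Omega R) (phi : R -> Omega -> S) (A : 'M[R]_m.+1).
Variables (Y : nat -> {mfun Omega >-> R}) (nu : R) (c : S -> R).
Hypothesis hphi : is_markov_chain P phi A.
Hypothesis hY : is_erlang_clock P phi Y nu.
Hypothesis nu_gt0 : 0 < nu.
Hypothesis c_neq0 : forall i, c i != 0.
Notation V := (passage_prob (path_law hphi) c nu).

Let Q_cylinder := @path_law_cylinder _ _ _ _ _ _ _ hphi.
Let erl_law := erl_tail hphi hY nu_gt0.
Let p0 : forall i j, transition A 0 i j = (i == j)%:R := transition0 A.
Let p_expansion h i j : 0 <= h <= 1 ->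
  `|transition A h i j - (i == j)%:R - h * A i j| <= expm_remainder A * h ^+ 2.
Proof. exact: expm_expansion. Qed.

(** For every initial phase: for a descending one the identity is trivial, the
    passage being immediate. *)
Lemma P_vec_return x y k i : x < 0 -> P_vec P phi Y c x y k i =
  \sum_(n < k) \sum_j V n 0 i j * P_vec P phi Y c x y (k - n) j.
Proof.
move=> x0; apply: EFin_inj; rewrite (P_vec_law c hphi hY nu_gt0)//.
have mD := measurable_le_set y.
rewrite (after_passages_law Q_cylinder c nu_gt0 erl_law)//; last first.
  by move=> q; apply: below_ge0; rewrite oppr_gt0.
rewrite -sumEFin; apply: eq_bigr => n _; rewrite -sumEFin; apply: eq_bigr => j _.
by rewrite EFinM (P_vec_law c hphi hY nu_gt0).
Qed.

Lemma P_vec_first_passage x y k i : x < 0 -> P_vec P phi Y c x y k i =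
  \sum_(n < k) \sum_j V n (- x) i j * r_vec P phi Y c (y - x) (k - n) j.
Proof.
move=> x0; apply: EFin_inj; rewrite (P_vec_law c hphi hY nu_gt0)//.
have z0 : 0 < - x by rewrite oppr_gt0.
have mD := measurable_le_set y.
rewrite (after_passages_limit Q_cylinder c_neq0 nu_gt0 p0 p_expansion erl_law i k (ltW z0)
  (fun q => below_ge0 q z0) (fun q => below_lt q z0) (fun e => below_lim z0) mD).
rewrite (after_passage_law Q_cylinder c nu_gt0 erl_law i k (ltW z0) mD).
rewrite -sumEFin; apply: eq_bigr => n _; rewrite -sumEFin; apply: eq_bigr => j _.
rewrite EFinM (r_vec_law c hphi hY nu_gt0); congr (_ * level_law _ _ _ _ _ _)%E.
by apply/seteqP; split => v /=; rewrite opprK lerBrDr.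
Qed.

Lemma Psi_passage n u v :
  Psi P phi Y c n u v = V n 0 (phase_plus (c := c) u) (phase_minus (c := c) v).
Proof. by rewrite mxE (stage_law c hphi hY nu_gt0). Qed.

Lemma sum_passage_minus (a : S -> R) n z i : 0 <= z ->
  \sum_j V n z i j * a j = \sum_v V n z i (phase_minus (c := c) v) * a (phase_minus v).
Proof.
move=> z0; rewrite (sum_phases c_neq0) big1 ?add0r// => u _.
by rewrite passage_prob_plus ?mul0r// phase_plus_gt0.
Qed.

Lemma W_block_law L x (n : 'I_L) u v : 0 <= x -> W_block P phi Y c A nu x n u v =
  V n x (phase_minus (c := c) u) (phase_minus (c := c) v).
Proof.
move=> x0.
rewrite (W_block_passage Q_cylinder c_neq0 nu_gt0 p0 p_expansion Psi_passage n x0).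
by rewrite mxE.
Qed.

End entrywise.

Theorem theorem4p6 (R : realType) (m : nat) (A : 'M[R]_m) (c : 'I_m -> R)
    (nu : R) (L : nat) (d : measure_display) (Omega : measurableType d)
    (P : 'I_m -> probability Omega R) (phi : R -> Omega -> 'I_m)
    (Y : nat -> {mfun Omega >-> R})
    (hA : is_generator A) (hc : forall i, c i != 0)
    (hnu : 0 < nu) (hL : (1 <= L)%N)
    (hphi : is_markov_chain P phi A) (hY : is_erlang_clock P phi Y nu)
    (k : nat) (hk : (1 <= k)%N) (hkL : (k <= L)%N) (x y : R) :
  (x < 0 ->
     subp c (P_vec P phi Y c x y k) =
       \sum_(n < k) Psi P phi Y c n *m subm c (P_vec P phi Y c x y (k - n)) /\
     subm c (P_vec P phi Y c x y k) =
       \sum_(n < k) W_block P phi Y c A nu `|x| (widen_ord hkL n) *m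
                    subm c (r_vec P phi Y c (y - x) (k - n))) /\
  (0 <= x ->
     subp c (P_vec P phi Y c x y k) = subp c (r_vec P phi Y c y k) /\
     subm c (P_vec P phi Y c x y k) = subm c (r_vec P phi Y c y k)).
Proof.
case: m A c P phi hA hc hphi hY => [|m] A c P phi hA hc hphi hY.
  by do 2!split; apply/matrixP => u; case: (enum_val u).
split=> x0; last by split; apply/matrixP => u v; rewrite !mxE (P_vec_nonneg Y c hphi).
split; apply/matrixP => u v; rewrite mxE summxE.
  rewrite (P_vec_return c hphi hY hnu)//; apply: eq_bigr => n _.
  rewrite (sum_passage_minus nu hphi hc)// mxE; apply: eq_bigr => w _.
  by rewrite (Psi_passage hphi hY hnu) mxE.
rewrite (P_vec_first_passage hphi hY hnu hc)//; apply: eq_bigr => n _.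
rewrite (sum_passage_minus nu hphi hc) ?oppr_ge0 ?(ltW x0)// mxE; apply: eq_bigr => w _.
by rewrite (W_block_law hphi hY hnu hc)// mxE ltr0_norm.
Qed.
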